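(* Let $\alpha>0$ and $\beta>0$ with $\alpha\neq 1$, and let $D_{\alpha,\beta}:(0,+\infty)\to\mathbb{R}$ be defined by $D_{\alpha,\beta}(x)=\mathcal{L}_\beta F_{\alpha,\beta}(x)-F_{\alpha,\beta}(x)$, and $\overline{D}_{\alpha,\beta}=-D_{\alpha,\beta}$. The following equivalences hold. (a) $D_{\alpha,\beta}$ is completely monotonic if and only if $\alpha\in(0,1)$ and $\beta\ge\max(\alpha,1-\alpha)$. (b) $\overline{D}_{\alpha,\beta}$ is completely monotonic if and only if either $\alpha\in(1,2]$ and $\beta\ge 1$, or $\alpha\in(0,1)$ and $\beta\le\min(\alpha,1-\alpha)$.
   Context: A smooth function $f$ on $(0,+\infty)$ is completely monotonic (CM) if $(-1)^n f^{(n)}(x)\ge 0$ for all $n\ge 0$ and $x>0$ (in particular the zero function is CM). For $\alpha,\beta>0$ the generalized Mittag-Leffler function is the entire function $E_{\alpha,\beta}(z)=\sum_{n\ge 0}\frac{z^n}{\Gamma(\beta+\alpha n)}$, $z\in\mathbb{C}$. Set $F_{\alpha,\beta}(x)=E_{\alpha,\beta}(x^\alpha)$ for $x>0$, with $F_{\alpha,\beta}(0)=1/\Gamma(\beta)$. For $\beta>0$ the differential-difference operator $\mathcal{L}_\beta$ is $\mathcal{L}_\beta f(x)=f'(x)+\frac{\beta-1}{x}\,(f(x)-f(0))$. One has, for $x>0$, the convergent series representation $$D_{\alpha,\beta}(x)=\sum_{n\ge 1}\frac{x^{\alpha n-1}}{\Gamma(\beta+\alpha n-1)}-\sum_{n\ge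 0}\frac{x^{\alpha n}}{\Gamma(\beta+\alpha n)},$$ with the usual convention $1/\Gamma=0$ at the poles of $\Gamma$. *)

(* Defs.v *)
From mathcomp Require Import all_boot all_order all_algebra.
From mathcomp Require Import all_classical all_reals all_analysis.

Set Implicit Arguments.
Unset Strict Implicit.
Unset Printing Implicit Defensive.

Import Order.TTheory GRing.Theory Num.Theory.
Import numFieldNormedType.Exports.

Local Open Scope classical_set_scope.
Local Open Scope ring_scope.

(* Euler's integral; it is finite and equal to the Gamma function for x > 0,
   the only arguments at which it is used below. *)
Definition Gamma (R : realType) (x : R) : R :=
  \int[lebesgue_measure]_(t in `]0, +oo[) (t `^ (x - 1) * expR (- t)).

(* The restriction to the real line of the entire function E_{alpha,beta}. *)
Definition mittag_leffler (R : realType) (alpha beta z : R) : R :=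
  limn (series (fun n : nat => z ^+ n / Gamma (beta + alpha * n%:R))).

(* Meaningful on [0, +oo[ only.  As 0 `^ alpha = 0 for alpha != 0, the value
   at 0 is 1 / Gamma beta: see ml_pow0. *)
Definition ml_pow (R : realType) (alpha beta x : R) : R :=
  mittag_leffler alpha beta (x `^ alpha).

Definition diff_op (R : realType) (beta : R) (f : R -> R) (x : R) : R :=
  derive1 f x + (beta - 1) / x * (f x - f 0).

Definition ml_defect (R : realType) (alpha beta x : R) : R :=
  diff_op beta (ml_pow alpha beta) x - ml_pow alpha beta x.

Definition ml_defect_opp (R : realType) (alpha beta x : R) : R :=
  - ml_defect alpha beta x.

(* Both clauses only depend on the restriction of f to the open half-line. *)
Definition completely_monotonic (R : realType) (f : R -> R) : Prop :=
  (forall (n : nat) (x : R), 0 < x -> derivable (derive1n n f) x 1) /\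
  (forall (n : nat) (x : R), 0 < x -> 0 <= (-1) ^+ n * derive1n n f x).

Lemma ml_pow0 (R : realType) (alpha beta : R) : alpha != 0 ->
  ml_pow alpha beta 0 = (Gamma beta)^-1.
Proof.
move=> a0; rewrite /ml_pow powR0// /mittag_leffler.
apply: cvg_lim => //; rewrite -(cvg_shiftS (series _)) /=.
apply: cvg_near_cst; near=> n.
rewrite /series /= big_nat_recl//= expr0 mulr0 addr0 div1r big1 ?addr0// => i _.
by rewrite exprS !mul0r.
Unshelve. all: by end_near. Qed.

(* Main.v *)
(* Let D_b be the defect with parameter b.

   Let 0 < alpha < 2, alpha <> 1.  In Hankel's formula for 1/Gamma, the rays of the
   contour contribute incomplete Gamma integrals and the arc |z| = x an integral over
   the argument.  Summing over the terms of the series, the arcs cancel by oscillation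
   and the rays give
     D_1(x) = (1/pi) int_0^oo k(t) e^(-xt) dt,
     k(t) = sin(pi alpha) (1 + 1/t) t^alpha / (1 - 2 cos(pi alpha) t^alpha + t^(2 alpha)),
   while D_1(x) = - e^(-x) for alpha = 2.  Euler's Beta integral turns the series of
   D_(b+1) into a mixture int_0^oo m_b(v) D_1(x / (1 + v)) dv with m_b >= 0, and
   (x^b D_(b+1))' = x^(b-1) D_b.

   Hence D_b(x) is the limit for l -> 1+ of (l^b D_(b+1)(l x) - D_(b+1)(x)) / (l - 1),
   a mixture of Laplace transforms of l^(b-1) k(t/l) - k(t), whose sign is that of the
   variation of t^(1-b) k(t): nonincreasing for b >= max(alpha, 1 - alpha) and
   nondecreasing for b <= min(alpha, 1 - alpha).  For 1 < alpha < 2 the kernel k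
   is nonpositive, so - D_1 is completely monotonic, and the mixture settles b >= 1.

   Conversely, the leading term of D_b (or of D_b'' if alpha > 2) at 0 excludes
   alpha > 2 and gives the conditions involving 1 - alpha.  If D_b has a constant sign
   then x^b D_(b+1) is monotone, which is incompatible with its behaviour at 0 and
   at infinity for the remaining parameters. *)
Require Import Defs.
From mathcomp Require Import all_boot all_order all_algebra.
From mathcomp Require Import all_classical all_reals all_analysis.
From mathcomp Require Import measurable_realfun ring lra.

Set Implicit Arguments.
Unset Strict Implicit.
Unset Printing Implicit Defensive.

Import Order.TTheory GRing.Theory Num.Theory.
Import numFieldNormedType.Exports.

Local Open Scope classical_set_scope.
Local Open Scope ring_scope.

(** The argument stays over the reals: the contour enters only through a recursion for the arc
    integrals, an integration by parts on the rays and the reflection formula, which starts an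
    induction on the parameter. The arc has the argument x of the series as its radius, so on the
    outer rays the terms are powers of x/y < 1 and can be summed. A second identity for each term
    has no Gamma part and lives on rays inside the circle, where the powers are those of y/x < 1.
    Adding it makes the arcs even in the exponent, hence summable to a Dirichlet kernel, and both
    regions yield the same kernel because rho / (1 - 2 rho cos theta + rho^2) is invariant under rho
    -> 1/rho. The bound alpha < 2 keeps sin(alpha p / 2), the denominator of the Dirichlet kernel,
    positive for 0 < p <= pi. D_b is reached through an integral and then a limit of quotients.
    Complete monotonicity is therefore carried as positivity of all iterated differences, which
    survives both operations, and is turned into signs of derivatives only at the end, where the
    series supplies the smoothness. *)

Section Calculus.
Context {R : realType}.
Implicit Types (f g : R -> R) (x a b c : R).

(** Separates the computed derivative from the expected one: the tactic [isd] lets unification build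
    the former rule by rule and leaves the equation between the two as a goal. *)
Lemma isd_eq f x a b : is_derive x 1 f a -> a = b -> is_derive x 1 f b.
Proof. by move=> ? <-. Qed.

Lemma isd_cst x c : is_derive x 1 (fun=> c) 0.
Proof. exact: is_derive_cst. Qed.

Lemma isd_id x : is_derive x 1 (fun y => y) 1.
Proof. exact: is_derive_id. Qed.

Lemma isd_add f g x a b : is_derive x 1 f a -> is_derive x 1 g b ->
  is_derive x 1 (fun y => f y + g y) (a + b).
Proof. by move=> ? ?; exact: is_deriveD. Qed.

Lemma isd_opp f x a : is_derive x 1 f a -> is_derive x 1 (fun y => - f y) (- a).
Proof. by move=> ?; exact: is_deriveN. Qed.

Lemma isd_mul f g x a b : is_derive x 1 f a -> is_derive x 1 g b ->
  is_derive x 1 (fun y => f y * g y) (a * g x + f x * b).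
Proof.
move=> ? ?; have -> : a * g x + f x * b = f x *: b + g x *: a.
  by rewrite /GRing.scale /= addrC [g x * a]mulrC.
exact: is_deriveM.
Qed.

Lemma isd_comp h f x a b : is_derive x 1 f a -> is_derive (f x) 1 h b ->
  is_derive x 1 (fun y => h (f y)) (b * a).
Proof. by move=> ? ?; exact: is_derive1_comp. Qed.

Lemma isd_exp f x a : is_derive x 1 f a ->
  is_derive x 1 (fun y => expR (f y)) (expR (f x) * a).
Proof. by move=> ?; apply: isd_comp. Qed.

Lemma isd_cos f x a : is_derive x 1 f a ->
  is_derive x 1 (fun y => cos (f y)) (- sin (f x) * a).
Proof. by move=> ?; apply: isd_comp. Qed.

Lemma isd_sin f x a : is_derive x 1 f a ->
  is_derive x 1 (fun y => sin (f y)) (cos (f x) * a).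
Proof. by move=> ?; apply: isd_comp. Qed.

Lemma isd_inv f x a : f x != 0 -> is_derive x 1 f a ->
  is_derive x 1 (fun y => (f y)^-1) (- a / f x ^+ 2).
Proof.
move=> fx0 ?; have -> : - a / f x ^+ 2 = - (f x) ^- 2 *: a.
  by rewrite /GRing.scale /= !mulNr mulrC.
exact: is_deriveV.
Qed.

Lemma isd_powR x c : 0 < x -> is_derive x 1 (fun y => y `^ c) (c * x `^ (c - 1)).
Proof.
move=> x0; have xI : x \in `]0, +oo[ by rewrite in_itv/= x0.
apply: DeriveDef; first exact: derivable_powR.
by rewrite -derive1E powR_derive1.
Qed.

Lemma isd_continuous f x a : is_derive x 1 f a -> {for x, continuous f}.
Proof. by move=> [/derivable1_diffP /differentiable_continuous]. Qed.

Lemma isd_within f df (A : set R) : (forall x, A x -> is_derive x 1 f (df x)) ->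
  {within A, continuous f}.
Proof.
move=> h; apply: continuous_in_subspaceT => x /set_mem Ax.
exact: isd_continuous (h _ Ax).
Qed.

Lemma isd_ge0_le f df a b : a <= b ->
  (forall x, a <= x <= b -> is_derive x 1 f (df x)) ->
  (forall x, a <= x <= b -> 0 <= df x) -> f a <= f b.
Proof.
move=> ab fd df0.
have fd' x : x \in `]a, b[ -> is_derive x 1 f (df x).
  by rewrite in_itv/= => /andP[ax xb]; apply: fd; rewrite !ltW.
have fc : {within `[a, b], continuous f}.
  by apply: (@isd_within _ df) => x /=; rewrite in_itv/= => /fd.
have [c cab e] := MVT_segment ab fd' fc.
rewrite -subr_ge0 e mulr_ge0// ?subr_ge0//.
by apply: df0; move: cab; rewrite in_itv.
Qed.

Lemma isd0_eq f df a b : a <= b ->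
  (forall x, a <= x <= b -> is_derive x 1 f (df x)) ->
  (forall x, a <= x <= b -> df x = 0) -> f a = f b.
Proof.
move=> ab fd df0; apply/eqP; rewrite eq_le; apply/andP; split.
  by apply: (isd_ge0_le ab fd) => x /df0 ->.
rewrite -lerN2; apply: (@isd_ge0_le (fun x => - f x) (fun x => - df x) a b) => //.
  by move=> x /fd ?; apply: isd_opp.
by move=> x /df0 ->; rewrite oppr0.
Qed.

End Calculus.

Ltac isd1 := first [simple notypeclasses refine (isd_cst _ _) | lazymatch goal with
  | |- is_derive _ _ (fun y => y) _ => simple notypeclasses refine (isd_id _)
  | |- is_derive _ _ (fun y => y `^ _) _ => simple notypeclasses refine (isd_powR _ _)
  | |- is_derive _ _ (fun y => @?f y + @?g y) _ => simple notypeclasses refine (@isd_add _ f g _ _ _ _ _)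
  | |- is_derive _ _ (fun y => - @?f y) _ => simple notypeclasses refine (@isd_opp _ f _ _ _)
  | |- is_derive _ _ (fun y => @?f y * @?g y) _ => simple notypeclasses refine (@isd_mul _ f g _ _ _ _ _)
  | |- is_derive _ _ (fun y => (@?f y)^-1) _ => simple notypeclasses refine (@isd_inv _ f _ _ _ _)
  | |- is_derive _ _ (fun y => expR (@?f y)) _ => simple notypeclasses refine (@isd_exp _ f _ _ _)
  | |- is_derive _ _ (fun y => cos (@?f y)) _ => simple notypeclasses refine (@isd_cos _ f _ _ _)
  | |- is_derive _ _ (fun y => sin (@?f y)) _ => simple notypeclasses refine (@isd_sin _ f _ _ _)
  end].
Ltac isd := simple notypeclasses refine (isd_eq _ _); [shelve|repeat isd1|cbv beta].
Ltac isc := simple notypeclasses refine (isd_continuous _); [shelve|repeat isd1].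

(** * Scaling monotonicity of the kernel *)

Section Inequality.
Context {R : realType}.
Implicit Types (m u v w A B k : R).

Lemma cosh_le (a b : R) : 0 <= a <= b ->
  expR a + expR (- a) <= expR b + expR (- b).
Proof.
move=> /andP[a0 ab]; rewrite !expRN.
have A1 : 1 <= expR a by rewrite -expR0 ler_expR.
have AB : expR a <= expR b by rewrite ler_expR.
have A0 := expR_gt0 a; have B0 := expR_gt0 b.
rewrite -subr_ge0.
have -> : expR b + (expR b)^-1 - (expR a + (expR a)^-1) =
  (expR b - expR a) * (expR a * expR b - 1) / (expR a * expR b).
  by field; rewrite !expR_eq0.
rewrite divr_ge0 ?mulr_ge0// subr_ge0//.
by rewrite -[1]mulr1 ler_pM// (le_trans A1).
Qed.

(** Convexity of sinh on the half-line, read off the derivatives: m cosh v dominates m cosh(m v). *)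
Lemma sinh_scale m u : 0 <= m <= 1 -> 0 <= u ->
  expR (m * u) - expR (- (m * u)) <= m * (expR u - expR (- u)).
Proof.
move=> /andP[m0 m1] u0; rewrite -subr_ge0.
pose f v := m * (expR v - expR (- v)) - (expR (m * v) - expR (- (m * v))).
pose df v := m * (expR v + expR (- v)) - m * (expR (m * v) + expR (- (m * v))).
have fd x : 0 <= x <= u -> is_derive x 1 f (df x).
  by move=> _; rewrite /f /df; isd; ring.
have dfg x : 0 <= x <= u -> 0 <= df x.
  move=> /andP[x0 _]; rewrite subr_ge0 ler_wpM2l// cosh_le//.
  by rewrite mulr_ge0//= ler_piMl.
have := isd_ge0_le u0 fd dfg; rewrite /f !mulr0 oppr0 expR0; lra.
Qed.

(** Concavity of sin on [0, pi], by way of the monotonicity of sin x / x, whose derivative has the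
    sign of x cos x - sin x. The division leaves the cases v = 0 and l = 0 apart. *)
Lemma sin_scale (l v : R) : 0 <= l <= 1 -> 0 <= v <= pi ->
  l * sin v <= sin (l * v).
Proof.
move=> /andP[l0 l1] /andP[v0 vp].
have singe x : 0 <= x <= v -> 0 <= sin x.
  by move=> /andP[x0 xv]; apply: sin_ge0_pi; rewrite x0 (le_trans xv).
have h x : 0 <= x <= v -> x * cos x <= sin x.
  move=> /andP[x0 xv]; rewrite -subr_ge0.
  have := @isd_ge0_le R (fun x => sin x - x * cos x) (fun x => x * sin x) 0 x x0.
  rewrite sin0 mul0r subr0; apply.
    by move=> z _; isd; ring.
  by move=> z /andP[z0 zx]; rewrite mulr_ge0// singe// z0 (le_trans zx).
have : sin v * (l * v) <= v * sin (l * v).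
  have lv : l * v <= v by rewrite ler_piMl.
  have lv0 : 0 <= l * v by rewrite mulr_ge0.
  pose f x := sin (l * x) * x - l * x * sin x.
  rewrite -subr_ge0.
  have -> : v * sin (l * v) - sin v * (l * v) = 
     - ((l * v) * sin v) - - ( v * sin (l * v)) by ring.
  rewrite subr_ge0.
  have [->|v1] := eqVneq v 0; first by rewrite !mulr0 !mul0r.
  have {}v1 : 0 < v by rewrite lt_def v1.
  have [->|l2] := eqVneq l 0; first by rewrite !mul0r sin0 mulr0.
  have {}l2 : 0 < l by rewrite lt_def l2.
  have := @isd_ge0_le R (fun x => - (sin x / x)) (fun x => (sin x - x * cos x) / x ^+ 2) (l * v) v lv.
  rewrite !lerN2 => H.
  have : sin v / v <= sin (l * v) / (l * v).
    apply: H => x /andP[lx xv].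
      have x0 : x != 0 by rewrite gt_eqF// (lt_le_trans _ lx)// mulr_gt0.
      by isd => //; field.
    rewrite divr_ge0// ?sqr_ge0// subr_ge0 h// xv andbT (le_trans _ lx)//.
  rewrite ler_pdivrMr// mulrAC ler_pdivlMr ?mulr_gt0//; lra.
have [->|v1] := eqVneq v 0; first by rewrite !(mulr0, sin0) ?lexx.
have {}v1 : 0 < v by rewrite lt_def v1.
move=> hv; rewrite -(ler_pM2l v1).
by have -> : v * (l * sin v) = sin v * (l * v) by ring.
Qed.

(** The chord, the tangent at 0 with pi < 4, the trivial bound and the parabola 1 - (1 - m)^2. These
    polynomial bounds are all that the kernel inequality uses about cos(pi alpha). *)
Lemma sin_bounds m : 0 <= m <= 1 ->
  [/\ m <= sin (pi * m / 2), sin (pi * m / 2) <= 2 * m,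
      sin (pi * m / 2) <= 1 & sin (pi * m / 2) <= m * (2 - m)].
Proof.
move=> /andP[m0 m1]; have p0 : 0 < pi :> R := pi_gt0 R.
have p4 : pi < 4 :> R by have := @pihalf_lt2 R; rewrite ltr_pdivrMr//; lra.
split; last 2 first.
- exact: sin_le1.
(* The sine equals 1 - 2 sin^2((1 - m) pi / 4), and concavity bounds that inner sine below by (1 -
   m) sin(pi / 4), whose square is (1 - m)^2 / 2. *)
- have -> : pi * m / 2 = pi / 2 - pi * (1 - m) / 2 by field.
  rewrite sinB sin_pihalf cos_pihalf mul1r mul0r subr0.
  have -> : pi * (1 - m) / 2 = ((1 - m) * (pi / 4)) *+ 2.
    by rewrite -mulr_natr; field.
  rewrite cos_mulr2n cos2sin2.
  have p42 : (pi / 4) *+ 2 = pi / 2 :> R by rewrite -mulr_natr; field.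
  have s4 : sin (pi / 4) ^+ 2 = 1 / 2 :> R.
    have := cos_pihalf R; rewrite -p42 cos_mulr2n cos2sin2 mulr2n; lra.
  have s0 : 0 <= sin (pi / 4) :> R by apply: sin_ge0_pi; apply/andP; split; lra.
  have l01 : 0 <= 1 - m <= 1 by apply/andP; split; lra.
  have v0 : 0 <= (pi : R) / 4 <= pi by apply/andP; split; lra.
  have h := sin_scale l01 v0.
  have : ((1 - m) * sin (pi / 4)) ^+ 2 <= sin ((1 - m) * (pi / 4)) ^+ 2.
    by rewrite ler_pXn2r// nnegrE ?mulr_ge0//; [lra|apply: le_trans h; rewrite mulr_ge0//; lra].
  by rewrite exprMn s4 -[(1 - _) *+ 2]mulr_natr => HH; nra.
- have v0 : 0 <= (pi : R) / 2 <= pi by apply/andP; split; lra.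
  have := sin_scale (introT andP (conj m0 m1)) v0; rewrite sin_pihalf mulr1.
  by rewrite mulrA [m * pi]mulrC.
- have x0 : 0 <= pi * m / 2 by rewrite divr_ge0// mulr_ge0// ltW.
  have h : sin (pi * m / 2) <= pi * m / 2.
    have := @isd_ge0_le R (fun x => x - sin x) (fun x => 1 - cos x) 0 (pi * m / 2) x0.
    rewrite sin0 subr0 subr_ge0; apply.
    by move=> z _; rewrite subr_ge0 cos_le1.
  by apply: le_trans h _; rewrite ler_pdivrMr//; nra.
Qed.

(** The sign of [mnum] at the critical value beta = alpha = (1 + m) / 2, with y = 2 u and k = -
    cos(pi alpha), once a positive factor is removed. For u >= 0, after 1 / A <= A, the only
    positive term k (1 - m) B is absorbed by m A (1 + B^2) >= 2 m A B. For u < 0 the coefficient of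
    k is nonpositive, so k may be lowered to m, and convexity of sinh concludes. *)
Lemma ineq_large m k u : 0 <= m <= 1 -> m <= k -> k <= 2 * m ->
  forall A B, A = expR (m * u) -> B = expR u ->
  - (1 + m) * A - k * (1 + m) / B + 1 / A - m * A * B ^+ 2 + k * (1 - m) * B <= 0.
Proof.
move=> /andP[m0 m1] mk k2 A B EA EB.
have A0 : 0 < A by rewrite EA expR_gt0. have B0 : 0 < B by rewrite EB expR_gt0.
have [u0|u0] := leP 0 u.
  have A1 : 1 <= A by rewrite EA -expR0 ler_expR mulr_ge0.
  have B1 : 1 <= B by rewrite EB -expR0 ler_expR.
  have iA : 1 / A <= A by rewrite ler_pdivrMr//; nra.
  have kB : 0 <= k * (1 + m) / B by rewrite divr_ge0// ?mulr_ge0//; lra.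
  have h1 : 2 * B * (m * A) <= m * A * (1 + B ^+ 2).
    rewrite -subr_ge0 (_ : _ - _ = m * A * (B - 1) ^+ 2); last by ring.
    by rewrite mulr_ge0 ?sqr_ge0// mulr_ge0// ltW.
  have h2 : k * (1 - m) * B <= 2 * m * B by rewrite ler_pM2r//; nra.
  have h3 : 2 * m * B <= 2 * B * (m * A).
    have : 0 <= m * B * (A - 1) by rewrite !mulr_ge0 ?(ltW B0) ?subr_ge0//.
    nra.
  nra.
have w0 : 0 <= - u by lra.
have := @sinh_scale m (- u) (introT andP (conj m0 m1)) w0.
rewrite mulrN !opprK !expRN -EA -EB => h.
have B1 : B <= 1 by rewrite EB -expR0 ler_expR ltW.
have iB : 1 <= B^-1 by rewrite invf_ge1.
have iA0 : 0 < A^-1 by rewrite invr_gt0.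
have h1 : 0 <= (k - m) * ((1 + m) / B - (1 - m) * B).
  by rewrite mulr_ge0//; nra.
have h2 : 0 <= m * A * B ^+ 2 by rewrite mulr_ge0 ?sqr_ge0// mulr_ge0// ltW.
have h3 : 0 <= m ^+ 2 * (B^-1 + B) by rewrite mulr_ge0 ?sqr_ge0// ltW// addr_gt0// (lt_le_trans ltr01).
have h4 : 0 <= m * A by rewrite mulr_ge0 // ltW.
nra.
Qed.

(** The expression T satisfies T'' >= T. Since T'' - T = (d - 1)(d + 1) T, two integrations from
    T(0) = 2 m (1 - k) and T'(0) = 0 show that (T' + T) e^(-w) and then T e^w are nonnegative. The
    initial value is nonnegative because 1 - k = (1 - m)^2. *)
Lemma sinh_convex_le m w : 0 <= m <= 1 -> 0 <= w ->
  0 <= expR (m * w) + m * expR ((2 - m) * w) - (1 - m) * expR (- (m * w))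
       - m * (2 - m) * ((1 + m) * expR w - (1 - m) * expR (- w)).
Proof.
move=> /andP[m0 m1] w0; set k := m * (2 - m).
pose T w := expR (m * w) + m * expR ((2 - m) * w) - (1 - m) * expR (- (m * w))
       - k * ((1 + m) * expR w - (1 - m) * expR (- w)).
pose T1 w := m * expR (m * w) + m * (2 - m) * expR ((2 - m) * w) 
   + (1 - m) * m * expR (- (m * w)) - k * ((1 + m) * expR w + (1 - m) * expR (- w)).
pose T2 w := m ^+ 2 * expR (m * w) + m * (2 - m) ^+ 2 * expR ((2 - m) * w)
   - (1 - m) * m ^+ 2 * expR (- (m * w)) - k * ((1 + m) * expR w - (1 - m) * expR (- w)).
have dT (x : R) : is_derive x 1 T (T1 x) by rewrite /T /T1; isd; ring.
have dT1 (x : R) : is_derive x 1 T1 (T2 x) by rewrite /T1 /T2; isd; ring.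
(* Up to the factor (1 - m) / A and a nonnegative remainder this is A^2 - 1 <= m (B^2 - 1), a
   consequence of the convexity of sinh and of A <= B. *)
have T2T (x : R) : 0 <= x -> 0 <= T2 x - T x.
  move=> x0; set A := expR (m * x); set B := expR x.
  have A0 : 0 < A := expR_gt0 _; have B0 : 0 < B := expR_gt0 _.
  have EB : expR ((2 - m) * x) = B ^+ 2 / A.
    by rewrite /B -expRM_natl -expRB; congr expR; ring.
  have -> : T2 x - T x = (1 - m) / A * ((3 - m) * m * B ^+ 2 + (1 - m ^+ 2) - (1 + m) * A ^+ 2).
    by rewrite /T2 /T EB expRN -/A -/B; field; rewrite gt_eqF.
  have A1 : 1 <= A by rewrite -expR0 ler_expR mulr_ge0.
  have AB : A <= B by rewrite ler_expR ler_piMl.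
  rewrite mulr_ge0//; first by rewrite divr_ge0 ?subr_ge0// ltW.
  have := @sinh_scale m x (introT andP (conj m0 m1)) x0.
  rewrite !expRN -/A -/B => h.
  have h1 : A * (A - A^-1) <= A * (m * (B - B^-1)) by rewrite ler_pM2l.
  have h2 : A * (A - A^-1) = A ^+ 2 - 1 by field; rewrite gt_eqF.
  have h3 : A * (B - B^-1) <= B ^+ 2 - 1.
    have -> : A * (B - B^-1) = A / B * (B ^+ 2 - 1) by field; rewrite gt_eqF.
    rewrite ler_piMl//; last by rewrite ler_pdivrMr// mul1r.
    by rewrite subr_ge0; apply: exprn_ege1; apply: le_trans A1 AB.
  have B2 : 1 <= B ^+ 2 by apply: exprn_ege1; apply: le_trans A1 AB.
  have h4 : A ^+ 2 - 1 <= m * (B ^+ 2 - 1).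
    by rewrite -h2; apply: le_trans h1 _; rewrite mulrCA ler_wpM2l.
  have h5 : (1 + m) * (A ^+ 2 - 1) <= (1 + m) * (m * (B ^+ 2 - 1)) by rewrite ler_wpM2l//; lra.
  have h6 : 0 <= 2 * m * (1 - m) * B ^+ 2 by rewrite !mulr_ge0 ?sqr_ge0//; lra.
  nra.
have U0 (x : R) : 0 <= x -> 0 <= (T1 x + T x) * expR (- x).
  move=> x0.
  have := @isd_ge0_le R (fun w => (T1 w + T w) * expR (- w)) (fun x => (T2 x - T x) * expR (- x)) 0 x x0.
  have -> : (T1 0 + T 0) * expR (- 0) = 2 * m * (1 - k).
    by rewrite /T1 /T !mulr0 oppr0 expR0 /k; ring.
  move=> H; apply: le_trans (H _ _).
  - have : 0 <= 1 - k by rewrite /k; have := sqr_ge0 (1 - m); nra.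
    by move=> ?; rewrite !mulr_ge0.
  - move=> z _; have De : is_derive z 1 (fun w : R => expR (- w)) (- expR (- z)).
      by isd; ring.
    have D := isd_mul (isd_add (dT1 z) (dT z)) De.
    by refine (isd_eq D _); rewrite /=; ring.
  - by move=> z /andP[z0 _]; rewrite mulr_ge0 ?expR_ge0// T2T.
have := @isd_ge0_le R (fun w => T w * expR w) (fun x => (T1 x + T x) * expR x) 0 w w0.
have -> : T 0 * expR 0 = 2 * m * (1 - k).
  by rewrite /T !mulr0 oppr0 expR0 /k; ring.
move=> H; suff : 0 <= T w * expR w by rewrite pmulr_lge0 ?expR_gt0.
apply: le_trans (H _ _).
- have : 0 <= 1 - k by rewrite /k; have := sqr_ge0 (1 - m); nra.
  by move=> ?; rewrite !mulr_ge0.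
- move=> z _; have De : is_derive z 1 (@expR R) (expR z) by exact: is_derive_expR.
  have D := isd_mul (dT z) De.
  by refine (isd_eq D _); rewrite /=; ring.
- move=> z /andP[z0 _]; rewrite mulr_ge0 ?expR_ge0//.
  by have := U0 z z0; rewrite pmulr_lge0 ?expR_gt0.
Qed.

(** The counterpart at beta = 1 - alpha, with alpha = (1 - m) / 2 and k = cos(pi alpha). The
    expression is affine in k with slope (1 + m) / B - (1 - m) B, so k may be replaced by a bound:
    by m where the slope is nonpositive, otherwise by 1 for u >= 0 and by m (2 - m) for u < 0. *)
Lemma ineq_small m k u : 0 <= m <= 1 -> m <= k -> k <= 1 -> k <= m * (2 - m) ->
  forall A B, A = expR (m * u) -> B = expR u ->
  - m * A / B ^+ 2 - 1 / A + k * (1 + m) / B + (1 - m) * A - k * (1 - m) * B <= 0.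
Proof.
move=> /andP[m0 m1] mk k1 k2 A B EA EB.
have A0 : 0 < A by rewrite EA expR_gt0. have B0 : 0 < B by rewrite EB expR_gt0.
have [u0|u0] := leP 0 u.
  have A1 : 1 <= A by rewrite EA -expR0 ler_expR mulr_ge0.
  have AB : A <= B by rewrite EA EB ler_expR ler_piMl.
  have [K|K] := leP ((1 + m) / B) ((1 - m) * B).
    have := @sinh_scale m u (introT andP (conj m0 m1)) u0.
    rewrite !expRN -EA -EB => h.
    have h1 : 0 <= (k - m) * ((1 - m) * B - (1 + m) / B) by rewrite mulr_ge0// subr_ge0.
    have h2 : (1 - m) * (A - A^-1) <= (1 - m) * (m * (B - B^-1)) by rewrite ler_wpM2l//; lra.
    have h3 : 2 * m / B <= 1 / A + A / B ^+ 2.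
      have : 2 / B <= 1 / A + A / B ^+ 2.
        rewrite -subr_ge0 (_ : _ - _ = (A - B) ^+ 2 / (A * B ^+ 2)); last by field; rewrite !gt_eqF.
        by rewrite divr_ge0 ?sqr_ge0// mulr_ge0 ?sqr_ge0// ltW.
      by apply: le_trans; rewrite ler_pM2r ?invr_gt0//; lra.
    have h4 : m * (2 * m / B) <= m * (1 / A + A / B ^+ 2) by rewrite ler_wpM2l.
    nra.
  have h1 : 0 <= (1 - k) * ((1 + m) / B - (1 - m) * B) by rewrite mulr_ge0// subr_ge0// ltW.
  have h2 : 0 <= (1 - m) * (B - A) + (B - A) * (B - m * A) / (A * B ^+ 2).
    have mA : m * A <= B by apply: le_trans AB; rewrite ler_piMl// ltW.
    by rewrite addr_ge0 ?divr_ge0 ?mulr_ge0 ?sqr_ge0// ?subr_ge0// ltW.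
  have h3 : (1 - m) * (B - A) + (B - A) * (B - m * A) / (A * B ^+ 2) =
    m * A / B ^+ 2 + 1 / A - (1 + m) / B - (1 - m) * A + (1 - m) * B.
    by field; rewrite !gt_eqF.
  nra.
have w0 : 0 <= - u by lra.
have := @sinh_convex_le m (- u) (introT andP (conj m0 m1)) w0.
have -> : expR ((2 - m) * - u) = A / B ^+ 2.
  by rewrite EA EB -expRM_natl -expRB; congr expR; ring.
rewrite mulrN opprK opprK !expRN -EA -EB => h.
have B1 : B <= 1 by rewrite EB -expR0 ler_expR ltW.
have iB : 1 <= B^-1 by rewrite invf_ge1.
have h1 : 0 <= (m * (2 - m) - k) * ((1 + m) / B - (1 - m) * B).
  by rewrite mulr_ge0//; nra.
nra.
Qed.

End Inequality.

(** * The Laplace kernel and its critical exponents *)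

Section Kernel.
Context {R : realType}.
Implicit Types (alpha beta t y l : R).

(** The squared modulus |t^alpha - e^(i pi alpha)|^2. *)
Definition mden alpha t : R :=
  1 - 2 * cos (pi * alpha) * t `^ alpha + (t `^ alpha) ^+ 2.

Definition mlker alpha t : R :=
  sin (pi * alpha) * (1 + t^-1) * t `^ alpha / mden alpha t.

Lemma mden_ge alpha t : sin (pi * alpha) ^+ 2 <= mden alpha t.
Proof.
rewrite /mden -subr_ge0 sin2cos2.
by rewrite (_ : _ - _ = (t `^ alpha - cos (pi * alpha)) ^+ 2) ?sqr_ge0//; ring.
Qed.

Lemma mden_ge' alpha t : sin (pi * alpha) ^+ 2 * (t `^ alpha) ^+ 2 <= mden alpha t.
Proof.
rewrite /mden -subr_ge0 sin2cos2.
by rewrite (_ : _ - _ = (1 - t `^ alpha * cos (pi * alpha)) ^+ 2) ?sqr_ge0//; ring.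
Qed.

Lemma mden_gt0 alpha t : sin (pi * alpha) != 0 -> 0 < mden alpha t.
Proof. by move=> s0; apply: lt_le_trans (mden_ge _ _); rewrite exprn_even_gt0. Qed.

Lemma sin_pi_gt0 alpha : 0 < alpha < 1 -> 0 < sin (pi * alpha).
Proof.
move=> /andP[a0 a1]; apply: sin_gt0_pi; rewrite mulr_gt0 ?pi_gt0//=.
by rewrite -[ltRHS]mulr1 ltr_pM2l ?pi_gt0.
Qed.

(** Carries the sign of the derivative of [mscaled], hence, when sin(pi alpha) > 0, of the variation
    of t^(1 - beta) k(t) at t = e^y. *)
Definition mnum alpha beta y : R := let r := expR (alpha * y) in
  alpha * (1 + expR y) * (1 - r ^+ 2)
  + (expR y - beta * (1 + expR y)) * (r ^+ 2 - 2 * cos (pi * alpha) * r + 1).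

(** With B = e^(y/2), m = |2 alpha - 1| and A = B^m, every exponential becomes a monomial in A and
    B, and cos(pi alpha) becomes plus or minus sin(pi m / 2). *)
Lemma mnum_key alpha y : 0 < alpha < 1 ->
  mnum alpha (Num.max alpha (1 - alpha)) y <= 0.
Proof.
move=> /andP[a0 a1]; rewrite /mnum.
set B := expR (y / 2).
have EB : expR y = B ^+ 2 by rewrite -expRM_natl; congr expR; field.
have B0 : 0 < B := expR_gt0 _.
have [ah|ah] := leP alpha (1 - alpha).
  pose m := 1 - 2 * alpha; set A := expR (m * (y / 2)).
  have A0 : 0 < A := expR_gt0 _.
  have m01 : 0 <= m <= 1 by apply/andP; split; rewrite /m; lra.
  have Er : expR (alpha * y) = B / A.
    by rewrite -expRB; congr expR; rewrite /m; field.
  have Ec : cos (pi * alpha) = sin (pi * m / 2).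
    by rewrite -cosBpihalf -cosN; congr cos; rewrite /m; field.
  have [k1 k2 k3 k4] := sin_bounds m01.
  have := @ineq_small R m _ (y / 2) m01 k1 k3 k4 A B erefl erefl => h.
  rewrite Er Ec EB; set k := sin _ in h *.
  rewrite (_ : _ + _ = B ^+ 2 / A * (- m * A / B ^+ 2 - 1 / A + k * (1 + m) / B +
    (1 - m) * A - k * (1 - m) * B)); last by rewrite /m; field; rewrite !gt_eqF.
  by rewrite pmulr_rle0// divr_gt0 ?exprn_gt0.
pose m := 2 * alpha - 1; set A := expR (m * (y / 2)).
have A0 : 0 < A := expR_gt0 _.
have m01 : 0 <= m <= 1 by apply/andP; split; rewrite /m; lra.
have Er : expR (alpha * y) = A * B.
  by rewrite -expRD; congr expR; rewrite /m; field.
have Ec : cos (pi * alpha) = - sin (pi * m / 2).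
  by rewrite -cosDpihalf; congr cos; rewrite /m; field.
have [k1 k2 k3 k4] := sin_bounds m01.
have := @ineq_large R m _ (y / 2) m01 k1 k2 A B erefl erefl => h.
rewrite Er Ec EB; set k := sin _ in h *.
rewrite (_ : _ + _ = A * B ^+ 2 * (- (1 + m) * A - k * (1 + m) / B + 1 / A -
  m * A * B ^+ 2 + k * (1 - m) * B)); last by rewrite /m; field; rewrite !gt_eqF.
by rewrite pmulr_rle0// mulr_gt0 ?exprn_gt0.
Qed.

Lemma mnum_den_ge0 alpha y : 0 <= expR (alpha * y) ^+ 2 - 2 * cos (pi * alpha) * expR (alpha * y) + 1.
Proof.
set r := expR _; set c := cos _.
rewrite (_ : _ + 1 = (r - c) ^+ 2 + (1 - c ^+ 2)); last by ring.
by rewrite addr_ge0 ?sqr_ge0// -sin2cos2 sqr_ge0.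
Qed.

(** As [mnum] is nonincreasing in beta, the critical value is enough. *)
Lemma mnum_le0 alpha beta y : 0 < alpha < 1 -> Num.max alpha (1 - alpha) <= beta ->
  mnum alpha beta y <= 0.
Proof.
move=> a01 ab; apply: le_trans (mnum_key y a01); rewrite /mnum.
rewrite lerD2l ler_wpM2r ?mnum_den_ge0// lerD2l lerN2 ler_wpM2r//.
Qed.

(** Expresses the symmetry k(1/t) = t k(t), which exchanges beta with 1 - beta and reverses the
    variation. It also exchanges the two thresholds, since 1 - max(alpha, 1 - alpha) = min(alpha, 1
    - alpha). *)
Lemma mnum_sym alpha beta y :
  mnum alpha beta y = - (expR y * expR (alpha * y) ^+ 2) * mnum alpha (1 - beta) (- y).
Proof.
rewrite /mnum mulrN !expRN; set r := expR (alpha * y); set t := expR y.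
have r0 : r != 0 by rewrite gt_eqF ?expR_gt0.
have t0 : t != 0 by rewrite gt_eqF ?expR_gt0.
by field; rewrite r0 t0.
Qed.

Lemma mnum_ge0 alpha beta y : 0 < alpha < 1 -> beta <= Num.min alpha (1 - alpha) ->
  0 <= mnum alpha beta y.
Proof.
move=> a01 ab; rewrite mnum_sym mulNr oppr_ge0 pmulr_rle0 ?mulr_gt0 ?exprn_gt0 ?expR_gt0//.
by apply: mnum_le0 => //; move: ab; rewrite le_min ge_max => /andP[]; lra.
Qed.

(** The function t^(1 - beta) k(t) / sin(pi alpha) in the variable y = ln t, see [mlker_expR]. *)
Definition mscaled alpha beta y : R :=
  (1 + expR y) * expR ((alpha - beta) * y) /
  (expR (alpha * y) ^+ 2 - 2 * cos (pi * alpha) * expR (alpha * y) + 1).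

Lemma mscaled_derive alpha beta y : sin (pi * alpha) != 0 ->
  is_derive y 1 (mscaled alpha beta) (expR ((alpha - beta) * y) *
    mnum alpha beta y /
    (expR (alpha * y) ^+ 2 - 2 * cos (pi * alpha) * expR (alpha * y) + 1) ^+ 2).
Proof.
move=> s0; rewrite /mscaled.
have q0 : expR (alpha * y) * expR (alpha * y) - 2 * cos (pi * alpha) * expR (alpha * y) + 1 != 0.
  rewrite gt_eqF//; have := mden_gt0 (expR y) s0; rewrite /mden -expRM [y * _]mulrC.
  by move=> h; rewrite -expr2 addrC addrA addrAC.
under eq_fun do rewrite expr2.
by isd => //; rewrite /mnum; field.
Qed.

Lemma mlker_expR alpha beta y :
  mlker alpha (expR y) * expR ((1 - beta) * y) = sin (pi * alpha) * mscaled alpha beta y.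
Proof.
rewrite /mlker /mscaled /mden -expRM [y * _]mulrC -expRN.
set r := expR (alpha * y).
have -> : 1 - 2 * cos (pi * alpha) * r + r ^+ 2 = r ^+ 2 - 2 * cos (pi * alpha) * r + 1 by ring.
have -> : expR ((alpha - beta) * y) = expR (- y) * r * expR ((1 - beta) * y).
  by rewrite -!expRD; congr expR; ring.
have -> : 1 + expR y = (1 + expR (- y)) * expR y.
  by rewrite mulrDl -expRD addNr expR0 mul1r addrC.
rewrite -[_ * expR y * _]mulrA [expR y * _]mulrA [expR y * _]mulrA -expRD subrr expR0 mul1r.
by rewrite !mulrA [LHS]mulrAC.
Qed.

(** After multiplication by t^(1 - beta), the two sides are the values of t^(1 - beta) k(t) at t and
    at t / l. *)
Lemma mlker_scale_le alpha beta t l : 0 < alpha < 1 -> Num.max alpha (1 - alpha) <= beta ->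
  0 < t -> 1 <= l -> mlker alpha t <= l `^ (beta - 1) * mlker alpha (t / l).
Proof.
move=> a01 ab t0 l1; have l0 : 0 < l by apply: lt_le_trans l1.
have s0 := sin_pi_gt0 a01.
pose y := ln t; pose z := ln l.
have Et : t = expR y by rewrite lnK.
have El : l = expR z by rewrite lnK.
have z0 : 0 <= z by apply: ln_ge0.
rewrite Et El -expRB -expRM.
rewrite -(ler_pM2r (expR_gt0 ((1 - beta) * y))) mlker_expR.
rewrite [leRHS](_ : _ = mlker alpha (expR (y - z)) * expR ((1 - beta) * (y - z))); last first.
  by rewrite mulrAC -expRD mulrC; congr (_ * expR _); ring.
rewrite mlker_expR ler_pM2l//.
rewrite -lerN2.
pose d x := expR ((alpha - beta) * x) * mnum alpha beta x /
    (expR (alpha * x) ^+ 2 - 2 * cos (pi * alpha) * expR (alpha * x) + 1) ^+ 2.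
apply: (@isd_ge0_le R (fun x => - mscaled alpha beta x) (fun x => - d x)).
- by rewrite gerBl.
- by move=> x _; have ? := mscaled_derive beta x (lt0r_neq0 s0); apply: isd_opp.
- move=> x _; rewrite oppr_ge0 /d pmulr_lle0; last first.
    rewrite invr_gt0 exprn_even_gt0//=.
    have := mden_gt0 (expR x) (lt0r_neq0 s0); rewrite /mden -expRM [x * _]mulrC => h.
    by rewrite gt_eqF// addrC addrA addrAC.
  by rewrite pmulr_rle0 ?expR_gt0// mnum_le0.
Qed.

Lemma mlker_scale_ge alpha beta t l : 0 < alpha < 1 -> beta <= Num.min alpha (1 - alpha) ->
  0 < t -> 1 <= l -> l `^ (beta - 1) * mlker alpha (t / l) <= mlker alpha t.
Proof.
move=> a01 ab t0 l1; have l0 : 0 < l by apply: lt_le_trans l1.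
have s0 := sin_pi_gt0 a01.
pose y := ln t; pose z := ln l.
have Et : t = expR y by rewrite lnK.
have El : l = expR z by rewrite lnK.
have z0 : 0 <= z by apply: ln_ge0.
rewrite Et El -expRB -expRM.
rewrite -(ler_pM2r (expR_gt0 ((1 - beta) * y))) mlker_expR.
rewrite [leLHS](_ : _ = mlker alpha (expR (y - z)) * expR ((1 - beta) * (y - z))); last first.
  by rewrite mulrAC -expRD mulrC; congr (_ * expR _); ring.
rewrite mlker_expR ler_pM2l//.
pose d x := expR ((alpha - beta) * x) * mnum alpha beta x /
    (expR (alpha * x) ^+ 2 - 2 * cos (pi * alpha) * expR (alpha * x) + 1) ^+ 2.
apply: (@isd_ge0_le R (mscaled alpha beta) d).
- by rewrite gerBl.
- by move=> x _; have ? := mscaled_derive beta x (lt0r_neq0 s0).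
- by move=> x _; rewrite /d divr_ge0 ?sqr_ge0// mulr_ge0 ?expR_ge0 ?mnum_ge0//.
Qed.

End Kernel.

(** * Measurability and integration on the half-line *)

Section Meas.
Context {d} {T : measurableType d} {R : realType}.
Implicit Types (D : set T) (f g : T -> R).

(** Writes 1 / x as x (x^2)^(-1), so that the real power is taken of a nonnegative number; at 0 both
    sides are 0. *)
Lemma measurable_invr : measurable_fun [set: R] (@GRing.inv R).
Proof.
rewrite (_ : @GRing.inv R = fun x => x * ((x * x) `^ (-1))).
  apply: measurable_funM => //.
  by apply: (measurableT_comp (measurable_powR _)); exact: measurable_funM.
apply/funext => x; rewrite powR_inv1 -?expr2 ?sqr_ge0//.
have [->|x0] := eqVneq x 0; first by rewrite invr0 mul0r.
by field.
Qed.

Lemma mea_cst D (c : R) : measurable_fun D (fun _ : T => c).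
Proof. exact: measurable_cst. Qed.
Lemma mea_add D f g : measurable_fun D f -> measurable_fun D g -> measurable_fun D (fun x => f x + g x).
Proof. exact: measurable_funD. Qed.
Lemma mea_mul D f g : measurable_fun D f -> measurable_fun D g -> measurable_fun D (fun x => f x * g x).
Proof. exact: measurable_funM. Qed.
Lemma mea_opp D f : measurable_fun D f -> measurable_fun D (fun x => - f x).
Proof. exact: measurable_funN. Qed.
Lemma mea_exp D f : measurable_fun D f -> measurable_fun D (fun x => expR (f x)).
Proof. exact: (measurableT_comp (@measurable_expR R)). Qed.
Lemma mea_inv D f : measurable_fun D f -> measurable_fun D (fun x => (f x)^-1).
Proof. exact: (measurableT_comp measurable_invr). Qed.
Lemma mea_pow D f a : measurable_fun D f -> measurable_fun D (fun x => (f x) `^ a).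
Proof. exact: (measurableT_comp (@measurable_powR R a)). Qed.
Lemma mea_cos D f : measurable_fun D f -> measurable_fun D (fun x => cos (f x)).
Proof. exact: (measurableT_comp (continuous_measurable_fun (@continuous_cos R))). Qed.
Lemma mea_sin D f : measurable_fun D f -> measurable_fun D (fun x => sin (f x)).
Proof. exact: (measurableT_comp (continuous_measurable_fun (@continuous_sin R))). Qed.
Lemma mea_norm D f : measurable_fun D f -> measurable_fun D (fun x => `|f x|).
Proof. exact: (measurableT_comp (@normr_measurable R setT)). Qed.
Lemma mea_exprn D f n : measurable_fun D f -> measurable_fun D (fun x => (f x) ^+ n).
Proof. exact: measurable_funX. Qed.
Lemma mea_sum D (s : seq nat) (F : nat -> T -> R) : (forall n, measurable_fun D (F n)) ->
  measurable_fun D (fun x => \sum_(i <- s) F i x).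
Proof. by move=> mF; exact: measurable_sum. Qed.
End Meas.

Lemma mea_id (R : realType) (D : set R) : measurable_fun D (fun x : R => x).
Proof. exact: measurable_id. Qed.

Ltac mea1 := first [exact: mea_cst | lazymatch goal with
  | |- measurable_fun _ (fun y => y) => exact: mea_id
  | |- measurable_fun _ (fun y => @?f y + @?g y) => refine (@mea_add _ _ _ _ f g _ _)
  | |- measurable_fun _ (fun y => - @?f y) => refine (@mea_opp _ _ _ _ f _)
  | |- measurable_fun _ (fun y => @?f y * @?g y) => refine (@mea_mul _ _ _ _ f g _ _)
  | |- measurable_fun _ (fun y => (@?f y)^-1) => refine (@mea_inv _ _ _ _ f _)
  | |- measurable_fun _ (fun y => expR (@?f y)) => refine (@mea_exp _ _ _ _ f _)
  | |- measurable_fun _ (fun y => cos (@?f y)) => refine (@mea_cos _ _ _ _ f _)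
  | |- measurable_fun _ (fun y => sin (@?f y)) => refine (@mea_sin _ _ _ _ f _)
  | |- measurable_fun _ (fun y => (@?f y) `^ ?a) => refine (@mea_pow _ _ _ _ f a _)
  | |- measurable_fun _ (fun y => (@?f y) ^+ ?a) => refine (@mea_exprn _ _ _ _ f a _)
  | |- measurable_fun _ (fun y => `| @?f y |) => refine (@mea_norm _ _ _ _ f _)
  | |- measurable_fun _ (fun y => \sum_(i <- ?s) @?f i y) => refine (@mea_sum _ _ _ _ s (fun i y => f i y) _)
  end].
Ltac mea := repeat (mea1; cbv beta).

Section Integ.
Context {R : realType}.
Notation mu := (@lebesgue_measure R).
Implicit Types (D : set R) (f g : R -> R) (x c r : R).

Definition integ D f := mu.-integrable D (EFin \o f).

Lemma integ_le D f g : measurable D -> measurable_fun D f ->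
  (forall x, D x -> `|f x| <= g x) -> integ D g -> integ D f.
Proof.
move=> mD mf fg; apply: le_integrable => //; first exact/measurable_EFinP.
move=> x Dx /=; rewrite lee_fin; apply: le_trans (fg x Dx) _; exact: ler_norm.
Qed.

Lemma integ_sub D D' f : measurable D -> measurable D' -> D `<=` D' -> integ D' f -> integ D f.
Proof. by move=> mD mD' sub; exact: integrableS. Qed.

Lemma integ_add D f g : measurable D -> integ D f -> integ D g -> integ D (fun x => f x + g x).
Proof. by move=> mD fi gi; have := @integrableD _ _ R mu D mD _ _ fi gi. Qed.

Lemma integ_opp D f : measurable D -> integ D f -> integ D (fun x => - f x).
Proof. by move=> mD fi; have := @integrableN _ _ R mu D _ fi. Qed.

Lemma integ_sum D (s : seq nat) (h : nat -> R -> R) : measurable D ->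
  (forall n, integ D (h n)) -> integ D (fun x => \sum_(i <- s) h i x).
Proof.
move=> mD hi; rewrite /integ (_ : _ \o _ = fun x => (\sum_(i <- s) (h i x)%:E)%E).
  by apply: integrable_sum => // i _; exact: hi.
by apply/funext => x /=; rewrite sumEFin.
Qed.

Lemma integ_scale D f c : measurable D -> integ D f -> integ D (fun x => c * f x).
Proof. by move=> mD fi; have := @integrableZl _ _ R mu D mD c _ fi. Qed.

Lemma integ_eq D f g : measurable D -> (forall x, D x -> f x = g x) -> integ D f -> integ D g.
Proof.
by move=> mD fg; apply: (@eq_integrable _ _ R mu D mD (EFin \o f) (EFin \o g)) => x; rewrite inE/= => Dx; rewrite fg.
Qed.

Lemma integ_norm D f : measurable D -> integ D f -> integ D (fun x => `|f x|).
Proof. by move=> mD fi; exact: (@integrable_norm _ _ R mu D _ fi). Qed.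

Lemma integ_mea D f : integ D f -> measurable_fun D f.
Proof. by move=> fi; apply/measurable_EFinP; exact: (@measurable_int _ _ R mu D _ fi). Qed.

Lemma Rint_sum D (s : seq nat) (h : nat -> R -> R) : measurable D ->
  (forall n, integ D (h n)) ->
  \int[mu]_(x in D) (\sum_(i <- s) h i x) = \sum_(i <- s) \int[mu]_(x in D) h i x.
Proof.
move=> mD hi; elim: s => [|n s IH].
  under eq_Rintegral do rewrite big_nil.
  by rewrite big_nil Rintegral_cst// mul0r.
under eq_Rintegral do rewrite big_cons.
by rewrite RintegralD//; [rewrite IH big_cons|exact: hi|exact: integ_sum].
Qed.

Lemma Rint_add D f g : measurable D -> integ D f -> integ D g ->
  \int[mu]_(x in D) (f x + g x) = \int[mu]_(x in D) f x + \int[mu]_(x in D) g x.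
Proof. by move=> mD fi gi; exact: (@RintegralD _ _ R mu D f g mD fi gi). Qed.

Lemma Rint_sub D f g : measurable D -> integ D f -> integ D g ->
  \int[mu]_(x in D) (f x - g x) = \int[mu]_(x in D) f x - \int[mu]_(x in D) g x.
Proof. by move=> mD fi gi; exact: (@RintegralB _ _ R mu D f g mD fi gi). Qed.

Lemma Rint_scale D f c : measurable D -> integ D f ->
  \int[mu]_(x in D) (c * f x) = c * \int[mu]_(x in D) f x.
Proof. by move=> mD fi; exact: (@RintegralZl _ _ R mu D f c mD fi). Qed.

Lemma Rdct D (h : nat -> R -> R) f g : measurable D ->
  (forall n, measurable_fun D (h n)) ->
  (forall x, D x -> h n x @[n --> \oo] --> f x) ->
  integ D g -> (forall n x, D x -> `|h n x| <= g x) ->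
  integ D f /\ \int[mu]_(x in D) h n x @[n --> \oo] --> (\int[mu]_(x in D) f x : R).
Proof.
move=> mD mh hf gi hg.
have mf : measurable_fun D f by apply: measurable_fun_cvg hf.
have hf' x : D x -> (h n x)%:E @[n --> \oo] --> (f x)%:E.
  by move=> Dx; apply: cvg_EFin; [exact: nearW|exact: hf].
have [|||||fi _ c] := @dominated_convergence _ _ R mu D mD (fun n x => (h n x)%:E) (EFin \o f) (EFin \o g).
- by move=> n; apply/measurable_EFinP; exact: (mh n).
- by apply/measurable_EFinP; exact: mf.
- exact: aeW.
- by [].
- by apply: aeW => x n Dx; exact: hg.
split=> //; apply: fine_cvg; rewrite fineK//.
exact: (@integrable_fin_num _ _ R mu D mD _ fi).
Qed.

Lemma integ_ge0_EFin D f (r : R) : measurable D -> measurable_fun D f ->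
  (forall x, D x -> 0 <= f x) -> (\int[mu]_(x in D) (f x)%:E = r%:E)%E ->
  integ D f /\ \int[mu]_(x in D) f x = r.
Proof.
move=> mD mf f0 e; split; last by rewrite /Rintegral e.
apply/integrableP; split; first exact/measurable_EFinP.
rewrite (_ : (\int[mu]_(x in D) _ = r%:E)%E) ?ltry//.
by rewrite -e; apply: eq_integral => x; rewrite inE => Dx /=; rewrite ger0_norm// f0.
Qed.

Lemma integ_EFin D f : measurable D -> integ D f ->
  (\int[mu]_(x in D) (f x)%:E = (\int[mu]_(x in D) f x)%:E)%E.
Proof. by move=> mD fi; rewrite /Rintegral fineK//; exact: integrable_fin_num. Qed.

End Integ.

(** * Improper integrals by primitives and by scaling *)

Section FTC.
Context {R : realType}.
Notation mu := (@lebesgue_measure R).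
Implicit Types (D : set R) (f g F : R -> R) (x y a b c l : R).

Local Notation pos := (`]0, +oo[%classic : set R).

Lemma measurable_pos : measurable pos.
Proof. exact: measurable_itv. Qed.

Lemma mea_within D f df : measurable D -> (forall x, D x -> is_derive x 1 f (df x)) -> measurable_fun D f.
Proof.
move=> mD h; apply: subspace_continuous_measurable_fun => //.
exact: isd_within h.
Qed.

(** Monotone convergence along the cut-offs [u n]: an integrand that may be singular at 0 is
    integrated on intervals bounded away from 0, and the result passes to the limit. *)
Lemma cvg_int0 (b : itv_bound R) f (u : nat -> R) :
  (forall n, 0 < u n) -> nonincreasing_seq u -> u n @[n --> \oo] --> 0 ->
  measurable_fun [set` Interval (BRight 0) b] f ->
  (forall x, [set` Interval (BRight 0) b] x -> 0 <= f x) ->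
  (\int[mu]_(x in [set` Interval (BLeft (u n)) b]) (f x)%:E)%E @[n --> \oo] -->
  (\int[mu]_(x in [set` Interval (BRight 0%R) b]) (f x)%:E)%E.
Proof.
move=> u0 nu cu mf f0.
have sub n : [set` Interval (BLeft (u n)) b] `<=` [set` Interval (BRight 0) b].
  move=> x /=; rewrite !itv_boundlr !bnd_simp => /andP[ux ->].
  by rewrite (lt_le_trans (u0 n)).
have -> : [set` Interval (BRight 0) b] = \bigcup_n [set` Interval (BLeft (u n)) b].
  apply/seteqP; split=> [x /=|x [n _]]; last exact: sub.
  rewrite itv_boundlr bnd_simp => /andP[x0 xb].
  have [n _ /(_ n (leqnn n))] := cvgr_lt 0 cu _ x0.
  by move=> ux; exists n => //=; rewrite itv_boundlr !bnd_simp xb ltW.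
apply: (@ge0_nondecreasing_set_cvg_integral _ (measurableTypeR R) R (fun n => [set` Interval (BLeft (u n)) b]) (fun x => (f x)%:E) mu).
- move=> m n mn; rewrite subsetEset => x /=.
  rewrite !itv_boundlr !bnd_simp => /andP[ux ->]; rewrite andbT.
  by apply: le_trans ux; exact: nu.
- by move=> n; exact: measurable_itv.
- move=> n; have mfn : measurable_fun [set` Interval (BLeft (u n)) b] f.
    by apply: measurable_funS mf; [exact: measurable_itv|exact: sub].
  by apply/measurable_EFinP; exact: mfn.
- by move=> n x /sub /f0 ?; rewrite lee_fin.
Qed.

Lemma harmonic_scaled (c : R) : 0 < c -> [/\ forall n, 0 < c * harmonic n,
  nonincreasing_seq (fun n => c * harmonic n) & c * harmonic n @[n --> \oo] --> (0 : R)].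
Proof.
move=> c0; split.
- by move=> n; rewrite mulr_gt0 ?harmonic_gt0.
- by move=> m n mn; rewrite ler_pM2l// lef_pV2 ?posrE// ler_nat.
- by rewrite -[X in _ --> X](mulr0 c); apply: cvgM; [exact: cvg_cst|exact: cvg_harmonic].
Qed.

Lemma cvg_at_right_seq F (l : R) (u : nat -> R) : (forall n, 0 < u n) ->
  u n @[n --> \oo] --> 0 -> F x @[x --> 0^'+] --> l -> F (u n) @[n --> \oo] --> l.
Proof.
move=> u0 cu cF; have h := (cvg_at_rightP F 0 l).1 cF; by apply: h.
Qed.

(** Nonnegativity makes integrability a conclusion: the integrals truncated at 1 / (n + 1) are
    differences of F with a finite limit. *)
Lemma FTC_pos f F (l0 l : R) :
  (forall x, 0 < x -> 0 <= f x) ->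
  (forall x, 0 < x -> is_derive x 1 F (f x)) ->
  (forall x, 0 < x -> {for x, continuous f}) ->
  F x @[x --> 0^'+] --> l0 -> F x @[x --> +oo] --> l ->
  integ pos f /\ \int[mu]_(x in pos) f x = l - l0.
Proof.
move=> f0 dF cf Fl0 Fl.
have cf' D : (forall x, D x -> 0 < x) -> {within D, continuous f}.
  by move=> D0; apply: continuous_in_subspaceT => x /set_mem /D0 /cf.
have mf : measurable_fun pos f.
  apply: subspace_continuous_measurable_fun; first exact: measurable_pos.
  by apply: cf' => x /=; rewrite in_itv/= andbT.
apply: integ_ge0_EFin => //.
  by move=> x /=; rewrite in_itv/= andbT => /f0.
have [u0 nu cu] := harmonic_scaled (@ltr01 R).
have f0' x : pos x -> 0 <= f x by rewrite /= in_itv/= andbT => /f0.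
have := cvg_int0 u0 nu cu mf f0'.
have h n : (\int[mu]_(x in [set` Interval (BLeft (1 * harmonic n)%R) +oo%O]) (f x)%:E = (l - F (1 * harmonic n))%R%:E)%E.
  have un := u0 n; set a := 1 * harmonic n in un *.
  rewrite EFinB; apply: (@ge0_continuous_FTC2y R f F a l) => //.
  - by move=> x ax; apply: f0; apply: lt_le_trans ax.
  - by apply: cf' => x /=; rewrite in_itv/= andbT; apply: lt_le_trans.
  - by move=> x ax; have [] := dF x (lt_trans un ax).
  - by apply: cvg_at_right_filter; apply: isd_continuous (dF _ un).
  - move=> x; rewrite in_itv/= andbT => ax.
    by rewrite derive1E; have [_ ->] := dF x (lt_trans un ax).
move=> c; apply: cvg_unique c _; first exact: (@ereal_hausdorff R).
rewrite (_ : (fun n => _) = fun n => (l - F (1 * harmonic n))%R%:E); last first.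
  by apply/funext => n; exact: h.
apply: cvg_EFin; first exact: nearW.
apply: cvgB; first exact: cvg_cst.
exact: cvg_at_right_seq Fl0.
Qed.

Lemma FTC_0c f F (l0 b : R) : 0 < b ->
  (forall x, 0 < x <= b -> 0 <= f x) ->
  (forall x, 0 < x <= b -> is_derive x 1 F (f x)) ->
  (forall x, 0 < x <= b -> {for x, continuous f}) ->
  F x @[x --> 0^'+] --> l0 ->
  integ `]0, b] f /\ \int[mu]_(x in `]0, b]) f x = F b - l0.
Proof.
move=> b0 f0 dF cf Fl0.
have cf' D : (forall x, D x -> 0 < x <= b) -> {within D, continuous f}.
  by move=> D0; apply: continuous_in_subspaceT => x /set_mem /D0 /cf.
have mf : measurable_fun `]0, b] f.
  apply: subspace_continuous_measurable_fun; first exact: measurable_itv.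
  by apply: cf' => x /=; rewrite in_itv.
have f0' x : `]0, b]%classic x -> 0 <= f x by rewrite /= in_itv/= => /f0.
apply: integ_ge0_EFin => //.
(* The factor b / 2 keeps every cut-off strictly below b. *)
have [u0 nu cu] := harmonic_scaled (divr_gt0 b0 (@ltr0n R 2)).
have := cvg_int0 u0 nu cu mf f0'.
have h n : (\int[mu]_(x in [set` Interval (BLeft (b / 2 * harmonic n)%R) (BRight b)]) (f x)%:E = (F b - F (b / 2 * harmonic n))%R%:E)%E.
  have un := u0 n.
  have ub : b / 2 * harmonic n < b.
    have : harmonic n <= 1 :> R by rewrite /harmonic invf_le1// ler1n.
    have := @harmonic_gt0 R n; nra.
  set a := b / 2 * harmonic n in un ub *.
  have dF' x : a <= x <= b -> is_derive x 1 F (f x).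
    by move=> /andP[ax xb]; apply: dF; rewrite xb (lt_le_trans un).
  rewrite EFinB; apply: (@continuous_FTC2 R f F a b) => //.
  - by apply: cf' => x /=; rewrite in_itv/= => /andP[ax ->]; rewrite (lt_le_trans un).
  - split.
    + by move=> x; rewrite in_itv/= => /andP[ax xb]; have [] := dF' x (introT andP (conj (ltW ax) (ltW xb))).
    + by apply: cvg_at_right_filter; apply: isd_continuous (dF' a _); rewrite lexx ltW.
    + by apply: cvg_at_left_filter; apply: isd_continuous (dF' b _); rewrite lexx ltW.
  - move=> x; rewrite in_itv/= => /andP[ax xb].
    by rewrite derive1E; have [_ ->] := dF' x (introT andP (conj (ltW ax) (ltW xb))).
move=> c; apply: cvg_unique c _; first exact: (@ereal_hausdorff R).
rewrite (_ : (fun n => _) = fun n => (F b - F (b / 2 * harmonic n))%R%:E); last first.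
  by apply/funext => n; exact: h.
apply: cvg_EFin; first exact: nearW.
apply: cvgB; first exact: cvg_cst.
exact: cvg_at_right_seq Fl0.
Qed.

Lemma FTC_cy f F (a l : R) :
  (forall x, a <= x -> 0 <= f x) ->
  (forall x, a <= x -> is_derive x 1 F (f x)) ->
  (forall x, a <= x -> {for x, continuous f}) ->
  F x @[x --> +oo] --> l ->
  integ `[a, +oo[ f /\ \int[mu]_(x in `[a, +oo[) f x = l - F a.
Proof.
move=> f0 dF cf Fl.
have cf' : {within `[a, +oo[, continuous f}.
  by apply: continuous_in_subspaceT => x /set_mem; rewrite /= in_itv/= andbT => /cf.
have mf : measurable_fun `[a, +oo[ f.
  by apply: subspace_continuous_measurable_fun; first exact: measurable_itv.
apply: integ_ge0_EFin => //.
  by move=> x /=; rewrite in_itv/= andbT => /f0.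
rewrite EFinB; apply: (@ge0_continuous_FTC2y R f F a l) => //.
- by move=> x /ltW /dF[].
- by apply: cvg_at_right_filter; apply: isd_continuous (dF _ (lexx a)).
- by move=> x; rewrite in_itv/= andbT => /ltW /dF[_ <-]; rewrite derive1E.
Qed.

Lemma FTC_cc f F (a b : R) : a < b ->
  (forall x, a <= x <= b -> is_derive x 1 F (f x)) ->
  (forall x, a <= x <= b -> {for x, continuous f}) ->
  integ `[a, b] f /\ \int[mu]_(x in `[a, b]) f x = F b - F a.
Proof.
move=> ab dF cf.
have cf' : {within `[a, b], continuous f}.
  by apply: continuous_in_subspaceT => x /set_mem; rewrite /= in_itv/= => /cf.
split; first by apply: continuous_compact_integrable => //; exact: segment_compact.
rewrite /Rintegral (@continuous_FTC2 R f F a b)//.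
- split.
  + by move=> x; rewrite in_itv/= => /andP[ax xb]; have [] := dF x (introT andP (conj (ltW ax) (ltW xb))).
  + by apply: cvg_at_right_filter; apply: isd_continuous (dF a _); rewrite lexx ltW.
  + by apply: cvg_at_left_filter; apply: isd_continuous (dF b _); rewrite lexx ltW.
- move=> x; rewrite in_itv/= => /andP[ax xb].
  by rewrite derive1E; have [_ ->] := dF x (introT andP (conj (ltW ax) (ltW xb))).
Qed.

(** Stated for extended integrals of nonnegative functions, so that a finite value on one side also
    yields integrability on the other. *)
Lemma scale_pos f (c : R) : 0 < c -> (forall x, 0 < x -> 0 <= f x) ->
  (forall x, 0 < x -> {for x, continuous f}) ->
  (\int[mu]_(x in pos) (f x)%:E = \int[mu]_(x in pos) (c * f (c * x))%R%:E)%E.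
Proof.
move=> c0 f0 cf.
have cf' D : (forall x, D x -> 0 < x) -> {within D, continuous f}.
  by move=> D0; apply: continuous_in_subspaceT => x /set_mem /D0 /cf.
have cg x : 0 < x -> {for x, continuous (fun x => c * f (c * x))}.
  move=> x0; apply: cvgM; first exact: cvg_cst; apply: (@continuous_comp _ _ _ (fun x => c * x) f).
    by apply: cvgM; first exact: cvg_cst; exact: cvg_id.
  by apply: cf; rewrite mulr_gt0.
have cg' D : (forall x, D x -> 0 < x) -> {within D, continuous (fun x => c * f (c * x))}.
  by move=> D0; apply: continuous_in_subspaceT => x /set_mem /D0 /cg.
have posE x : pos x -> 0 < x by rewrite /= in_itv/= andbT.
have mf : measurable_fun pos f.
  by apply: subspace_continuous_measurable_fun; [exact: measurable_pos|exact: cf'].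
have mg : measurable_fun pos (fun x => c * f (c * x)).
  by apply: subspace_continuous_measurable_fun; [exact: measurable_pos|exact: cg'].
have f0' x : pos x -> 0 <= f x by move=> /posE /f0.
have g0' x : pos x -> 0 <= c * f (c * x).
  by move=> /posE x0; rewrite mulr_ge0 ?(ltW c0)// f0// mulr_gt0.
have [u0 nu cu] := harmonic_scaled (@ltr01 R).
have [v0 nv cv] := harmonic_scaled c0.
have h1 := cvg_int0 u0 nu cu mg g0'.
have h2 := cvg_int0 v0 nv cv mf f0'.
apply: cvg_unique h2 _; first exact: (@ereal_hausdorff R).
apply: cvg_trans h1; apply: near_eq_cvg; apply: nearW => n.
rewrite mul1r; have := @harmonic_gt0 R n; set a := harmonic n => a0.
have E := @increasing_ge0_integration_by_substitutiony R (fun x => c * x) f a.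
have D1 : derive1 (fun x => c * x) = cst c.
  by apply/funext => x; rewrite derive1E; have [_ ->] : is_derive x 1 (fun x => c * x) c by isd; ring.
rewrite E ?D1.
- by apply: eq_integral => x _; rewrite /= fctE /= mulrC.
- by move=> x y _ _ xy; rewrite ltr_pM2l.
- by move=> x _; exact: cst_continuous.
- by apply: is_cvg_cst.
- by apply: is_cvg_cst.
- split; last by apply: cvg_at_right_filter; apply: cvgM; first exact: cvg_cst; exact: cvg_id.
  by move=> x _; have [] : is_derive x 1 (fun x => c * x) c by isd; ring.
- by apply: gt0_cvgMry => //; exact: cvg_id.
- by apply: cf' => x /=; rewrite in_itv/= andbT; apply: lt_le_trans; rewrite mulr_gt0.
- by move=> x; rewrite in_itv/= andbT => ax; apply: f0; apply: lt_trans ax; rewrite mulr_gt0.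
Qed.

End FTC.

(** * Gamma and Beta integrals *)

Section Gamma.
Context {R : realType}.
Notation mu := (@lebesgue_measure R).
Implicit Types (D : set R) (f g : R -> R) (x y a b c t p s : R).

Local Notation pos := (`]0, +oo[%classic : set R).

Lemma in_pos x : pos x -> 0 < x.
Proof. by rewrite /= in_itv/= andbT. Qed.

Lemma integ_setU A B f : measurable A -> measurable B -> [disjoint A & B] ->
  integ A f -> integ B f ->
  integ (A `|` B) f /\ \int[mu]_(x in A `|` B) f x = \int[mu]_(x in A) f x + \int[mu]_(x in B) f x.
Proof.
move=> mA mB AB fA fB.
have mf : measurable_fun (A `|` B) f.
  by apply/measurable_funU => //; split; apply: integ_mea.
have fU : integ (A `|` B) f.
  apply/integrableP; split; first by apply/measurable_EFinP; exact: mf.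
  have mn : measurable_fun (A `|` B) (fun x => `|f x|) by exact: mea_norm.
  rewrite (@ge0_integral_setU _ (measurableTypeR R) R mu A B)//.
    rewrite lte_add_pinfty//.
    - by have /integrableP[] := fA.
    - by have /integrableP[] := fB.
  by apply/measurable_EFinP; exact: mn.
split=> //; exact: (@Rintegral_setU _ (measurableTypeR R) R mu).
Qed.

Lemma integ_pos_split b f : 0 < b -> integ `]0, b] f -> integ `]b, +oo[ f ->
  integ pos f /\ \int[mu]_(x in pos) f x = \int[mu]_(x in `]0, b]) f x + \int[mu]_(x in `]b, +oo[) f x.
Proof.
move=> b0 f1 f2.
have -> : pos = `]0, b]%classic `|` `]b, +oo[%classic.
  by rewrite -itv_bndbnd_setU// bnd_simp ltW.
apply: integ_setU => //.
apply/disj_setPS => y [/=]; rewrite 2!in_itv/= => /andP[_ yx] /andP[].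
by rewrite ltNge yx.
Qed.

Definition gint p t := t `^ (p - 1) * expR (- t).

(** From ln z <= z - 1 at z = t / (2 p). The factor 2 leaves half of the exponential decay to
    [gint_integ]. *)
Lemma powR_le_exp p t : 0 < p -> 0 < t -> t `^ p <= (2 * p) `^ p * expR (t / 2).
Proof.
move=> p0 t0; rewrite /powR !gt_eqF ?mulr_gt0// -expRD ler_expR.
have : ln (t / (2 * p)) <= t / (2 * p) - 1.
  have := @le_ln1Dx R (t / (2 * p) - 1); rewrite [1 + _]addrC subrK; apply.
  by rewrite ltrBrDr addNr divr_gt0 ?mulr_gt0.
rewrite ln_div ?posrE ?mulr_gt0// => h.
have : p * (ln t - ln (2 * p)) <= p * (t / (2 * p) - 1) by rewrite ler_pM2l.
have -> : p * (t / (2 * p) - 1) = t / 2 - p by field; rewrite gt_eqF.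
lra.
Qed.

Lemma gint_ge0 p t : 0 <= gint p t.
Proof. by rewrite mulr_ge0 ?powR_ge0 ?expR_ge0. Qed.

Lemma mea_gint D p : measurable_fun D (gint p).
Proof. by rewrite /gint; mea. Qed.

Lemma gint_cont p t : 0 < t -> {for t, continuous (gint p)}.
Proof.
move=> t0; apply: isd_continuous; rewrite /gint; repeat isd1.
by [].
Qed.

Lemma cvg_powRN c : 0 < c -> t `^ (- c) @[t --> +oo] --> (0 : R).
Proof.
move=> c0; apply/cvgrPdist_lt => e e0; near=> t.
have t0 : 0 < t by near: t; exact: nbhs_pinfty_gt.
rewrite sub0r normrN ger0_norm ?powR_ge0//.
have te : e `^ (- c^-1) < t by near: t; apply: nbhs_pinfty_gt; rewrite num_real.
have -> : e = (e `^ (- c^-1)) `^ (- c).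
  by rewrite -powRrM mulrNN mulVf ?gt_eqF// powRr1// ltW.
rewrite (powRN t c) (powRN _ c) ltf_pV2 ?posrE ?powR_gt0//.
by apply: gt0_ltr_powR => //; rewrite ?nnegrE ?powR_ge0 ?(ltW t0).
Unshelve. all: by end_near. Qed.

Lemma cvg_expRN c : 0 < c -> expR (- (c * t)) @[t --> +oo] --> (0 : R).
Proof.
move=> c0; apply: (cvg_comp (fun t => c * t) (fun x => expR (- x)) _ (@cvgr_expR R)).
by apply: gt0_cvgMry => //; exact: cvg_id.
Qed.

Lemma cvg_powR0 c : 0 < c -> t `^ c @[t --> 0^'+] --> (0 : R).
Proof. exact: powR_cvg0. Qed.

Lemma integ_pow01 c b : 0 < c -> 0 < b ->
  integ `]0, b] (fun t => t `^ (c - 1)) /\ \int[mu]_(t in `]0, b]) (t `^ (c - 1)) = b `^ c / c.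
Proof.
move=> c0 b0; have := @FTC_0c R (fun t => t `^ (c - 1)) (fun t => t `^ c / c) 0 b b0.
rewrite subr0; apply.
- by move=> x _; exact: powR_ge0.
- by move=> x /andP[x0 _]; isd => //; field; rewrite gt_eqF.
- by move=> x /andP[x0 _]; apply: isd_continuous (isd_powR (c - 1) x0).
- by rewrite -[X in _ --> X](mul0r c^-1); apply: cvgM; [exact: cvg_powR0|exact: cvg_cst].
Qed.

Lemma integ_pow1y c b : 0 < c -> 0 < b ->
  integ `[b, +oo[ (fun t => t `^ (- c - 1)) /\ \int[mu]_(t in `[b, +oo[) (t `^ (- c - 1)) = b `^ (- c) / c.
Proof.
move=> c0 b0; have := @FTC_cy R (fun t => t `^ (- c - 1)) (fun t => - (t `^ (- c) / c)) b 0.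
rewrite sub0r opprK; apply.
- by move=> x _; exact: powR_ge0.
- by move=> x bx; isd; [exact: lt_le_trans bx|field; rewrite gt_eqF].
- by move=> x bx; apply: isd_continuous (isd_powR (- c - 1) _); exact: lt_le_trans bx.
- rewrite -[X in _ --> X]oppr0; apply: cvgN.
  by rewrite -[X in _ --> X](mul0r c^-1); apply: cvgM; [exact: cvg_powRN|exact: cvg_cst].
Qed.

Lemma integ_exp1y c b : 0 < c ->
  integ `[b, +oo[ (fun t => expR (- (c * t))) /\ \int[mu]_(t in `[b, +oo[) expR (- (c * t)) = expR (- (c * b)) / c.
Proof.
move=> c0; have := @FTC_cy R (fun t => expR (- (c * t))) (fun t => - (expR (- (c * t)) / c)) b 0.
rewrite sub0r opprK; apply.
- by move=> x _; exact: expR_ge0.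
- by move=> x bx; isd; field; rewrite gt_eqF.
- move=> x bx; apply: isd_continuous; repeat isd1.
- rewrite -[X in _ --> X]oppr0; apply: cvgN.
  by rewrite -[X in _ --> X](mul0r c^-1); apply: cvgM; [exact: cvg_expRN|exact: cvg_cst].
Qed.

Lemma gint_integ p : 0 < p -> integ pos (gint p).
Proof.
move=> p0; apply: (integ_pos_split ltr01 _ _).1.
  apply: (integ_le _ _ _ (integ_pow01 p0 ltr01).1) => //; first exact: mea_gint.
  move=> t /=; rewrite in_itv/= => /andP[t0 _]; rewrite ger0_norm ?gint_ge0//.
  by rewrite ler_piMr ?powR_ge0// -expR0 ler_expR oppr_le0 ltW.
apply: (@integ_sub _ _ `[1, +oo[) => //; first by apply: subset_itvr; rewrite bnd_simp.
have h2 : 0 < 2^-1 :> R by rewrite invr_gt0.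
apply: (integ_le _ _ _ (integ_scale ((2 * p) `^ p) _ (integ_exp1y 1 h2).1)) => //; first exact: mea_gint.
move=> t /=; rewrite in_itv/= andbT => t1; rewrite ger0_norm ?gint_ge0//.
have t0 : 0 < t by apply: lt_le_trans t1.
apply: (@le_trans _ _ ((2 * p) `^ p * expR (t / 2) * expR (- t))).
  rewrite ler_pM2r ?expR_gt0//; apply: le_trans (powR_le_exp p0 t0).
  by apply: ler_powR => //; rewrite gerBl.
by rewrite -mulrA -expRD ler_wpM2l ?powR_ge0// ler_expR; lra.
Qed.

Lemma GammaE p : Gamma p = \int[mu]_(t in pos) gint p t.
Proof. by []. Qed.

Lemma Gamma_EFin p : 0 < p -> (\int[mu]_(t in pos) (gint p t)%:E = (Gamma p)%:E)%E.
Proof. by move=> p0; rewrite GammaE integ_EFin//; exact: gint_integ. Qed.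

Lemma Rint_le D f g : measurable D -> integ D f -> integ D g -> (forall x, D x -> f x <= g x) ->
  \int[mu]_(x in D) f x <= \int[mu]_(x in D) g x.
Proof. by move=> mD fi gi fg; exact: (@le_Rintegral _ _ R mu D f g mD fi gi fg). Qed.

Lemma Rint_ge0 D f : (forall x, D x -> 0 <= f x) -> 0 <= \int[mu]_(x in D) f x.
Proof. by move=> f0; exact: Rintegral_ge0. Qed.

Lemma Rint_sub_le D E f : measurable D -> measurable E -> D `<=` E -> integ E f ->
  (forall x, E x -> 0 <= f x) -> \int[mu]_(x in D) f x <= \int[mu]_(x in E) f x.
Proof.
move=> mD mE DE fE f0; rewrite -lee_fin -!integ_EFin//; last exact: integ_sub DE fE.
apply: (@ge0_subset_integral _ (measurableTypeR R) R mu D E) => //.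
  by apply/measurable_EFinP; exact: (integ_mea fE).
Qed.

Lemma Rint_cst_itv (a b c : R) : a <= b -> \int[mu]_(x in `[a, b]) c = c * (b - a).
Proof.
move=> ab; rewrite (@Rintegral_cst _ (measurableTypeR R))//; congr (_ * _).
have E : lebesgue_measure (`[a, b]%classic : set R) = (b - a)%:E.
  move: ab; rewrite le_eqVlt => /predU1P[->|ab].
    by rewrite lebesgue_measure_itv/= lte_fin ltxx subrr.
  by rewrite lebesgue_measure_itv/= lte_fin ab.
exact: (congr1 fine E).
Qed.

Lemma integ_cst_itv (a b c : R) : integ `[a, b] (fun=> c).
Proof.
apply: continuous_compact_integrable; first exact: segment_compact.
by apply: continuous_subspaceT => x; exact: cvg_cst.
Qed.

(* [gint p t >= M^(p-1) e^-(M+1)] on [[M, M+1]] *)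
Lemma Gamma_ge p M : 1 <= p -> 0 < M -> M `^ (p - 1) * expR (- (M + 1)) <= Gamma p.
Proof.
move=> p1 M0; have p0 : 0 < p by apply: lt_le_trans p1.
have sub : `[M, M + 1]%classic `<=` pos.
  by move=> x /=; rewrite !in_itv/= => /andP[Mx _]; rewrite andbT (lt_le_trans M0).
apply: (@le_trans _ _ (\int[mu]_(t in `[M, M + 1]) gint p t)); last first.
  by apply: Rint_sub_le => //; [exact: gint_integ|move=> x _; exact: gint_ge0].
have M1 : M <= M + 1 by rewrite lerDl.
have := Rint_cst_itv (M `^ (p - 1) * expR (- (M + 1))) M1.
rewrite [_ * (M + 1 - M)](_ : _ = M `^ (p - 1) * expR (- (M + 1))); last by ring.
move=> <-.
apply: Rint_le => //; first exact: integ_cst_itv.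
  exact: integ_sub sub (gint_integ p0).
move=> t /=; rewrite in_itv/= => /andP[Mt tM].
apply: ler_pM; rewrite ?powR_ge0 ?expR_ge0//; last by rewrite ler_expR lerN2.
by apply: ge0_ler_powR; rewrite ?nnegrE ?subr_ge0// ltW// (lt_le_trans M0).
Qed.

(** Tonelli's theorem in the plane, for the extension of h by 0 outside the quadrant. *)
Lemma tonelli_pos (h : R * R -> R) : measurable_fun setT h ->
  (forall s t, 0 < s -> 0 < t -> 0 <= h (s, t)) ->
  (\int[mu]_(s in pos) \int[mu]_(t in pos) (h (s, t))%:E =
   \int[mu]_(t in pos) \int[mu]_(s in pos) (h (s, t))%:E)%E.
Proof.
move=> mh h0.
pose k (z : R * R) := \1_pos z.1 * \1_pos z.2 * h z.
have mi : measurable_fun setT (\1_pos : R -> R) by exact: measurable_indic.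
have mk : measurable_fun setT k.
  apply: measurable_funM => //; apply: measurable_funM.
    exact: (measurableT_comp mi (@measurable_fst _ _ R R)).
  exact: (measurableT_comp mi (@measurable_snd _ _ R R)).
have k0 z : (0 <= (k z)%:E)%E.
  rewrite lee_fin /k !indicE; case: z => s t /=.
  case: (boolP (s \in pos)) => sp; last by rewrite !mul0r.
  case: (boolP (t \in pos)) => tp; last by rewrite mulr0 mul0r.
  by rewrite !mul1r h0//; apply: in_pos; exact: set_mem.
have E := @fubini_tonelli _ _ (measurableTypeR R) (measurableTypeR R) R mu mu (EFin \o k)
   ((measurable_EFinP _ _).2 mk) k0.
have L : (\int[mu]_(s in pos) \int[mu]_(t in pos) (h (s, t))%:E = \int[mu]_s \int[mu]_t (k (s, t))%:E)%E.
  rewrite integral_mkcond; apply: eq_integral => s _; rewrite patchE /k.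
  case: ifPn => sp.
    rewrite integral_mkcond; apply: eq_integral => t _; rewrite patchE !indicE/= sp mul1r.
    by case: ifPn => tp; rewrite ?mul1r ?mul0r.
  rewrite integral0_eq; first by [].
  by move=> t _; rewrite !indicE/= (negbTE sp) !mul0r.
have M : (\int[mu]_(t in pos) \int[mu]_(s in pos) (h (s, t))%:E = \int[mu]_t \int[mu]_s (k (s, t))%:E)%E.
  rewrite integral_mkcond; apply: eq_integral => t _; rewrite patchE /k.
  case: ifPn => tp.
    rewrite integral_mkcond; apply: eq_integral => s _; rewrite patchE !indicE/= tp mulr1.
    by case: ifPn => sp; rewrite ?mul1r ?mul0r.
  rewrite integral0_eq; first by [].
  by move=> s _; rewrite !indicE/= (negbTE tp) mulr0 !mul0r.
rewrite L M; exact: E.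
Qed.

End Gamma.

(** * Euler's Beta integral *)

Section Beta.
Context {R : realType}.
Notation mu := (@lebesgue_measure R).
Implicit Types (D : set R) (f g : R -> R) (x c r t p q s v : R).
Local Notation pos := (`]0, +oo[%classic : set R).

(** The Beta integrand carried from ]0, 1[ to ]0, +oo[ by the substitution v / (1 + v). *)
Definition bint p q v := v `^ (q - 1) * (1 + v) `^ (- (p + q)).

Lemma bint_ge0 p q v : 0 <= bint p q v.
Proof. by rewrite mulr_ge0 ?powR_ge0. Qed.

Lemma mea_bint D p q : measurable_fun D (bint p q).
Proof. by rewrite /bint; mea. Qed.

Lemma Rint_eq D f g : (forall x, D x -> f x = g x) ->
  \int[mu]_(x in D) f x = \int[mu]_(x in D) g x.
Proof. by move=> fg; apply: eq_Rintegral => x /set_mem; exact: fg. Qed.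

Lemma Eint_eq D f g : (forall x, D x -> f x = g x) ->
  (\int[mu]_(x in D) (f x)%:E = \int[mu]_(x in D) (g x)%:E)%E.
Proof. by move=> fg; apply: eq_integral => x /set_mem Dx; rewrite fg. Qed.

Lemma Eint_scale D f c : measurable D -> measurable_fun D f ->
  (forall x, D x -> 0 <= f x) -> 0 <= c ->
  (\int[mu]_(x in D) (c * f x)%:E = c%:E * \int[mu]_(x in D) (f x)%:E)%E.
Proof.
move=> mD mf f0 c0.
have := @ge0_integralZl_EFin _ (measurableTypeR R) R mu D mD (EFin \o f).
rewrite -ge0_integralZl_EFin//; by apply/measurable_EFinP; exact: mf.
Qed.

Lemma Gamma_gt0 p : 0 < p -> 0 < Gamma p.
Proof.
move=> p0.
have sub : `[1, 2]%classic `<=` pos.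
  by move=> x /=; rewrite !in_itv/= => /andP[x1 _]; rewrite andbT (lt_le_trans ltr01).
have i12 := integ_sub (measurable_itv `[1, 2]) (measurable_itv _) sub (gint_integ p0).
rewrite GammaE; apply: lt_le_trans (Rint_sub_le (measurable_itv _) (measurable_itv _) sub (gint_integ p0) (fun x _ => gint_ge0 _ x)).
have h12 : (1 : R) <= 2 by rewrite ler1n.
apply: (@lt_le_trans _ _ (\int[mu]_(t in `[1, 2]) (2^-1 * expR (- 2)))).
  by rewrite Rint_cst_itv// !mulr_gt0 ?expR_gt0 ?invr_gt0// subr_gt0 ltr1n.
apply: Rint_le => //; first exact: integ_cst_itv.
move=> x /=; rewrite in_itv/= => /andP[x1 x2]; have x0 : 0 < x by apply: lt_le_trans x1.
apply: ler_pM; rewrite ?expR_ge0 ?invr_ge0//; last by rewrite ler_expR lerN2.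
apply: (@le_trans _ _ (x `^ (- 1))); last by apply: ler_powR => //; lra.
by rewrite powR_inv1 ?(ltW x0)// lef_pV2 ?posrE ?ltr0n.
Qed.

(** Both sides are the double integral of s^(p + q - 1) t^(q - 1) e^(- s (1 + t)). Integrating in t
    first leaves Gamma q times the integrand of Gamma p; integrating in s first leaves Gamma (p + q)
    times the Beta integrand. *)
Lemma beta_Gamma p q : 0 < p -> 0 < q ->
  integ pos (bint p q) /\ Gamma (p + q) * \int[mu]_(v in pos) bint p q v = Gamma p * Gamma q.
Proof.
move=> p0 q0; have pq0 : 0 < p + q by rewrite addr_gt0.
pose h (z : R * R) := z.1 `^ (p + q - 1) * z.2 `^ (q - 1) * expR (- (z.1 * (1 + z.2))).
have mfst : measurable_fun setT (fun z : R * R => z.1) by exact: measurable_fst.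
have msnd : measurable_fun setT (fun z : R * R => z.2) by exact: measurable_snd.
have mh : measurable_fun setT h by rewrite /h; mea.
have h0 s t : 0 < s -> 0 < t -> 0 <= h (s, t) by rewrite !mulr_ge0 ?powR_ge0 ?expR_ge0.
have := tonelli_pos mh h0.
have Gp0 r : 0 <= Gamma r by apply: Rint_ge0 => x _; exact: gint_ge0.
rewrite (_ : (\int[mu]_(s in pos) _ = (Gamma p * Gamma q)%:E)%E); last first.
  rewrite (_ : (\int[mu]_(s in pos) _ = \int[mu]_(s in pos) (Gamma q * gint p s)%:E)%E); last first.
    apply: eq_integral => s /set_mem /in_pos s0.
    rewrite [RHS]EFinM [RHS]muleC -(Gamma_EFin q0) (scale_pos s0 (fun x _ => gint_ge0 q x) (@gint_cont R q)).
    rewrite -Eint_scale ?gint_ge0//; last 2 first.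
      by apply: mea_mul; [exact: mea_cst|rewrite /gint; mea].
      by move=> x _; rewrite mulr_ge0 ?gint_ge0// ltW.
    apply: Eint_eq => t /in_pos t0; rewrite /h /gint /= powRM ?(ltW s0) ?(ltW t0)//.
    have -> : s `^ (p + q - 1) = s `^ (p - 1) * s * s `^ (q - 1).
      rewrite -[X in _ * X * _]powRr1 ?(ltW s0)// -!powRD ?(gt_eqF s0) ?implybT//.
      by congr (_ `^ _); ring.
    rewrite (_ : - (s * (1 + t)) = - s + - (s * t)); last by ring.
    by rewrite expRD; ring.
  rewrite Eint_scale//; [|exact: mea_gint|by move=> x _; exact: gint_ge0].
  by rewrite (Gamma_EFin p0) -EFinM (mulrC (Gamma q)).
rewrite (_ : (\int[mu]_(t in pos) _ = \int[mu]_(t in pos) (Gamma (p + q) * bint p q t)%:E)%E); last first.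
  apply: eq_integral => t /set_mem /in_pos t0.
  have t1 : 0 < 1 + t by rewrite addr_gt0.
  rewrite [RHS]EFinM [RHS]muleC -(Gamma_EFin pq0) (scale_pos t1 (fun x _ => gint_ge0 _ x) (@gint_cont R _)).
  rewrite -Eint_scale ?bint_ge0//; last 2 first.
    by apply: mea_mul; [exact: mea_cst|rewrite /gint; mea].
    by move=> x _; rewrite mulr_ge0 ?gint_ge0// ltW.
  apply: Eint_eq => s /in_pos s0; rewrite /h /gint /bint /= powRM ?(ltW s0) ?(ltW t1)//.
  have -> : (1 + t) `^ (- (p + q)) = ((1 + t) `^ (p + q - 1) * (1 + t))^-1.
    rewrite -[X in _ * X]powRr1 ?(ltW t1)// -powRD ?(gt_eqF t1) ?implybT// powRN.
    by congr (_ `^ _)^-1; ring.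
  rewrite [s * _]mulrC; field.
  by rewrite !gt_eqF// ?powR_gt0.
rewrite Eint_scale//; [|exact: mea_bint|by move=> x _; exact: bint_ge0].
have Gpq := Gamma_gt0 pq0.
move=> /esym E.
have E2 : (\int[mu]_(v in pos) (bint p q v)%:E = (Gamma p * Gamma q / Gamma (p + q))%:E)%E.
  have -> : Gamma p * Gamma q / Gamma (p + q) = (Gamma (p + q))^-1 * (Gamma p * Gamma q) by rewrite mulrC.
  rewrite EFinM -E muleA -EFinM mulVf ?gt_eqF// mul1e//.
have [] := integ_ge0_EFin (measurable_itv _) (mea_bint p q) (fun x _ => bint_ge0 p q x) E2.
move=> bi ->; split; first exact: bi.
have alg (G P : R) : 0 < G -> G * (P / G) = P by move=> G0; rewrite mulrC divfK// gt_eqF.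
exact: alg Gpq.
Qed.
End Beta.

(** * Functional equation and reflection formula for Gamma *)

Section Reflection.
Context {R : realType}.
Notation mu := (@lebesgue_measure R).
Implicit Types (D : set R) (f : R -> R) (x y c l t p s v : R).
Local Notation pos := (`]0, +oo[%classic : set R).

Lemma Gamma1 : Gamma 1 = 1 :> R.
Proof.
have e10 : expR (- (1 * t)) @[t --> 0^'+] --> expR (- (1 * 0) : R).
  by apply: cvg_at_right_filter; apply: (@isd_continuous R (fun t => expR (- (1 * t)))).
have [|||||_] := @FTC_pos R (fun t => expR (- (1 * t))) (fun t => - expR (- (1 * t))) (- 1) 0.
- by move=> x _; exact: expR_ge0.
- by move=> x _; isd; ring.
- by move=> x _; isc.
- by apply: cvgN; move: e10; rewrite mulr0 oppr0 expR0.
- by rewrite -[X in _ --> X]oppr0; apply: cvgN; apply: cvg_expRN.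
rewrite sub0r opprK => E; rewrite GammaE -[RHS]E; apply: Rint_eq => x /in_pos x0.
by rewrite /gint subrr powRr0 !mul1r.
Qed.

(** The Beta integral with q = 1 is elementary and equals 1 / p. *)
Lemma Gamma_rec p : 0 < p -> Gamma (p + 1) = p * Gamma p.
Proof.
move=> p0; have [_] := beta_Gamma p0 ltr01; rewrite Gamma1 mulr1.
have [|||||_ E] := @FTC_pos R (bint p 1) (fun v => - ((1 + v) `^ (- p) / p)) (- p^-1) 0.
- by move=> x _; exact: bint_ge0.
- move=> x x0; have x1 : 0 < 1 + x by rewrite addr_gt0.
  have D : is_derive x 1 (fun v => (1 + v) `^ (- p)) (- p * (1 + x) `^ (- p - 1)).
    have := @isd_comp R (fun y => y `^ (- p)) (fun v => 1 + v) x 1 _ _ (isd_powR (- p) x1).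
    by move=> H; apply: isd_eq (H _) _; [by isd; ring|rewrite mulr1].
  refine (isd_eq (isd_opp (isd_mul D (isd_cst x p^-1))) _).
  rewrite /bint subrr powRr0 mul1r (opprD p 1); field; rewrite gt_eqF//.
- move=> x x0; have x1 : 0 < 1 + x by rewrite addr_gt0.
  rewrite /bint; apply: (@cvgM _ R^o); first by apply: isd_continuous (isd_powR _ x0).
  apply: (@continuous_comp _ _ _ (fun v => 1 + v) (fun y => y `^ (- (p + 1)))).
    by apply: cvgD; [exact: cvg_cst|exact: cvg_id].
  by apply: isd_continuous (isd_powR _ x1).
- rewrite -[X in _ --> X]opprK opprK; apply: cvgN; rewrite -[X in _ --> X]mul1r; apply: cvgM; last exact: cvg_cst.
  have : (1 + v) `^ (- p) @[v --> 0^'+] --> (1 + 0) `^ (- p).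
    apply: cvg_at_right_filter; apply: (@continuous_comp _ _ _ (fun v => 1 + v) (fun y => y `^ (- p))).
      by apply: cvgD; [exact: cvg_cst|exact: cvg_id].
    by rewrite addr0; apply: isd_continuous (isd_powR _ ltr01).
  by rewrite addr0 powR1.
- rewrite -[X in _ --> X]oppr0; apply: cvgN; rewrite -[X in _ --> X](mul0r p^-1); apply: cvgM; last exact: cvg_cst.
  apply: (cvg_comp (fun v => 1 + v) (fun y => y `^ (- p)) _ (cvg_powRN p0)).
  by apply/cvgryPge => A; near=> x; rewrite -lerBlDl; near: x; apply: nbhs_pinfty_ge; rewrite num_real.
rewrite E sub0r opprK => <-; field; rewrite gt_eqF//.
Unshelve. all: by end_near. Qed.

(* The Cesaro means of [u] tend to 0, so dominated convergence applies to them; this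
   replaces the Riemann-Lebesgue lemma. *)
Lemma cesaro_oscillation D f (u : nat -> R -> R) (B : R -> R) (L : R) : measurable D ->
  integ D f -> (forall n, measurable_fun D (u n)) ->
  (forall n x, D x -> `|u n x| <= 1) ->
  (forall n x, D x -> `|\sum_(0 <= k < n) u k x| <= B x) ->
  (\int[mu]_(x in D) (f x * u n x)) @[n --> \oo] --> L -> L = 0.
Proof.
move=> mD fi mu_ u1 uB /cesaro cL.
have fui n : integ D (fun x => f x * u n x).
  apply: (integ_le _ _ _ (integ_norm mD fi)) => //.
    by apply: mea_mul => //; exact: integ_mea.
  by move=> x Dx; rewrite normrM ler_piMr// u1.
have [||||_] := @Rdct R D (fun n x => f x * (n.+1%:R^-1 * \sum_(0 <= k < n.+1) u k x)) (fun=> 0) (fun x => `|f x|) mD.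
- move=> n; apply: mea_mul; first exact: integ_mea.
  by apply: mea_mul; [exact: mea_cst|apply: mea_sum].
- move=> x Dx; rewrite -[X in _ --> X](mulr0 (f x)); apply: cvgM; first exact: cvg_cst.
  apply: (@squeeze_cvgr _ _ _ _ (fun n => - (n.+1%:R^-1 * B x)) (fun n => n.+1%:R^-1 * B x)).
  + by apply: nearW => n; rewrite -ler_norml normrM ger0_norm ?invr_ge0// ler_pM2l ?invr_gt0// uB.
  + by rewrite -[X in _ --> X]oppr0; apply: cvgN; rewrite -[X in _ --> X](mul0r (B x)); apply: cvgM; [exact: cvg_harmonic|exact: cvg_cst].
  + by rewrite -[X in _ --> X](mul0r (B x)); apply: cvgM; [exact: cvg_harmonic|exact: cvg_cst].
- exact: integ_norm.
- move=> n x Dx; rewrite normrM ler_piMr// normrM ger0_norm ?invr_ge0//.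
  rewrite ler_pdivrMl// mulr1; apply: le_trans (ler_norm_sum _ _ _) _.
  apply: le_trans (ler_sum _ (fun k _ => u1 k x Dx)) _.
  by rewrite sumr_const_nat subn0.
rewrite (@Rintegral_cst _ (measurableTypeR R))// mul0r => c0.
apply: cvg_unique cL _ => //; apply: cvg_trans c0; apply: near_eq_cvg; apply: nearW => n.
rewrite /arithmetic_mean /= /series /= -Rint_sum// -(@RintegralZl _ (measurableTypeR R))//; last exact: integ_sum.
by apply: Rint_eq => x Dx; rewrite !mulr_sumr; apply: eq_bigr => i _; ring.
Qed.

(** Multiplication by 2 sin(psi / 2) telescopes the sum. *)
Lemma sum_sin_bound (psi delta : R) n : sin (psi / 2) != 0 ->
  `|\sum_(0 <= k < n) sin (k%:R * psi + delta)| <= `|sin (psi / 2)|^-1.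
Proof.
move=> s0.
have E : 2 * sin (psi / 2) * \sum_(0 <= k < n) sin (k%:R * psi + delta) =
    cos (- psi / 2 + delta) - cos (n%:R * psi - psi / 2 + delta).
  elim: n => [|n IH]; first by rewrite big_nil mulr0 mul0r add0r mulNr subrr.
  rewrite big_nat_recr//= mulrDr IH.
  set A := n%:R * psi + delta.
  have -> : n%:R * psi - psi / 2 + delta = A - psi / 2 by rewrite /A; ring.
  have -> : n.+1%:R * psi - psi / 2 + delta = A + psi / 2 by rewrite /A -natr1; field.
  by rewrite (cosB A) (cosD A); ring.
have : `|2 * sin (psi / 2) * \sum_(0 <= k < n) sin (k%:R * psi + delta)| <= 2.
  rewrite E; apply: le_trans (ler_normB _ _) _.
  by have := cos_max (- psi / 2 + delta); have := cos_max (n%:R * psi - psi / 2 + delta); lra.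
rewrite !normrM ger0_norm// -mulrA ger_pMr// => h.
by rewrite -[leRHS]mul1r ler_pdivlMr ?normr_gt0// mulrC.
Qed.

Lemma cos_lip x y : `|cos x - cos y| <= `|x - y|.
Proof.
wlog xy : x y / x <= y.
  move=> H; have [xy|/ltW xy] := leP x y; first exact: H.
  by rewrite distrC [leRHS]distrC H.
have Dc t : is_derive t 1 (@cos R) (- sin t) by exact: is_derive_cos.
have Di (t : R) : is_derive t 1 (fun z : R => z) 1 by exact: isd_id.
rewrite distrC [leRHS]distrC [leRHS]ger0_norm ?subr_ge0// ler_norml; apply/andP; split.
  have := isd_ge0_le xy (fun t _ => isd_add (Dc t) (Di t)).
  move=> H; suff : cos x + x <= cos y + y by lra.
  by apply: H => t _; rewrite addrC subr_ge0 sin_le1.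
have := isd_ge0_le xy (fun t _ => isd_add (isd_opp (Dc t)) (Di t)).
move=> H; suff : - cos x + x <= - cos y + y by lra.
by apply: H => t _; rewrite opprK -[1]opprK subr_ge0 sin_geN1.
Qed.

Lemma int_cos c : c != 0 -> integ `[0, (pi : R)] (fun t => cos (c * t)) /\
  \int[mu]_(t in `[0, pi]) cos (c * t) = sin (c * pi) / c.
Proof.
move=> c0; have := @FTC_cc R (fun t => cos (c * t)) (fun t => sin (c * t) / c) 0 pi (pi_gt0 R).
rewrite mulr0 sin0 mul0r subr0; apply.
- by move=> x _; isd; field.
- by move=> x _; isc.
Qed.

Lemma sin_half_ge (phi : R) : 0 < phi <= pi -> phi / pi <= sin (phi / 2).
Proof.
move=> /andP[p0 pp]; have ppi := pi_gt0 R.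
have l01 : 0 <= phi / pi <= 1 by rewrite (divr_ge0 (ltW p0) (ltW ppi))/= ler_pdivrMr// mul1r.
have v0 : 0 <= (pi : R) / 2 <= pi by apply/andP; split; lra.
have := sin_scale l01 v0; rewrite sin_pihalf mulr1.
by rewrite mulrA mulfVK ?gt_eqF.
Qed.

Lemma sum_cos_half (phi : R) n :
  sin (phi / 2) * \sum_(0 <= k < n) 2 * cos ((k%:R + 1 / 2) * phi) = sin (n%:R * phi).
Proof.
elim: n => [|n IH]; first by rewrite big_nil mulr0 mul0r sin0.
rewrite big_nat_recr//= mulrDr IH.
have -> : n%:R * phi = (n%:R + 1 / 2) * phi - phi / 2 by field.
have -> : n.+1%:R * phi = (n%:R + 1 / 2) * phi + phi / 2 by rewrite -natr1; field.
by rewrite sinB sinD; ring.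
Qed.

Lemma sin_shift s k : sin ((s + k%:R) * pi) = (-1) ^+ k * sin (s * pi).
Proof.
elim: k => [|k IH]; first by rewrite addr0 expr0 mul1r.
have -> : (s + k.+1%:R) * pi = (s + k%:R) * pi + pi by rewrite -natr1; ring.
by rewrite sinDpi IH exprS; ring.
Qed.

Lemma sin_shiftN s k : sin ((k.+1%:R - s) * pi) = (-1) ^+ k * sin (s * pi).
Proof.
have -> : (k.+1%:R - s) * pi = (- s + k.+1%:R) * pi by ring.
by rewrite sin_shift mulNr sinN exprS; ring.
Qed.

Lemma geometric_alt v n : 1 + v != 0 ->
  \sum_(0 <= k < n) (- v) ^+ k = (1 - (- v) ^+ n) / (1 + v).
Proof.
move=> v0; elim: n => [|n IH]; first by rewrite big_nil expr0 subrr mul0r.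
by rewrite big_nat_recr//= IH exprS; field.
Qed.

Lemma geometric_alt_le v n : 0 <= v <= 1 -> `|\sum_(0 <= k < n) (- v) ^+ k| <= 2.
Proof.
move=> /andP[v0 v1]; have v2 : 0 < 1 + v by rewrite ltr_wpDr.
rewrite geometric_alt ?gt_eqF// normrM [X in _ * X]ger0_norm ?invr_ge0 ?(ltW v2)// ler_pdivrMr//.
apply: le_trans (ler_normB _ _) _; rewrite normr1 normrX normrN (ger0_norm v0).
have : v ^+ n <= 1 by rewrite exprn_ile1.
lra.
Qed.

Lemma geometric_alt_cvg v : 0 <= v < 1 ->
  \sum_(0 <= k < n) (- v) ^+ k @[n --> \oo] --> (1 + v)^-1.
Proof.
move=> /andP[v0 v1]; have v2 : 0 < 1 + v by rewrite ltr_wpDr.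
rewrite (_ : (fun n => _) = (fun n => (1 - (- v) ^+ n) / (1 + v))); last first.
  by apply/funext => n; rewrite geometric_alt// gt_eqF.
rewrite -[X in _ --> X]mul1r; apply: cvgM; last exact: cvg_cst.
rewrite -[X in _ --> X]subr0; apply: cvgB; first exact: cvg_cst.
by apply: cvg_expr; rewrite normrN ger0_norm.
Qed.

(** Partial sums of the expansion of pi / sin(pi s) into simple fractions. *)
Definition alt_sum s (n : nat) : R :=
  \sum_(0 <= k < n) (-1) ^+ k * ((s + k%:R)^-1 + (k.+1%:R - s)^-1).

(** The integral of v^(s - 1) / (1 + v) is split at 1, and 1 / (1 + v) expanded in powers of v below
    and of 1 / v above. The alternating partial sums stay below 2 in absolute value, which gives the
    dominating functions. *)
Lemma mellin_series s : 0 < s < 1 -> alt_sum s n @[n --> \oo] -->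
  (\int[mu]_(v in pos) bint (1 - s) s v : R).
Proof.
move=> /andP[s0 s1]; have s1' : 0 < 1 - s by rewrite subr_gt0.
have [ib _] := beta_Gamma s1' s0.
have bE v : 0 < v -> bint (1 - s) s v = v `^ (s - 1) / (1 + v).
  by move=> v0; rewrite /bint subrK powRN powRr1// addr_ge0// ltW.
have i1 := (integ_pow01 s0 ltr01).1.
have sub1 : `]0, 1[%classic `<=` `]0, (1 : R)]%classic by apply: subset_itvl; rewrite bnd_simp.
have sub2 : `]0, (1 : R)]%classic `<=` pos by apply: subset_itvl; rewrite bnd_simp.
have sub3 : `]1, +oo[%classic `<=` pos by apply: subset_itvr; rewrite bnd_simp.
have [_ EE] := integ_pos_split ltr01 (integ_sub (measurable_itv _) (measurable_itv _) sub2 ib)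
   (integ_sub (measurable_itv _) (measurable_itv _) sub3 ib).
have E01 : \int[mu]_(v in `]0, 1]) bint (1 - s) s v = \int[mu]_(v in `]0, 1[) bint (1 - s) s v.
  apply/esym; apply: Rintegral_itv_bndo_bndc.
  by apply: (integ_sub _ _ _ ib) => //; exact: subset_trans sub1 sub2.
rewrite EE E01.
have split_sum n : alt_sum s n =
   \sum_(0 <= k < n) (-1) ^+ k * (s + k%:R)^-1 + \sum_(0 <= k < n) (-1) ^+ k * (k.+1%:R - s)^-1.
  by rewrite /alt_sum -big_split/=; apply: eq_bigr => k _; rewrite mulrDr.
rewrite (eq_cvg _ _ split_sum).
apply: cvgD.
  have [||||_] := @Rdct R `]0, 1[ (fun n v => \sum_(0 <= k < n) (- v) ^+ k * v `^ (s - 1))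
      (bint (1 - s) s) (fun v => 2 * v `^ (s - 1)) (measurable_itv _).
  - by move=> n; mea => k; mea.
  - move=> v; rewrite /= in_itv/= => /andP[v0 v1]; rewrite bE//.
    rewrite (_ : (fun n => _) = fun n => (\sum_(0 <= k < n) (- v) ^+ k) * v `^ (s - 1)); last first.
      by apply/funext => n; rewrite mulr_suml.
    rewrite mulrC; by apply: cvgM; [apply: geometric_alt_cvg; rewrite ltW|exact: cvg_cst].
  - by apply: integ_scale => //; exact: integ_sub sub1 i1.
  - move=> n v; rewrite /= in_itv/= => /andP[v0 v1]; rewrite -mulr_suml normrM [X in _ * X]ger0_norm ?powR_ge0//.
    by rewrite ler_wpM2r ?powR_ge0// geometric_alt_le// !ltW.
  apply: cvg_trans; apply: near_eq_cvg; apply: nearW => n.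
  have ik k : integ `]0, 1[ (fun v => (- v) ^+ k * v `^ (s - 1)) /\
     \int[mu]_(v in `]0, 1[) ((- v) ^+ k * v `^ (s - 1)) = (-1) ^+ k * (s + k%:R)^-1.
    have sk0 : 0 < s + k%:R by rewrite ltr_wpDr.
    have [j1 j2] := integ_pow01 sk0 ltr01.
    have j3 : integ `]0, 1[ (fun t => t `^ (s + k%:R - 1)) by exact: integ_sub sub1 j1.
    have E x : `]0, 1[%classic x -> (-1) ^+ k * x `^ (s + k%:R - 1) = (- x) ^+ k * x `^ (s - 1).
      rewrite /= in_itv/= => /andP[x0 _].
      rewrite (_ : s + k%:R - 1 = k%:R + (s - 1)); last by ring.
      rewrite (@powRD _ x k%:R) ?(gt_eqF x0) ?implybT// powR_mulrn ?(ltW x0)//.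
      by rewrite [(- x) ^+ k]exprNn mulrA.
    split; first by apply: (integ_eq _ E) => //; exact: integ_scale.
    rewrite -(Rint_eq E) (@RintegralZl _ (measurableTypeR R))//; congr (_ * _).
    by rewrite Rintegral_itv_bndo_bndc// j2 powR1 mul1r.
  by rewrite Rint_sum// => [|k]; [apply: eq_bigr => k _; rewrite (ik k).2|exact: (ik k).1].
have sub4 : `]1, +oo[%classic `<=` `[(1 : R), +oo[%classic by apply: subset_itvr; rewrite bnd_simp.
have i2 := (integ_pow1y s1' ltr01).1.
have [||||_] := @Rdct R `]1, +oo[ (fun n v => \sum_(0 <= k < n) (- v^-1) ^+ k * v `^ (- (1 - s) - 1))
    (bint (1 - s) s) (fun v => 2 * v `^ (- (1 - s) - 1)) (measurable_itv _).
- by move=> n; mea => k; mea.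
- move=> v; rewrite /= in_itv/= andbT => v1; have v0 : 0 < v by apply: lt_trans v1.
  have -> : bint (1 - s) s v = (1 + v^-1)^-1 * v `^ (- (1 - s) - 1).
    rewrite bE// (_ : - (1 - s) - 1 = s - 1 - 1); last by ring.
    rewrite (@powRB _ v (s - 1)) ?(gt_eqF v0) ?implybT// powRr1 ?(ltW v0)//.
    by field; rewrite !gt_eqF ?addr_gt0.
  rewrite (_ : (fun n => _) = fun n => (\sum_(0 <= k < n) (- v^-1) ^+ k) * v `^ (- (1 - s) - 1)); last first.
    by apply/funext => n; rewrite mulr_suml.
  apply: cvgM; last exact: cvg_cst.
  by apply: geometric_alt_cvg; rewrite invr_ge0 (ltW v0)/= invf_lt1.
- by apply: integ_scale => //; exact: integ_sub sub4 i2.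
- move=> n v; rewrite /= in_itv/= andbT => v1; have v0 : 0 < v by apply: lt_trans v1.
  rewrite -mulr_suml normrM [X in _ * X]ger0_norm ?powR_ge0//.
  by rewrite ler_wpM2r ?powR_ge0// geometric_alt_le// invr_ge0 (ltW v0)/= invf_le1// ltW.
apply: cvg_trans; apply: near_eq_cvg; apply: nearW => n.
have ik k : integ `]1, +oo[ (fun v => (- v^-1) ^+ k * v `^ (- (1 - s) - 1)) /\
   \int[mu]_(v in `]1, +oo[) ((- v^-1) ^+ k * v `^ (- (1 - s) - 1)) = (-1) ^+ k * (k.+1%:R - s)^-1.
  have sk0 : 0 < k.+1%:R - s by rewrite subr_gt0 (lt_le_trans s1)// ler1n.
  have [j1 j2] := integ_pow1y sk0 ltr01.
  have j3 : integ `]1, +oo[ (fun t => t `^ (- (k.+1%:R - s) - 1)) by exact: integ_sub sub4 j1.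
  have E x : `]1, +oo[%classic x -> (-1) ^+ k * x `^ (- (k.+1%:R - s) - 1) = (- x^-1) ^+ k * x `^ (- (1 - s) - 1).
    rewrite /= in_itv/= andbT => x1; have x0 : 0 < x by apply: lt_trans x1.
    rewrite (_ : - (k.+1%:R - s) - 1 = - k%:R + (- (1 - s) - 1)); last by rewrite -natr1; ring.
    rewrite (@powRD _ x (- k%:R)) ?(gt_eqF x0) ?implybT// powRN powR_mulrn ?(ltW x0)//.
    by rewrite [(- x^-1) ^+ k]exprNn exprVn mulrA.
  split; first by apply: (integ_eq _ E) => //; exact: integ_scale.
  rewrite -(Rint_eq E) (@RintegralZl _ (measurableTypeR R))//; congr (_ * _).
  by rewrite Rintegral_itv_obnd_cbnd// j2 powR1 mul1r.
by rewrite Rint_sum// => [|k]; [apply: eq_bigr => k _; rewrite (ik k).2|exact: (ik k).1].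
Qed.

(** Evaluates the limit of [alt_sum]. Up to sin(pi s), each fraction is the integral of a cosine
    over [0, pi], and pairing the frequencies s + k and k + 1 - s gives 2 cos((k + 1/2) t) cos((s -
    1/2) t). Subtracting the same sum at s = 0, whose integral is pi, removes the singularity at t =
    0 and leaves an oscillating integral. *)
Lemma Gamma_reflection s : 0 < s < 1 -> sin (s * pi) * (Gamma s * Gamma (1 - s)) = pi.
Proof.
move=> s01; have /andP[s0 s1] := s01; have s1' : 0 < 1 - s by rewrite subr_gt0.
have ppi := pi_gt0 R.
have := mellin_series s01.
have [ib] := beta_Gamma s1' s0.
rewrite subrK Gamma1 mul1r => -> cX.
set G := Gamma s * _; rewrite [Gamma (1 - s) * _]mulrC -/G in cX.
suff : sin (s * pi) * G - pi = 0 by move/eqP; rewrite subr_eq0 => /eqP.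
pose f (t : R) := (cos ((s - 1 / 2) * t) - cos (1 / 2 * t)) / sin (t / 2).
pose D : set R := `]0, pi]%classic.
have mD : measurable D by exact: measurable_itv.
have mf : measurable_fun D f by rewrite /f; mea.
(* The numerator is at most |s - 1| t <= t because cos is 1-Lipschitz, and sin(t / 2) >= t / pi. *)
have fb t : D t -> `|f t| <= pi.
  rewrite /D/= in_itv/= => t0; have := sin_half_ge t0; move: t0 => /andP[t0 tp] st.
  have st0 : 0 < sin (t / 2) by apply: lt_le_trans st; rewrite divr_gt0.
  rewrite /f normrM [X in _ * X]ger0_norm ?invr_ge0 ?(ltW st0)// ler_pdivrMr//.
  apply: (@le_trans _ _ t); last by rewrite mulrC -ler_pdivrMr.
  apply: le_trans (cos_lip _ _) _; rewrite -mulrBl normrM (ger0_norm (ltW t0)).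
  by rewrite ler_piMl ?(ltW t0)// ler_norml; apply/andP; split; lra.
have sD : D `<=` `[0, pi]%classic by apply: subset_itvr; rewrite bnd_simp.
have fi : integ D f.
  by apply: (@integ_le R D f (fun=> pi) (measurable_itv _) mf fb); apply: (integ_sub _ _ sD (integ_cst_itv 0 pi pi)); exact: measurable_itv.
pose u n (t : R) := sin (n.+1%:R * t).
apply: (@cesaro_oscillation D f u (fun t => (`|sin (t / 2)|^-1)) _ (measurable_itv _) fi) => //.
- by move=> n; rewrite /u; mea.
- by move=> n t _; exact: sin_max.
- move=> n t; rewrite /D/= in_itv/= => t0; have := sin_half_ge t0; move: t0 => /andP[t0 tp] st.
  have st0 : 0 < sin (t / 2) by apply: lt_le_trans st; rewrite divr_gt0.
  have := @sum_sin_bound t t n; rewrite gt_eqF// => /(_ isT).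
  suff -> : \sum_(0 <= k < n) sin (k%:R * t + t) = \sum_(0 <= k < n) u k t by [].
  by apply: eq_bigr => k _; rewrite /u -natr1 mulrDl mul1r.
have cX' : sin (s * pi) * alt_sum s n.+1 - pi @[n --> \oo]
   --> sin (s * pi) * G - pi.
  apply: cvgB; last exact: cvg_cst.
  by apply: cvgM; [exact: cvg_cst|rewrite (cvg_shiftS (alt_sum s))].
apply: cvg_trans cX'; apply: near_eq_cvg; apply: nearW => n.
have ic c : integ D (fun t => cos (c * t)).
  apply: (@integ_le R D (fun t => cos (c * t)) (fun=> 1) mD) => [|t _|]; [by mea|exact: cos_max|].
  exact: (integ_sub mD (measurable_itv _) sD (integ_cst_itv _ _ _)).
have ic' c : c != 0 -> \int[mu]_(t in D) cos (c * t) = sin (c * pi) / c.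
  by move=> c0; rewrite /D Rintegral_itv_obnd_cbnd; [exact: (int_cos c0).2|exact: ic].
have E t : D t -> f t * u n t =
    \sum_(0 <= k < n.+1) (cos ((s + k%:R) * t) + cos ((k.+1%:R - s) * t))
    - \sum_(0 <= k < n.+1) (cos (k%:R * t) + cos (k.+1%:R * t)).
  rewrite /D/= in_itv/= => t0; have := sin_half_ge t0; move: t0 => /andP[t0 tp] st.
  have st0 : 0 < sin (t / 2) by apply: lt_le_trans st; rewrite divr_gt0.
  rewrite /u -sum_cos_half /f -mulrA mulKf ?gt_eqF// mulrBl.
  congr (_ - _); rewrite mulr_sumr; apply: eq_bigr => k _.
    have -> : (s + k%:R) * t = (k%:R + 1 / 2) * t + (s - 1 / 2) * t by field.
    have -> : (k.+1%:R - s) * t = (k%:R + 1 / 2) * t - (s - 1 / 2) * t by rewrite -natr1; field.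
    by rewrite cosD cosB; ring.
  have -> : k%:R * t = (k%:R + 1 / 2) * t - (1 / 2) * t by field.
  have -> : k.+1%:R * t = (k%:R + 1 / 2) * t + (1 / 2) * t by rewrite -natr1; field.
  by rewrite cosB cosD; ring.
rewrite (Rint_eq E) (Rint_sub mD); last 2 first.
- by apply: integ_sum => // k; apply: integ_add => //; exact: ic.
- by apply: integ_sum => // k; apply: integ_add => //; exact: ic.
congr (_ - _).
  rewrite (Rint_sum _ mD); last by move=> k; apply: integ_add => //; exact: ic.
  rewrite mulr_sumr; apply: eq_bigr => k _.
  rewrite (Rint_add mD); [|exact: ic|exact: ic].
  rewrite !ic' ?sin_shift ?sin_shiftN; first by ring.
  - by rewrite gt_eqF// subr_gt0 (lt_le_trans s1)// ler1n.
  - by rewrite gt_eqF// ltr_wpDr.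
rewrite (Rint_sum _ mD); last by move=> k; apply: integ_add => //; exact: ic.
have sk k : sin (k%:R * pi) = 0 :> R.
  by have := sin_shift 0 k; rewrite add0r mul0r sin0 mulr0.
(* Only the cosine of frequency 0, in the term k = 0, has a nonzero integral; that term is present
   because n + 1 terms are taken. *)
rewrite big_nat_recl//= big1_seq ?addr0; last first.
  move=> k _; rewrite (Rint_add mD); [|exact: ic|exact: ic].
  by rewrite !ic' ?sk ?mul0r ?addr0// pnatr_eq0.
rewrite (Rint_add mD); [|exact: ic|exact: ic].
rewrite [X in _ + X]ic' ?sk ?mul0r ?addr0 ?pnatr_eq0//.
rewrite (@Rint_eq R D _ (fun=> 1)); last by move=> t _; rewrite mul0r cos0.
rewrite /D Rintegral_itv_obnd_cbnd; last by apply: (integ_sub _ _ sD (integ_cst_itv _ _ _)).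
by rewrite Rint_cst_itv ?pi_ge0// subr0 mul1r.
Qed.

End Reflection.

(** * Arcs and rays of the Hankel contour *)

Section Arc.
Context {R : realType}.
Notation mu := (@lebesgue_measure R).
Implicit Types (D : set R) (f : R -> R) (x y a b c p s : R).
Local Notation pos := (`]0, +oo[%classic : set R).
Local Notation arcD := (`[0, pi]%classic : set R).

Lemma Rint_norm D f : measurable D -> integ D f ->
  `|\int[mu]_(x in D) f x| <= \int[mu]_(x in D) `|f x|.
Proof. by move=> mD fi; exact: (@le_normr_Rintegral _ _ R mu D f mD fi). Qed.

(* [x `^ a] times the real part of the integral of [e^z z^(-a)] over the upper half
   of the circle [|z| = x], parametrised by the argument [p] of [z]. *)
Definition arcf a x p := expR (x * cos p) * cos (x * sin p - a * p).
Definition Arc a x : R := \int[mu]_(p in arcD) arcf a x p.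

Lemma arcf_le a x p : `|arcf a x p| <= expR `|x|.
Proof.
rewrite /arcf normrM (ger0_norm (expR_ge0 _)) -[leRHS]mulr1.
apply: ler_pM; rewrite ?expR_ge0 ?cos_max// ler_expR.
apply: le_trans (ler_norm _) _; rewrite normrM ler_piMr// cos_max //.
Qed.

Lemma mea_arcf D a x : measurable_fun D (arcf a x).
Proof. by rewrite /arcf; mea. Qed.

Lemma integ_arcf a x : integ arcD (arcf a x).
Proof.
apply: (@integ_le R _ _ (fun=> expR `|x|)) => [||p _|]; [exact: measurable_itv|exact: mea_arcf|exact: arcf_le|].
exact: integ_cst_itv.
Qed.

Lemma Arc_le a x : `|Arc a x| <= pi * expR `|x|.
Proof.
apply: le_trans (Rint_norm (measurable_itv _) (integ_arcf a x)) _.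
apply: le_trans (Rint_le (measurable_itv _) (integ_norm (measurable_itv _) (integ_arcf a x)) (integ_cst_itv _ _ _) (fun p _ => arcf_le a x p)) _.
by rewrite Rint_cst_itv ?pi_ge0// subr0 mulrC.
Qed.

(** With z = x e^(i p), differentiating e^z in x multiplies it by e^(i p), which lowers a by 1. *)
Lemma arcf_derive a x p : is_derive x 1 (fun x => arcf a x p) (arcf (a - 1) x p).
Proof.
rewrite /arcf; isd.
have -> : x * sin p - (a - 1) * p = (x * sin p - a * p) + p by ring.
by rewrite (cosD _ p); ring.
Qed.

Lemma Arc_derive a x : is_derive x 1 (Arc a) (Arc (a - 1) x).
Proof.
have d1 y p : derive1 (fun x => arcf a x p) y = arcf (a - 1) y p.
  by rewrite derive1E; have [_ ->] := arcf_derive a y p.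
pose G p : R := expR (`|x| + 1).
have Ix : `]x - 1, x + 1[%classic x by rewrite /= in_itv/= ltrDl ltr01 andbT ltrBlDr ltrDl.
have intf y : `]x - 1, x + 1[%classic y -> lebesgue_measure.-integrable arcD (EFin \o arcf a y).
  by move=> _; exact: integ_arcf.
have derf y p : `]x - 1, x + 1[%classic y -> arcD p -> derivable (fun z => arcf a z p) y 1.
  by move=> _ _; have [] := arcf_derive a y p.
have intG : lebesgue_measure.-integrable arcD (EFin \o G) by exact: integ_cst_itv.
have Gub y p : `]x - 1, x + 1[%classic y -> arcD p -> `|partial1of2 (arcf a) y p| <= G p.
  rewrite /= !in_itv/= => /andP[y1 y2] _; rewrite /partial1of2 d1.
  apply: le_trans (arcf_le _ _ _) _; rewrite ler_expR.
  have -> : y = x + (y - x) by ring.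
  by apply: le_trans (ler_normD _ _) _; rewrite lerD2l ler_norml; apply/andP; split; lra.
have G0 p : 0 <= G p by exact: expR_ge0.
have dA := @derivable_under_integral R _ _ lebesgue_measure (arcf a) arcD (measurable_itv _) x _ _ Ix intf derf G G0 intG Gub.
have eA := @differentiation_under_integral R _ _ lebesgue_measure (arcf a) arcD (measurable_itv _) x _ _ Ix intf derf G G0 intG Gub.
apply: DeriveDef; first exact: dA.
rewrite -derive1E; apply: etrans eA _.
by apply: Rint_eq => p _; rewrite /partial1of2 d1.
Qed.

(** Integration by parts in the argument p: the primitive is the imaginary part of e^z (z / x)^(-a),
    and its value at z = - x is the boundary term. *)
Lemma Arc_rec a x : x * Arc (a - 1) x = a * Arc a x - expR (- x) * sin (pi * a).
Proof.
have [||_] := @FTC_cc R (fun p => x * arcf (a - 1) x p + - (a * arcf a x p))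
   (fun p => expR (x * cos p) * sin (x * sin p - a * p)) 0 pi (pi_gt0 R).
- move=> p _; isd; rewrite /arcf.
  have -> : x * sin p - (a - 1) * p = (x * sin p - a * p) + p by ring.
  by rewrite (cosD _ p); ring.
- by move=> p _; rewrite /arcf; isc.
rewrite sin0 sinpi !mulr0 subrr sin0 mulr0 subr0 sub0r cospi mulrN1 sinN.
rewrite (Rint_sub (measurable_itv _)); [|exact: integ_scale (measurable_itv _) (integ_arcf _ _)|exact: integ_scale (measurable_itv _) (integ_arcf _ _)].
rewrite !(Rint_scale _ (measurable_itv _))//; [|exact: integ_arcf|exact: integ_arcf].
rewrite -!/(Arc _ _) [a * pi]mulrC; lra.
Qed.

Lemma Arc_N1 x : Arc (- 1) x = 0.
Proof.
have [->|x0] := eqVneq x 0.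
  have [_] := @int_cos R 1 (oner_neq0 _); rewrite mul1r sinpi mul0r => E.
  rewrite -[RHS]E; apply: Rint_eq => p _.
  by rewrite /arcf !mul0r expR0 mul1r sub0r mulN1r opprK mul1r.
have := Arc_rec 0 x; rewrite sub0r mul0r mulr0 sin0 mulr0 subr0 => /eqP.
by rewrite mulf_eq0 (negbTE x0) => /eqP.
Qed.

Lemma Arc_0 x : 0 < x -> Arc 0 x = pi.
Proof.
move=> x0.
have d0 y : 0 <= y <= x -> Arc (0 - 1) y = 0 by rewrite sub0r Arc_N1.
rewrite -(isd0_eq (ltW x0) (fun y _ => Arc_derive 0 y) d0).
rewrite -[RHS](_ : 1 * (pi - 0) = _); last by ring.
rewrite -(Rint_cst_itv 1 (pi_ge0 R)); apply: Rint_eq => p _.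
by rewrite /arcf !mul0r subr0 expR0 cos0 mul1r.
Qed.

(** Cauchy's theorem on the slit disc: the rays run down to 0 and no Gamma term appears. In real
    form, the left side tends to 0 at 0 and by [Arc_rec] its derivative is sin(pi b) times the Gamma
    integrand. *)
Lemma Arc_inner b x : 0 < b -> 0 < x ->
  x `^ b * Arc (- b) x = sin (pi * b) * \int[mu]_(y in `]0, x]) gint b y.
Proof.
move=> b0 x0; set s := sin (pi * b).
have dF y : 0 < y -> is_derive y 1 (fun y => y `^ b * Arc (- b) y) (s * gint b y).
  move=> y0; refine (isd_eq (isd_mul (isd_powR b y0) (Arc_derive (- b) y)) _).
  have := Arc_rec (- b) y; rewrite mulrN sinN -/s => E.
  have -> : y `^ b = y `^ (b - 1) * y.
    rewrite -[X in _ * X]powRr1 ?(ltW y0)// -powRD ?(gt_eqF y0) ?implybT//.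
    by rewrite subrK.
  rewrite /gint; transitivity (y `^ (b - 1) * (y * Arc (- b - 1) y + b * Arc (- b) y)); first by ring.
  by rewrite E; ring.
have lF : y `^ b * Arc (- b) y @[y --> 0^'+] --> (0 : R).
  apply: (@squeeze_cvgr _ _ _ _ (fun y => - (y `^ b * (pi * expR 1))) (fun y => y `^ b * (pi * expR 1))).
  - near=> y; rewrite -ler_norml normrM (ger0_norm (powR_ge0 _ _)) ler_wpM2l ?powR_ge0//.
    apply: le_trans (Arc_le _ _) _; rewrite ler_pM2l ?pi_gt0// ler_expR.
    have y0 : 0 < y by near: y; exact: nbhs_right_gt.
    rewrite ger0_norm ?(ltW y0)//; near: y; exact: nbhs_right_le.
  - rewrite -[X in _ --> X]oppr0; apply: cvgN.
    by rewrite -[X in _ --> X](mul0r (pi * expR 1)); apply: cvgM; [exact: cvg_powR0|exact: cvg_cst].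
  - by rewrite -[X in _ --> X](mul0r (pi * expR 1)); apply: cvgM; [exact: cvg_powR0|exact: cvg_cst].
(* Either the left side is constant, or it is divided by s, whose sign is unknown, so that the
   integrand is nonnegative. *)
have [s0|s0] := eqVneq s 0.
  have [||||_] := @FTC_0c R (fun=> 0) (fun y => y `^ b * Arc (- b) y) 0 x x0.
  - by [].
  - by move=> y /andP[y0 _]; apply: isd_eq (dF y y0) _; rewrite s0 mul0r.
  - by move=> y _; exact: cvg_cst.
  - exact: lF.
  by rewrite subr0 s0 mul0r (@Rintegral_cst _ (measurableTypeR R))// mul0r.
have [||||_ ->] := @FTC_0c R (gint b) (fun y => s^-1 * (y `^ b * Arc (- b) y)) 0 x x0.
- by move=> y _; exact: gint_ge0.
- move=> y /andP[y0 _]; refine (isd_eq (isd_mul (isd_cst y s^-1) (dF y y0)) _).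
  by field.
- by move=> y /andP[y0 _]; exact: gint_cont.
- by rewrite -[X in _ --> X](mulr0 s^-1); apply: cvgM; [exact: cvg_cst|].
by rewrite subr0 mulVKf.
Unshelve. all: by end_near. Qed.

(** On [x, +oo[ the power y^(c - 1) is at most x^(c - 1 - |c|) y^|c|, which reduces any real c to a
    convergent Gamma integral. *)
Lemma integ_gint_tail c x : 0 < x -> integ `[x, +oo[ (gint c).
Proof.
move=> x0; pose m := `|c|.
have m1 : 0 < m + 1 by apply: ltr_wpDl => //; exact: normr_ge0.
have sub : `[x, +oo[%classic `<=` pos by apply: subset_itvr; rewrite bnd_simp.
have i1 : integ `[x, +oo[ (gint (m + 1)) by apply: (integ_sub _ _ sub (gint_integ m1)); exact: measurable_itv.
apply: (integ_le _ _ _ (integ_scale (x `^ (c - 1 - m)) _ i1)); [exact: measurable_itv|exact: mea_gint| |exact: measurable_itv].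
move=> y /=; rewrite in_itv/= andbT => xy; have y0 : 0 < y by apply: lt_le_trans xy.
rewrite ger0_norm ?gint_ge0// /gint mulrA ler_wpM2r ?expR_ge0// addrK.
have -> : y `^ (c - 1) = y `^ (c - 1 - m) * y `^ m.
  by rewrite -powRD ?(gt_eqF y0) ?implybT// subrK.
rewrite ler_wpM2r ?powR_ge0// -[c - 1 - m]opprK !(powRN _ (- _)) lef_pV2 ?posrE ?powR_gt0//.
apply: ge0_ler_powR; rewrite ?nnegrE ?(ltW x0) ?(ltW y0) ?xy//.
by have := ler_norm c; rewrite -/m; lra.
Qed.

Lemma gint_tail_rec a x : 0 < a -> 0 < x ->
  a * \int[mu]_(y in `[x, +oo[) gint (- a) y =
  x `^ (- a) * expR (- x) - \int[mu]_(y in `[x, +oo[) gint (1 - a) y.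
Proof.
move=> a0 x0; have mD : measurable (`[x, +oo[%classic : set R) by exact: measurable_itv.
have [||||_] := @FTC_cy R (fun y => a * gint (- a) y + gint (1 - a) y) (fun y => - (y `^ (- a) * expR (- y))) x 0.
- by move=> y _; apply: addr_ge0; [apply: mulr_ge0; [exact: ltW|exact: gint_ge0]|exact: gint_ge0].
- move=> y xy; have y0 : 0 < y by apply: lt_le_trans xy.
  isd => //; rewrite /gint (_ : 1 - a - 1 = - a); last by ring.
  by ring.
- move=> y xy; have y0 : 0 < y by apply: lt_le_trans xy.
  by apply: cvgD; [apply: cvgM; [exact: cvg_cst|exact: gint_cont]|exact: gint_cont].
- rewrite -[X in _ --> X]oppr0; apply: cvgN; rewrite -[X in _ --> X](mul0r 0); apply: cvgM; [exact: cvg_powRN|exact: cvgr_expR].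
rewrite sub0r opprK => <-.
rewrite (Rint_add mD); [|exact: integ_scale mD (integ_gint_tail _ x0)|exact: integ_gint_tail].
by rewrite (Rint_scale _ mD (integ_gint_tail _ x0)) addrK.
Qed.

(** Hankel's formula in real form. For -1 < a < 0 it is the inner identity completed by the
    reflection formula, and at a = 0 it is the value pi of the arc. A unit step in a combines the
    recursions of the arc, of the tail integral and of Gamma. *)
Lemma Arc_outer a x : - 1 < a -> 0 < x ->
  pi / Gamma (1 + a) = x `^ (- a) * Arc a x - sin (pi * a) * \int[mu]_(y in `[x, +oo[) gint (- a) y.
Proof.
move=> a1 x0.
have [n an] : exists n, a <= n%:R.
  exists (Num.trunc `|a|).+1; apply: le_trans (ler_norm a) _; apply: ltW.
  by have := @truncnS_gt R `|a|.
elim: n a a1 an => [|n IH] a a1 an.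
  have [->|aN0] := eqVneq a 0.
    by rewrite addr0 Gamma1 divr1 oppr0 powRr0 mul1r Arc_0// mulr0 sin0 mul0r subr0.
  have b0 : 0 < - a by rewrite oppr_gt0 lt_def eq_sym aN0.
  have s01 : 0 < - a < 1 by rewrite b0 ltrNl.
  have := Arc_inner b0 x0; rewrite opprK => ->.
  have sub : `[x, +oo[%classic `<=` pos by apply: subset_itvr; rewrite bnd_simp.
  have sub1 : `]0, x]%classic `<=` pos by apply: subset_itvl; rewrite bnd_simp.
  have sub2 : `]x, +oo[%classic `<=` pos by apply: subset_itvr; rewrite bnd_simp ltW.
  have j1 := integ_sub (measurable_itv _) (measurable_itv _) sub1 (gint_integ b0).
  have j2 := integ_sub (measurable_itv _) (measurable_itv _) sub2 (gint_integ b0).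
  have [_] := integ_pos_split x0 j1 j2; rewrite -GammaE => E.
  have Et : \int[mu]_(y in `]x, +oo[) gint (- a) y = \int[mu]_(y in `[x, +oo[) gint (- a) y.
    by apply: Rintegral_itv_obnd_cbnd.
  rewrite -Et mulrN sinN.
  have -> : pi / Gamma (1 + a) = sin (- a * pi) * Gamma (- a).
    rewrite -[in LHS](Gamma_reflection s01) opprK mulrA mulfK//.
    by rewrite gt_eqF// Gamma_gt0//; lra.
  by rewrite E mulNr sinN (mulrC a); ring.
have [a0|a0] := leP a n%:R; first exact: IH.
have {}a0 : 0 < a by apply: le_lt_trans a0.
have := IH (a - 1) _ _.
have -> : 1 + (a - 1) = a by ring.
move=> H; have := H _ _; rewrite (_ : - (a - 1) = 1 - a); last by ring.
have -> : sin (pi * (a - 1)) = - sin (pi * a).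
  by rewrite mulrBr mulr1 -[in RHS](subrK pi (pi * a)) sinDpi opprK.
move=> {}H.
have {}H : pi / Gamma a = x `^ (1 - a) * Arc (a - 1) x + sin (pi * a) * \int[mu]_(y in `[x, +oo[) gint (1 - a) y.
  by rewrite H ?mulNr ?opprK//; [lra|rewrite lerBlDr -natr1 in an *; lra].
have alg (P G X A A1 J J1 S e : R) : P / G = x * X * A1 + S * J1 ->
    x * A1 = a * A - e * S -> a * J = X * e - J1 -> P / (a * G) = X * A - S * J.
  move=> H1 H2 H3; apply: (mulfI (lt0r_neq0 a0)).
  have -> : a * (X * A - S * J) = X * (a * A - e * S) + S * (X * e - a * J) by ring.
  by rewrite -H2 H3 invfM mulrCA mulVKf ?gt_eqF// H1; ring.
have P : x `^ (1 - a) = x * x `^ (- a).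
  by rewrite powRD ?(gt_eqF x0) ?implybT// powRr1// ltW.
rewrite P in H; rewrite [1 + a]addrC (Gamma_rec a0).
exact: alg H (Arc_rec a x) (gint_tail_rec a0 x0).
Qed.

End Arc.

(** * Geometric sums along the rays *)

Section Kernel.
Context {R : realType}.
Notation mu := (@lebesgue_measure R).
Implicit Types (D : set R) (x y a c r t q s alpha theta rho : R).
Local Notation pos := (`]0, +oo[%classic : set R).

Lemma powR_sub1 x c : 0 < x -> x `^ (c - 1) = x `^ c / x.
Proof. by move=> x0; rewrite powRB ?powRr1 ?(ltW x0)// (gt_eqF x0) implybT. Qed.

Lemma invr_powR x c : 0 < x -> x^-1 `^ c = x `^ (- c).
Proof. by move=> x0; rewrite -powR_inv1 ?(ltW x0)// -powRrM mulN1r. Qed.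

(** The imaginary part of the sum of (rho e^(i theta))^k over 1 <= k <= n. *)
Definition sin_pow theta rho n : R := \sum_(0 <= k < n) sin (k.+1%:R * theta) * rho ^+ k.+1.

Lemma sin_powE theta rho n : (1 - 2 * cos theta * rho + rho ^+ 2) * sin_pow theta rho n =
  rho * (sin theta - rho ^+ n * sin (n.+1%:R * theta) + rho ^+ n.+1 * sin (n%:R * theta)).
Proof.
elim: n => [|n IH].
  by rewrite /sin_pow big_geq// mulr0 mul0r sin0 mulr0 addr0 !mul1r subrr mulr0.
rewrite /sin_pow big_nat_recr//= -/(sin_pow _ _ _) mulrDr IH.
have -> : sin (n.+2%:R * theta) = 2 * cos theta * sin (n.+1%:R * theta) - sin (n%:R * theta).
  have -> : n.+2%:R * theta = n.+1%:R * theta + theta by rewrite -[n.+2%:R]natr1 mulrDl mul1r.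
  have -> : n%:R * theta = n.+1%:R * theta - theta by rewrite -[n.+1%:R]natr1 mulrDl mul1r addrK.
  by rewrite sinD sinB; ring.
by rewrite !exprS; ring.
Qed.

Lemma sin_den_ge theta rho : sin theta ^+ 2 <= 1 - 2 * cos theta * rho + rho ^+ 2.
Proof.
rewrite -subr_ge0 (_ : _ - _ = (rho - cos theta) ^+ 2) ?sqr_ge0//.
by rewrite sin2cos2; ring.
Qed.

(** The closed form has three terms of size at most rho, whence the 3. The factor rho is kept
    because it will be a positive power of a ratio bounded by y / x, and so makes the bound
    integrable against [arcw], which behaves like 1 / y at 0. *)
Lemma sin_pow_le theta rho n : sin theta != 0 -> 0 <= rho <= 1 ->
  `|sin_pow theta rho n| <= 3 / sin theta ^+ 2 * rho.
Proof.
move=> s0 /andP[r0 r1]; have sp : 0 < sin theta ^+ 2 by rewrite exprn_even_gt0.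
have dp := lt_le_trans sp (sin_den_ge theta rho).
rewrite -(ler_pM2l dp) -{1}(gtr0_norm dp) -normrM sin_powE normrM (ger0_norm r0).
apply: (@le_trans _ _ (rho * 3)).
  rewrite ler_wpM2l//; apply: le_trans (ler_normD _ _) _.
  have h1 k z : `|rho ^+ k * sin z| <= 1.
    rewrite normrM (ger0_norm (exprn_ge0 _ r0)) -[leRHS]mulr1.
    by apply: ler_pM => //; [exact: exprn_ge0|exact: exprn_ile1|exact: sin_max].
  have := h1 n.+1 (n%:R * theta); have := h1 n (n.+1%:R * theta).
  have := ler_normB (sin theta) (rho ^+ n * sin (n.+1%:R * theta)); have := sin_max theta.
  lra.
rewrite [leLHS]mulrC mulrA ler_wpM2r// mulrCA ler_peMr// ler_pdivlMr// mul1r.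
exact: sin_den_ge.
Qed.

(** Half of the conjugate Poisson kernel: the imaginary part of r / (1 - r) at r = rho e^(i
    theta). *)
Definition poisson theta rho : R := sin theta * rho / (1 - 2 * cos theta * rho + rho ^+ 2).

Lemma sin_pow_cvg theta rho : sin theta != 0 -> 0 <= rho < 1 ->
  sin_pow theta rho n @[n --> \oo] --> poisson theta rho.
Proof.
rewrite /poisson =>  s0 /andP[r0 r1]; have sp : 0 < sin theta ^+ 2 by rewrite exprn_even_gt0.
have dp := lt_le_trans sp (sin_den_ge theta rho); set den := 1 - _ + _ in dp *.
have E n : sin_pow theta rho n = rho * (sin theta - rho ^+ n * sin (n.+1%:R * theta) + rho ^+ n.+1 * sin (n%:R * theta)) / den.
  by rewrite -sin_powE mulrC mulKf// gt_eqF.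
have rn : rho ^+ n @[n --> \oo] --> (0 : R) by apply: cvg_expr; rewrite ger0_norm.
have z (u : nat -> R) (w : nat -> R) : u n @[n --> \oo] --> (0 : R) -> (forall n, `|w n| <= 1) -> u n * w n @[n --> \oo] --> (0 : R).
  move=> u0 w1; apply/norm_cvg0P; have := cvg_norm u0; rewrite normr0 => un.
  apply: (@squeeze_cvgr _ _ _ _ (fun=> 0) (fun n => `|u n|)).
  - by near=> n; rewrite normr_ge0 normrM ler_piMr.
  - exact: cvg_cst.
  - exact: un.
rewrite (eq_cvg _ _ E) [sin theta * rho]mulrC.
apply: cvgM; last exact: cvg_cst.
apply: cvgM; first exact: cvg_cst.
rewrite -[X in _ --> X]addr0; apply: cvgD.
  rewrite -[X in _ --> X]subr0; apply: cvgB; first exact: cvg_cst.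
  by apply: z => // n; exact: sin_max.
by apply: z => [|n]; [rewrite (cvg_shiftS (fun n => rho ^+ n)); exact: rn|exact: sin_max].
Unshelve. all: by end_near. Qed.

(** The weight on the rays. The summands 1 / x and 1 / y come from the two reciprocals of Gamma in
    each term, whose arguments differ by 1. *)
Definition arcw x y : R := (x^-1 + y^-1) * expR (- y).

Lemma arcw_bound alpha x y : 0 < x -> 0 < y ->
  (y / x) `^ alpha * arcw x y = x `^ (- alpha - 1) * gint (alpha + 1) y + x `^ (- alpha) * gint alpha y.
Proof.
move=> x0 y0; rewrite /arcw /gint addrK powRM ?(ltW y0)// ?invr_ge0 ?(ltW x0)//.
rewrite (invr_powR _ x0).
have -> : x `^ (- alpha - 1) = x `^ (- alpha) * x^-1.
  by rewrite (powR_sub1 _ x0).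
have -> : y `^ (alpha - 1) = y `^ alpha * y^-1.
  by rewrite (powR_sub1 _ y0).
by ring.
Qed.

(** Used with tau = y / x inside the circle and tau = x / y outside; in the second case tau < 1 < y
    / x, so the same dominating function serves. *)
Lemma sin_pow_int alpha x D (tau : R -> R) : 0 < alpha -> sin (pi * alpha) != 0 -> 0 < x ->
  measurable D -> measurable_fun D tau -> D `<=` pos ->
  (forall y, D y -> 0 < tau y < 1 /\ tau y <= y / x) ->
  integ D (fun y => poisson (pi * alpha) (tau y `^ alpha) * arcw x y) /\
  \int[mu]_(y in D) (sin_pow (pi * alpha) ((tau y) `^ alpha) n * arcw x y) @[n --> \oo] -->
  (\int[mu]_(y in D) (poisson (pi * alpha) (tau y `^ alpha) * arcw x y) : R).
Proof.
move=> a0 s0 x0 mD mt sub ht.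
have w0 y : 0 < y -> 0 <= arcw x y by move=> y0; rewrite /arcw mulr_ge0 ?expR_ge0 ?addr_ge0 ?invr_ge0 ?(ltW x0) ?(ltW y0).
have r01 y : D y -> 0 <= tau y `^ alpha < 1.
  move=> /ht[/andP[t0 t1] _]; rewrite powR_ge0/= (_ : 1 = 1 `^ alpha); last by rewrite powR1.
  by apply: gt0_ltr_powR; rewrite ?nnegrE ?(ltW t0).
have ig : integ D (fun y => 3 / sin (pi * alpha) ^+ 2 * (x `^ (- alpha - 1) * gint (alpha + 1) y + x `^ (- alpha) * gint alpha y)).
  have mp := @measurable_pos R; have a1 : 0 < alpha + 1 by lra.
  apply: (integ_sub mD mp sub); apply: (integ_scale _ mp); apply: (integ_add mp).
    exact: integ_scale mp (gint_integ a1).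
  exact: integ_scale mp (gint_integ a0).
apply: (Rdct mD _ _ ig).
- by move=> n; rewrite /sin_pow /arcw; mea => k; mea; exact: mt.
- by move=> y Dy; apply: cvgM; [apply: sin_pow_cvg => //; exact: r01|exact: cvg_cst].
- move=> n y Dy; have y0 := in_pos (sub _ Dy); have [/andP[t0 t1] tx] := ht _ Dy.
  rewrite normrM (ger0_norm (w0 _ y0)) -arcw_bound// [leRHS]mulrA ler_wpM2r ?w0//.
  have /andP[q0 q1] := r01 _ Dy.
  apply: le_trans (sin_pow_le _ _ _) _ => //; first by rewrite q0 (ltW q1).
  rewrite ler_wpM2l ?divr_ge0 ?sqr_ge0//.
  by apply: ge0_ler_powR; rewrite ?nnegrE ?(ltW a0) ?(ltW t0) ?divr_ge0 ?(ltW y0) ?(ltW x0).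
Qed.

End Kernel.

(** * Arcs and rays of a single term of the series *)

Section KernelRepr.
Context {R : realType}.
Notation mu := (@lebesgue_measure R).
Implicit Types (D : set R) (x y a b c t p alpha : R).
Local Notation pos := (`]0, +oo[%classic : set R).
Local Notation arcD := (`[0, pi]%classic : set R).

(** The difference of the inner identities at b and b + 1: as sin(pi (b + 1)) = - sin(pi b), their
    ray integrals add up. *)
Lemma inner_term b x : 0 < b -> 0 < x ->
  integ `]0, x[ (fun y => (y / x) `^ b * arcw x y) /\
  sin (pi * b) * \int[mu]_(y in `]0, x[) ((y / x) `^ b * arcw x y) = Arc (- b) x - Arc (- b - 1) x.
Proof.
move=> b0 x0; have b10 : 0 < b + 1 by lra.
have mD : measurable (`]0, x[%classic : set R) by exact: measurable_itv.
have mD' : measurable (`]0, x]%classic : set R) by exact: measurable_itv.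
have mp := @measurable_pos R.
have sub : `]0, x[%classic `<=` pos by apply: subset_itvl; rewrite bnd_simp.
have i0 := integ_sub mD mp sub (gint_integ b0); have i1 := integ_sub mD mp sub (gint_integ b10).
have E y : (`]0, x[%classic : set R) y -> x `^ (- b - 1) * gint (b + 1) y + x `^ (- b) * gint b y = (y / x) `^ b * arcw x y.
  by rewrite /= in_itv/= => /andP[y0 _]; rewrite arcw_bound.
have j0 := integ_scale (x `^ (- b)) mD i0; have j1 := integ_scale (x `^ (- b - 1)) mD i1.
split; first exact: integ_eq mD E (integ_add mD j1 j0).
rewrite -(Rint_eq E) (Rint_add mD j1 j0) (Rint_scale _ mD i0) (Rint_scale _ mD i1).
have oc c (ic : integ `]0, x[ (gint c)) : \int[mu]_(y in `]0, x[) gint c y = \int[mu]_(y in `]0, x]) gint c y.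
  by apply: Rintegral_itv_bndo_bndc; exact: ic.
rewrite (oc _ i0) (oc _ i1); have A0 := Arc_inner b0 x0; have A1 := Arc_inner b10 x0.
have E1 : sin (pi * (b + 1)) = - sin (pi * b) by rewrite mulrDr mulr1 sinDpi.
have xb c : x `^ (- c) * x `^ c = 1 by rewrite powRN mulVf// gt_eqF// powR_gt0.
rewrite E1 opprD in A1.
have -> : Arc (- b) x = x `^ (- b) * (x `^ b * Arc (- b) x) by rewrite mulrA xb mul1r.
have -> : Arc (- b - 1) x = x `^ (- b - 1) * (x `^ (b + 1) * Arc (- b - 1) x).
  by rewrite mulrA -opprD xb mul1r.
by rewrite A0 A1; ring.
Qed.

(** Hankel's formula at a - 1 and at a, combined in the same way. *)
Lemma outer_term a x : 0 < a -> 0 < x ->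
  integ `]x, +oo[ (fun y => (x / y) `^ a * arcw x y) /\
  sin (pi * a) * \int[mu]_(y in `]x, +oo[) ((x / y) `^ a * arcw x y) =
  pi * (x `^ (a - 1) / Gamma a - x `^ a / Gamma (1 + a)) - Arc (a - 1) x + Arc a x.
Proof.
move=> a0 x0.
have mD : measurable (`]x, +oo[%classic : set R) by exact: measurable_itv.
have mD' : measurable (`[x, +oo[%classic : set R) by exact: measurable_itv.
have sub : `]x, +oo[%classic `<=` (`[x, +oo[%classic : set R) by apply: subset_itvr; rewrite bnd_simp.
have i0 := integ_sub mD mD' sub (integ_gint_tail (- a) x0).
have i1 := integ_sub mD mD' sub (integ_gint_tail (1 - a) x0).
have E y : (`]x, +oo[%classic : set R) y -> x `^ (a - 1) * gint (1 - a) y + x `^ a * gint (- a) y = (x / y) `^ a * arcw x y.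
  rewrite /= in_itv/= andbT => xy; have y0 : 0 < y by apply: lt_trans xy.
  rewrite -[x / y]invf_div; have -> : (y / x)^-1 `^ a = (y / x) `^ (- a).
    by rewrite -powR_inv1 ?divr_ge0 ?(ltW x0) ?(ltW y0)// -powRrM mulN1r.
  by rewrite arcw_bound// opprK [- a + 1]addrC.
have j0 := integ_scale (x `^ a) mD i0; have j1 := integ_scale (x `^ (a - 1)) mD i1.
split; first exact: integ_eq mD E (integ_add mD j1 j0).
rewrite -(Rint_eq E) (Rint_add mD j1 j0) (Rint_scale _ mD i0) (Rint_scale _ mD i1).
have oc c : \int[mu]_(y in `]x, +oo[) gint c y = \int[mu]_(y in `[x, +oo[) gint c y.
  by apply: Rintegral_itv_obnd_cbnd; exact: integ_sub mD mD' sub (integ_gint_tail c x0).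
rewrite !oc; have a1 : - 1 < a - 1 by lra.
have a1' : - 1 < a by lra.
have A0 := Arc_outer a1' x0; have A1 := Arc_outer a1 x0.
have E1 : sin (pi * (a - 1)) = - sin (pi * a).
  by rewrite mulrBr mulr1 -[in RHS](subrK pi (pi * a)) sinDpi opprK.
rewrite E1 opprB [1 + (a - 1)]addrC subrK in A1.
have xb c : x `^ c * x `^ (- c) = 1 by rewrite powRN mulfV// gt_eqF// powR_gt0.
have alg (P G1 G0 X1 Y1 X0 Y0 B1 B0 S J1 J0 : R) : X1 * Y1 = 1 -> X0 * Y0 = 1 ->
    P / G0 = Y0 * B0 - S * J0 -> P / G1 = Y1 * B1 - - S * J1 ->
    S * (X1 * J1 + X0 * J0) = P * (X1 / G1 - X0 / G0) - B1 + B0.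
  move=> h1 h0 H0 H1.
  have -> : P * (X1 / G1 - X0 / G0) = X1 * (P / G1) - X0 * (P / G0) by ring.
  have -> : X1 * (P / G1) = X1 * Y1 * B1 + X1 * (S * J1) by rewrite H1; ring.
  have -> : X0 * (P / G0) = X0 * Y0 * B0 - X0 * (S * J0) by rewrite H0; ring.
  by rewrite h1 h0; ring.
have h1 := xb (a - 1); rewrite opprB in h1.
exact: alg h1 (xb a) A0 A1.
Qed.

(** The difference of the arc integrands at the parameters -1 and 0. It vanishes at p = 0, which
    offsets the zero of sin(alpha p / 2) there. *)
Definition arcg x p := expR (x * cos p) * (cos (x * sin p + p) - cos (x * sin p)).

(** The parameters a and - a enter symmetrically, so the dependence on a reduces to the even factor
    2 cos(a p). *)
Lemma arc_terms a x : Arc (a - 1) x - Arc a x - (Arc (- a) x - Arc (- a - 1) x) =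
  \int[mu]_(p in arcD) (arcg x p * (2 * cos (a * p))).
Proof.
have mD : measurable arcD by exact: measurable_itv.
have E p : arcD p -> arcf (a - 1) x p - arcf a x p - (arcf (- a) x p - arcf (- a - 1) x p) = arcg x p * (2 * cos (a * p)).
  move=> _; rewrite /arcf /arcg.
  have -> : x * sin p - (a - 1) * p = (x * sin p + p) - a * p by ring.
  have -> : x * sin p - (- a - 1) * p = (x * sin p + p) + a * p by ring.
  have -> : x * sin p - (- a) * p = x * sin p + a * p by ring.
  rewrite [cos (x * sin p + p - a * p)]cosB [cos (x * sin p + p + a * p)]cosD [cos (x * sin p - a * p)]cosB [cos (x * sin p + a * p)]cosD.
  by ring.
rewrite -(Rint_eq E) /Arc -!(Rint_sub mD) //; do ?[exact: integ_arcf|apply: (integ_add mD)|apply: (integ_opp mD)].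
Qed.

(** The contribution of the exponent alpha (n + 1) to the series of D_1. The constant -1 of that
    series is left out, because the identities on the rays need a positive exponent. *)
Definition dterm alpha x (n : nat) : R :=
  x `^ (alpha * n.+1%:R - 1) / Gamma (alpha * n.+1%:R) - x `^ (alpha * n.+1%:R) / Gamma (1 + alpha * n.+1%:R).

Lemma integ_arcg_mul c x : integ arcD (fun p => arcg x p * (2 * cos (c * p))).
Proof.
have mD : measurable arcD by exact: measurable_itv.
apply: (@integ_le R _ _ (fun=> expR `|x| * (2 * 2))) => [||p _|]; [exact: mD|by rewrite /arcg; mea| |exact: integ_cst_itv].
rewrite /arcg 2!normrM (ger0_norm (expR_ge0 _)) -mulrA.
apply: ler_pM; rewrite ?expR_ge0 ?mulr_ge0//.
  rewrite ler_expR; apply: le_trans (ler_norm _) _; rewrite normrM ler_piMr// cos_max //.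
apply: ler_pM => //.
  apply: le_trans (ler_normB _ _) _.
  by have := cos_max (x * sin p + p); have := cos_max (x * sin p); lra.
by rewrite normrM ger0_norm// ler_piMr// cos_max.
Qed.

Lemma sin_pow_sum alpha x D (tau : R -> R) n : measurable D ->
  (forall k, integ D (fun y => (tau y) `^ (alpha * k.+1%:R) * arcw x y)) -> (forall y, D y -> 0 <= tau y) ->
  \int[mu]_(y in D) (sin_pow (pi * alpha) ((tau y) `^ alpha) n * arcw x y) =
  \sum_(0 <= k < n) sin (pi * (alpha * k.+1%:R)) * \int[mu]_(y in D) ((tau y) `^ (alpha * k.+1%:R) * arcw x y).
Proof.
move=> mD hi t0.
have E y : D y -> \sum_(0 <= k < n) (sin (pi * (alpha * k.+1%:R)) * ((tau y) `^ (alpha * k.+1%:R) * arcw x y)) = sin_pow (pi * alpha) ((tau y) `^ alpha) n * arcw x y.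
  move=> Dy; rewrite /sin_pow mulr_suml; apply: eq_bigr => k _.
  by rewrite mulrA powRrM powR_mulrn ?powR_ge0//; congr (sin _ * _ * _); rewrite [RHS]mulrC mulrA.
rewrite -(Rint_eq E) Rint_sum//; last by move=> k; exact: integ_scale mD (hi k).
by apply: eq_bigr => k _; rewrite (Rint_scale _ mD (hi k)).
Qed.

Lemma dterm_sum alpha x n : 0 < alpha -> 0 < x ->
  pi * \sum_(0 <= k < n) dterm alpha x k =
  \int[mu]_(p in arcD) (arcg x p * \sum_(0 <= k < n) 2 * cos (alpha * k.+1%:R * p)) +
  \int[mu]_(y in `]0, x[) (sin_pow (pi * alpha) ((y / x) `^ alpha) n * arcw x y) +
  \int[mu]_(y in `]x, +oo[) (sin_pow (pi * alpha) ((x / y) `^ alpha) n * arcw x y).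
Proof.
move=> a0 x0.
have ak k : 0 < alpha * k.+1%:R by rewrite mulr_gt0.
have mD : measurable arcD by exact: measurable_itv.
have E p : arcD p -> \sum_(0 <= k < n) (arcg x p * (2 * cos (alpha * k.+1%:R * p))) = arcg x p * \sum_(0 <= k < n) 2 * cos (alpha * k.+1%:R * p).
  by rewrite mulr_sumr.
rewrite -(Rint_eq E) Rint_sum//; last by move=> k; exact: integ_arcg_mul.
rewrite sin_pow_sum; [|exact: measurable_itv|by move=> k; have [] := inner_term (ak k) x0|]; last first.
  by move=> y /=; rewrite in_itv/= => /andP[y0 _]; rewrite divr_ge0 ?(ltW y0) ?(ltW x0).
rewrite sin_pow_sum; [|exact: measurable_itv|by move=> k; have [] := outer_term (ak k) x0|]; last first.
  move=> y /=; rewrite in_itv/= andbT => xy; have y0 : 0 < y by apply: lt_trans xy.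
  by rewrite divr_ge0 ?(ltW y0) ?(ltW x0).
rewrite mulr_sumr -!big_split/=; apply: eq_bigr => k _.
have [_ H1] := inner_term (ak k) x0; have [_ H2] := outer_term (ak k) x0.
have H3 := arc_terms (alpha * k.+1%:R) x.
have alg (P D A B C b1 b2 c1 c2 : R) : B = b1 - b2 -> C = P * D - c1 + c2 ->
    c1 - c2 - (b1 - b2) = A -> P * D = A + B + C.
  by move=> -> -> <-; ring.
exact: alg H1 H2 H3.
Qed.

End KernelRepr.

(** * Summation over the terms of the series *)

Section KernelLimit.
Context {R : realType}.
Notation mu := (@lebesgue_measure R).
Implicit Types (f : R -> R) (x y a b c p q s u v alpha : R).
Local Notation pos := (`]0, +oo[%classic : set R).
Local Notation arcD := (`[0, pi]%classic : set R).

Lemma integ_itv_closed_r (b : itv_bound R) c f : integ [set` Interval b (BLeft c)] f ->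
  measurable_fun [set` Interval b (BRight c)] f -> integ [set` Interval b (BRight c)] f.
Proof.
move=> fi mf; apply/integrableP; split; first exact/measurable_EFinP.
rewrite -integral_itv_bndo_bndc; first by have /integrableP[] := fi.
apply: measurableT_comp => //; apply/measurable_EFinP.
by apply: measurable_funS mf => //; apply: subset_itvl; rewrite bnd_simp.
Qed.

(** The Dirichlet kernel without its constant term. *)
Lemma sum_cos u n : sin (u / 2) != 0 ->
  \sum_(0 <= k < n) 2 * cos (k.+1%:R * u) = sin (n%:R * u + u / 2) / sin (u / 2) - 1.
Proof.
move=> s0; elim: n => [|n IH]; first by rewrite big_geq// mul0r add0r divff// subrr.
rewrite big_nat_recr//= IH.
have -> : n%:R * u + u / 2 = n.+1%:R * u - u / 2 by rewrite -[n.+1%:R]natr1; field.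
by rewrite sinB sinD; field.
Qed.

(** The numerator is at most p e^|x| since cos is 1-Lipschitz, and the denominator at least (p / pi)
    sin(alpha pi / 2) by concavity. At p = 0 the quotient is 0 by the convention on inverses. *)
Lemma arc_quot_le alpha x p : 0 < alpha < 2 -> arcD p ->
  `|arcg x p / sin (alpha * p / 2)| <= expR `|x| * (pi / sin (alpha * pi / 2)).
Proof.
move=> /andP[a0 a2] /=; rewrite in_itv/= => /andP[p0 pp].
have pi0 := @pi_gt0 R.
have [->|pN0] := eqVneq p 0.
  rewrite mulr0 mul0r sin0 invr0 mulr0 normr0 mulr_ge0 ?expR_ge0// divr_ge0 ?ltW//.
  by apply: sin_gt0_pi; apply/andP; split; [nra|rewrite ltr_pdivrMr//; nra].
have pg : 0 < p by rewrite lt_def pN0.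
have v0 : 0 < alpha * pi / 2 < pi by apply/andP; split; [nra|rewrite ltr_pdivrMr//; nra].
have sv := sin_gt0_pi v0; case/andP: v0 => v0 v1.
have := @sin_scale R (p / pi) (alpha * pi / 2) _ _.
rewrite (ltW v0) (ltW v1) divr_ge0 ?(ltW pi0) ?(ltW pg)// ler_pdivrMr// mul1r pp.
move=> /(_ isT isT); have -> : p / pi * (alpha * pi / 2) = alpha * p / 2.
  have H q : 0 < q -> p / q * (alpha * q / 2) = alpha * p / 2 by move=> q0; field; rewrite gt_eqF.
  exact: H.
move=> ge; have s0 : 0 < p / pi * sin (alpha * pi / 2) by rewrite mulr_gt0// divr_gt0.
have sp := lt_le_trans s0 ge.
rewrite normrM normfV (gtr0_norm sp) ler_pdivrMr//.
rewrite /arcg normrM (ger0_norm (expR_ge0 _)) -!mulrA; apply: ler_pM; rewrite ?expR_ge0//.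
  rewrite ler_expR; apply: le_trans (ler_norm _) _; rewrite normrM ler_piMr// cos_max //.
apply: le_trans (cos_lip _ _) _; rewrite addrAC subrr add0r (gtr0_norm pg).
rewrite !mulrA mulrAC ler_pdivlMr// [leRHS]mulrC -ler_pdivrMr// mulrAC; exact: ge.
Qed.

(** By [dterm_sum], a partial sum is an arc integral plus two ray integrals with known limits. The
    constant -1 of the Dirichlet sum leaves minus the integral of [arcg], which is pi: hence the 1
    subtracted from L. *)
Lemma sum_dterm_lim alpha x L : 0 < alpha < 2 -> sin (pi * alpha) != 0 -> 0 < x ->
  \sum_(0 <= k < n) dterm alpha x k @[n --> \oo] --> L ->
  integ pos (fun y => x^-1 * mlker alpha (y / x) * expR (- y)) /\
  pi * (L - 1) = \int[mu]_(y in pos) (x^-1 * mlker alpha (y / x) * expR (- y)).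
Proof.
move=> /[dup] a02 /andP[a0 a2] s0 x0 Lc.
have mD : measurable arcD by exact: measurable_itv.
have mD1 : measurable (`]0, x[%classic : set R) by exact: measurable_itv.
have mD1' : measurable (`]0, x]%classic : set R) by exact: measurable_itv.
have mD2 : measurable (`]x, +oo[%classic : set R) by exact: measurable_itv.
have sub1 : `]0, x[%classic `<=` pos by apply: subset_itvl; rewrite bnd_simp.
have sub2 : `]x, +oo[%classic `<=` pos by apply: subset_itvr; rewrite bnd_simp ltW.
pose K y := x^-1 * mlker alpha (y / x) * expR (- y).
have KE y : 0 < y -> K y = poisson (pi * alpha) ((y / x) `^ alpha) * arcw x y.
  move=> y0; rewrite /K /mlker /poisson -/(mden _ _) /arcw; set d := mden _ _; set q := _ `^ _.
  rewrite (_ : x^-1 + y^-1 = x^-1 * (1 + (y / x)^-1)); first by ring.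
  by field; rewrite ?gt_eqF.
have [|i1 c1] := @sin_pow_int R alpha x `]0, x[ (fun y => y / x) a0 s0 x0 mD1 ltac:(mea) sub1 _.
- by move=> y /=; rewrite in_itv/= => /andP[y0 yx]; rewrite divr_gt0// ltr_pdivrMr// mul1r.
have [|i2 c2] := @sin_pow_int R alpha x `]x, +oo[ (fun y => x / y) a0 s0 x0 mD2 ltac:(mea) sub2 _.
- move=> y /=; rewrite in_itv/= andbT => xy; have y0 := lt_trans x0 xy.
  have h : x / y < 1 by rewrite ltr_pdivrMr// mul1r.
  rewrite divr_gt0// h; split=> //; apply: (@le_trans _ _ 1); first exact: ltW.
  by rewrite ler_pdivlMr// mul1r ltW.
have E1 y : (`]0, x[%classic : set R) y -> poisson (pi * alpha) ((y / x) `^ alpha) * arcw x y = K y.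
  by move=> /= yD; rewrite KE//; move: yD; rewrite in_itv/= => /andP[].
(* Outside the circle the ratio is inverted, which does not affect [poisson]. *)
have E2 y : (`]x, +oo[%classic : set R) y -> poisson (pi * alpha) ((x / y) `^ alpha) * arcw x y = K y.
  rewrite /= in_itv/= andbT => xy; have y0 := lt_trans x0 xy; rewrite KE//.
  have -> : (x / y) `^ alpha = ((y / x) `^ alpha)^-1.
    by rewrite -powRN -[- alpha]mulN1r powRrM powR_inv1 ?invf_div ?divr_ge0 ?(ltW x0) ?(ltW y0).
  set q := (y / x) `^ alpha; have q0 : 0 < q by rewrite powR_gt0// divr_gt0.
  rewrite /poisson; congr (_ * _); have d0 : 0 < 1 - 2 * cos (pi * alpha) * q + q ^+ 2.
    by apply: lt_le_trans (sin_den_ge _ _); rewrite exprn_even_gt0.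
  rewrite -!mulrA; congr (_ * _).
  have -> : 1 - 2 * (cos (pi * alpha) * q^-1) + q^-1 ^+ 2 = (1 - 2 * cos (pi * alpha) * q + q ^+ 2) / q ^+ 2.
    by field; rewrite gt_eqF.
  by field; rewrite -?mulrA ?gt_eqF// mulrA.
have j1 := integ_eq mD1 E1 i1; have j2 := integ_eq mD2 E2 i2.
rewrite (Rint_eq E1) in c1; rewrite (Rint_eq E2) in c2.
have j1' : integ `]0, x] K.
  by apply: integ_itv_closed_r j1 _; rewrite /K /mlker /mden; mea.
have [jK IK] := integ_pos_split x0 j1' j2; split; first exact: jK.
rewrite IK -(Rintegral_itv_bndo_bndc j1).
pose f p := arcg x p / sin (alpha * p / 2).
pose un n p := sin (n%:R * (alpha * p) + alpha * p / 2).
have fi : integ arcD f.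
  apply: (@integ_le R _ _ (fun=> expR `|x| * (pi / sin (alpha * pi / 2)))); [exact: mD|by rewrite /f /arcg; mea| |exact: integ_cst_itv].
  by move=> p pD; exact: arc_quot_le.
have spos p : arcD p -> p != 0 -> 0 < sin (alpha * p / 2).
  rewrite /= in_itv/= => /andP[p0 pp] pN0; have pg : 0 < p by rewrite lt_def pN0.
  by apply: sin_gt0_pi; apply/andP; split; [nra|rewrite ltr_pdivrMr//; nra].
have Ef n p : arcD p -> arcg x p * \sum_(0 <= k < n) 2 * cos (alpha * k.+1%:R * p) = f p * un n p - arcg x p.
  move=> pD; have [->|pN0] := eqVneq p 0.
    by rewrite /f /arcg sin0 !(mulr0, addr0, subrr, mul0r, sin0).
  rewrite -[X in _ = _ - X]mulr1 /f -mulrA -mulrBr; congr (_ * _).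
  rewrite mulrC -sum_cos ?gt_eqF ?spos//; apply: eq_bigr => k _.
  by rewrite mulrA [k.+1%:R * _]mulrC.
have L0 : pi * (L - 1) - (\int[mu]_(x in `]0, x[) K x + \int[mu]_(x in `]x, +oo[) K x) = 0.
  apply: (@cesaro_oscillation R arcD f un (fun p => `|sin (alpha * p / 2)|^-1)) => //.
  - by move=> n; rewrite /un; mea.
  - by move=> n p _; exact: sin_max.
  - move=> n p pD; have [->|pN0] := eqVneq p 0.
      rewrite big1 ?normr0 ?invr_ge0// => k _.
      by rewrite /un !(mulr0, mul0r, addr0) sin0.
    by apply: sum_sin_bound; rewrite gt_eqF// spos.
  have un_i n : integ arcD (fun p => f p * un n p).
    apply: (integ_le mD _ _ (integ_norm mD fi)); first by rewrite /f /un /arcg; mea.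
    by move=> p _; rewrite normrM ler_piMr// sin_max.
  have Eg p : arcD p -> arcf (- 1) x p - arcf 0 x p = arcg x p.
    by move=> _; rewrite /arcf /arcg mulN1r opprK mul0r subr0; ring.
  have gi : integ arcD (arcg x).
    by apply: (integ_eq mD Eg); apply: (integ_add mD); [|apply: (integ_opp mD)]; exact: integ_arcf.
  have Ig : \int[mu]_(p in arcD) arcg x p = - pi.
    rewrite -(Rint_eq Eg) (Rint_sub mD) ?integ_arcf// -/(Arc _ _) -/(Arc 0 x).
    by rewrite Arc_N1 Arc_0// sub0r.
  have E n : \int[mu]_(p in arcD) (f p * un n p) = pi * (\sum_(0 <= k < n) dterm alpha x k - 1) -
    (\int[mu]_(y in `]0, x[) (sin_pow (pi * alpha) ((y / x) `^ alpha) n * arcw x y) +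
     \int[mu]_(y in `]x, +oo[) (sin_pow (pi * alpha) ((x / y) `^ alpha) n * arcw x y)).
    rewrite mulrBr mulr1 dterm_sum// (Rint_eq (Ef n)) (Rint_sub mD (un_i n) gi) Ig opprK.
    have alg (J P A B : R) : J = J + P + A + B - P - (A + B) by ring.
    exact: alg.
  rewrite (eq_cvg _ _ E); apply: cvgB; last exact: cvgD c1 c2.
  by apply: cvgM; [exact: cvg_cst|apply: cvgB => //; exact: cvg_cst].
by move/eqP: L0; rewrite subr_eq0 => /eqP.
Qed.

End KernelLimit.

Section Laplace.
Context {R : realType}.
Notation mu := (@lebesgue_measure R).
Implicit Types (f : R -> R) (x y a t s alpha : R).
Local Notation pos := (`]0, +oo[%classic : set R).

(** The substitution y = x t, made after division by sin(pi alpha) so that the integrand is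
    nonnegative for 1 < alpha < 2 as well. *)
Lemma mlker_laplace alpha x L : 0 < alpha < 2 -> sin (pi * alpha) != 0 -> 0 < x ->
  \sum_(0 <= k < n) dterm alpha x k @[n --> \oo] --> L ->
  integ pos (fun t => mlker alpha t * expR (- (x * t))) /\
  pi * (L - 1) = \int[mu]_(t in pos) (mlker alpha t * expR (- (x * t))).
Proof.
move=> a02 s0 x0 Lc; have [jK IK] := sum_dterm_lim a02 s0 x0 Lc.
set s := sin (pi * alpha) in s0.
have mp := @measurable_pos R.
pose f y := x^-1 * ((1 + x * y^-1) * (x `^ (- alpha) * y `^ alpha) /
   (1 - 2 * cos (pi * alpha) * (x `^ (- alpha) * y `^ alpha) + (x `^ (- alpha) * y `^ alpha) * (x `^ (- alpha) * y `^ alpha))) * expR (- y).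
have E y : pos y -> x^-1 * mlker alpha (y / x) * expR (- y) = s * f y.
  move=> /in_pos y0; rewrite /f /mlker -/s /mden.
  have -> : (y / x) `^ alpha = x `^ (- alpha) * y `^ alpha.
    rewrite powRM ?(ltW y0) ?invr_ge0 ?(ltW x0)// mulrC; congr (_ * _).
    by rewrite (invr_powR _ x0).
  by rewrite invf_div expr2; ring.
have d0 y : 0 < y -> 0 < 1 - 2 * cos (pi * alpha) * (x `^ (- alpha) * y `^ alpha) + (x `^ (- alpha) * y `^ alpha) * (x `^ (- alpha) * y `^ alpha).
  move=> y0; rewrite -expr2; apply: lt_le_trans (sin_den_ge _ _).
  by rewrite exprn_even_gt0.
have f0 y : 0 < y -> 0 <= f y.
  move=> y0; have dy := d0 _ y0; rewrite /f; apply: mulr_ge0; last exact: expR_ge0.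
  apply: mulr_ge0; first by rewrite invr_ge0 ltW.
  apply: divr_ge0; last exact: ltW.
  by apply: mulr_ge0; [rewrite addr_ge0// divr_ge0 ?ltW|rewrite mulr_ge0 ?powR_ge0].
have fc y : 0 < y -> {for y, continuous f}.
  by move=> y0; rewrite /f; isc; rewrite ?gt_eqF// d0.
have fi : integ pos f.
  have := integ_scale s^-1 mp jK; apply: (integ_eq mp) => y /E ->.
  by rewrite mulKf.
have := scale_pos x0 f0 fc; rewrite (integ_EFin mp fi).
have E2 t : pos t -> x * f (x * t) = s^-1 * (mlker alpha t * expR (- (x * t))).
  move=> /in_pos t0; have xt : pos (x * t) by rewrite /= in_itv/= andbT mulr_gt0.
  have xtx : x * t / x = t by rewrite mulrAC mulfV ?gt_eqF// mul1r.
  have := E _ xt; rewrite xtx => H.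
  apply: (mulfI s0); rewrite mulVKf// mulrCA -H -!mulrA.
  by rewrite mulVKf// gt_eqF.
rewrite (Eint_eq (fun t ht => E2 t ht)) => /esym H.
have k0 t : pos t -> 0 <= s^-1 * (mlker alpha t * expR (- (x * t))).
  by move=> tp; rewrite -E2// mulr_ge0 ?(ltW x0)// f0// mulr_gt0// in_pos.
have [|] := integ_ge0_EFin mp _ k0 H; first by rewrite /mlker /mden; mea.
move=> ki kI.
have ki' : integ pos (fun t => mlker alpha t * expR (- (x * t))).
  by have := integ_scale s mp ki; apply: (integ_eq mp) => t _; rewrite mulVKf.
split; first exact: ki'.
rewrite IK (Rint_eq E) (Rint_scale _ mp fi) -kI (Rint_scale _ mp ki').
exact: mulVKf.
Qed.

End Laplace.

(** * Fractional power series *)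

Section FracPowerSeries.
Context {R : realType}.
Implicit Types (a b : nat -> R) (x z c g p K alpha : R).

(** Coefficients of an entire power series. Boundedness against every geometric sequence is visibly
    stable under shifts and affine factors, which is all that differentiation does to the
    coefficients. *)
Definition entire_seq a := forall K, 0 < K -> exists C, forall n, `|a n| * K ^+ n <= C.

Definition psum a z : R := limn (pseries a z).

Lemma entire_norm_cvg a z : entire_seq a -> cvgn (series (fun n => `|a n * z ^+ n|)).
Proof.
(* Boundedness at radius 2 |z| + 1 makes the terms at most C / 2^n. *)
move=> ea; have K0 : 0 < 2 * `|z| + 1 by rewrite ltr_wpDl// mulr_ge0.
have [C hC] := ea _ K0.
have C0 : 0 <= C by apply: le_trans (hC 0); rewrite expr0 mulr1.
apply: (@series_le_cvg _ _ (geometric C 2^-1)) => [n|n|n|].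
- exact: normr_ge0.
- by rewrite /= mulr_ge0// exprn_ge0// invr_ge0.
- rewrite /= exprVn ler_pdivlMr ?exprn_gt0//; apply: le_trans _ (hC n).
  rewrite normrM -mulrA ler_wpM2l// normrX -exprMn.
  have h : `|z| * 2 <= 2 * `|z| + 1 by rewrite mulrC lerDl.
  by apply: lerXn2r h; rewrite nnegrE; [exact: mulr_ge0|exact: ltW].
- by apply: is_cvg_geometric_series; rewrite ger0_norm ?invr_ge0// invf_lt1// ltr1n.
Qed.

Lemma entire_cvg a z : entire_seq a -> cvgn (pseries a z).
Proof. by move=> ea; apply: normed_cvg; exact: entire_norm_cvg. Qed.

Lemma psum_cvg a z : entire_seq a -> pseries a z @ \oo --> psum a z.
Proof. by move=> ea; exact: entire_cvg. Qed.

Lemma eq_psum a b z : a =1 b -> psum a z = psum b z.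
Proof. by move=> /funext ->. Qed.

Lemma eq_entire a b : a =1 b -> entire_seq a -> entire_seq b.
Proof. by move=> /funext ->. Qed.

Lemma psumD a b z : entire_seq a -> entire_seq b ->
  psum (fun n => a n + b n) z = psum a z + psum b z.
Proof.
move=> ea eb; apply: cvg_lim => //.
have -> : pseries (fun n => a n + b n) z = (fun n => pseries a z n + pseries b z n).
  by apply/funext => n; rewrite /pseries /series /= -big_split; apply: eq_bigr => i _ /=; rewrite mulrDl.
by apply: cvgD; exact: psum_cvg.
Qed.

Lemma psumZ c a z : entire_seq a -> psum (fun n => c * a n) z = c * psum a z.
Proof.
move=> ea; apply: cvg_lim => //.
have -> : pseries (fun n => c * a n) z = (fun n => c * pseries a z n).
  by apply/funext => n; rewrite /pseries /series /= mulr_sumr; apply: eq_bigr => i _ /=; rewrite mulrA.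
by apply: cvgM; [exact: cvg_cst|exact: psum_cvg].
Qed.

Lemma natr_le2X n : n%:R <= 2 ^+ n :> R.
Proof. by rewrite -natrX ler_nat ltnW// ltn_expl. Qed.

Lemma ge1_2X n : 1 <= 2 ^+ n :> R. Proof. by rewrite exprn_ege1// ler1n. Qed.

Lemma entire_lin c alpha a : entire_seq a -> entire_seq (fun n => (c + alpha * n%:R) * a n).
Proof.
move=> ea K K0; have [|C hC] := ea (2 * K); first by rewrite mulr_gt0.
exists ((`|c| + `|alpha|) * C) => n; apply: le_trans (ler_wpM2l _ (hC n)); last by rewrite addr_ge0.
have -> : (`|c| + `|alpha|) * (`|a n| * (2 * K) ^+ n) = (`|c| + `|alpha|) * 2 ^+ n * (`|a n| * K ^+ n).
  by rewrite exprMn; ring.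
rewrite normrM -[leLHS]mulrA.
rewrite ler_wpM2r ?mulr_ge0 ?exprn_ge0 ?(ltW K0)//.
apply: le_trans (ler_normD _ _) _; rewrite normrM mulrDl lerD//.
  by rewrite ler_peMr// ge1_2X.
by rewrite ler_wpM2l// ger0_norm// natr_le2X.
Qed.

Lemma entire_scale c a : entire_seq a -> entire_seq (fun n => c * a n).
Proof. by move/(entire_lin c 0); apply: eq_entire => n; rewrite mul0r addr0. Qed.

Lemma entire_shift a : entire_seq a -> entire_seq (fun n => a n.+1).
Proof.
move=> ea K K0; have [C hC] := ea K K0; exists (C / K) => n.
by rewrite ler_pdivlMr// -mulrA -exprSr.
Qed.

Lemma entire_diffs a : entire_seq a -> entire_seq (pseries_diffs a).
Proof.
move=> /(entire_lin 0 1)/entire_shift; apply: eq_entire => n.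
by rewrite /pseries_diffs add0r mul1r.
Qed.

Lemma psum_derive a z : entire_seq a -> is_derive z 1 (psum a) (psum (pseries_diffs a) z).
Proof.
move=> ea; have e1 := entire_diffs ea; have e2 := entire_diffs e1.
apply: (@pseries_snd_diffs R a (`|z| + 1)); [exact: entire_cvg|exact: entire_cvg|exact: entire_cvg|].
by rewrite [X in _ < X]ger0_norm ?addr_ge0// ltrDl.
Qed.

Lemma psum_recl a z : entire_seq a -> psum a z = a 0 + z * psum (fun n => a n.+1) z.
Proof.
move=> ea; apply: cvg_lim => //; rewrite -(cvg_shiftS (pseries a z)).
have -> : (fun n => pseries a z n.+1) = (fun n => a 0 + z * pseries (fun n => a n.+1) z n).
  apply/funext => n; rewrite /pseries /series /= big_nat_recl//= expr0 mulr1 mulr_sumr.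
  by congr (_ + _); apply: eq_bigr => i _; rewrite exprS mulrCA.
apply: cvgD; first exact: cvg_cst.
by apply: cvgM; [exact: cvg_cst|apply: psum_cvg; exact: entire_shift].
Qed.

Lemma psum_diffs a z : entire_seq a -> z * psum (pseries_diffs a) z = psum (fun n => n%:R * a n) z.
Proof.
move=> ea; have e1 : entire_seq (fun n => n%:R * a n).
  by move: (entire_lin 0 1 ea); apply: eq_entire => n; rewrite add0r mul1r.
by rewrite (psum_recl _ e1) mul0r add0r.
Qed.

(** The form x^c times a power series in x^alpha is preserved by differentiation, see
    [fps_derive]. *)
Definition fps alpha c a x : R := x `^ c * psum a (x `^ alpha).

Lemma fps_derive alpha c a x : entire_seq a -> 0 < x ->
  is_derive x 1 (fps alpha c a) (fps alpha (c - 1) (fun n => (c + alpha * n%:R) * a n) x).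
Proof.
move=> ea x0; have e1 : entire_seq (fun n => n%:R * a n).
  by move: (entire_lin 0 1 ea); apply: eq_entire => n; rewrite add0r mul1r.
refine (isd_eq (isd_mul (isd_powR c x0) (isd_comp (isd_powR alpha x0) (psum_derive _ ea))) _).
rewrite /fps; have -> : psum (fun n => (c + alpha * n%:R) * a n) (x `^ alpha) = c * psum a (x `^ alpha) + alpha * (x `^ alpha * psum (pseries_diffs a) (x `^ alpha)).
  rewrite psum_diffs// -!psumZ// -psumD; [|exact: entire_scale|exact: entire_scale].
  by apply: eq_psum => n; ring.
by rewrite !(powR_sub1 _ x0); ring.
Qed.

Lemma fps_lim0 alpha a : 0 < alpha -> entire_seq a -> psum a (x `^ alpha) @[x --> 0^'+] --> a 0.
Proof.
move=> a0 ea; have -> : a 0 = psum a 0 by rewrite psum_recl// mul0r addr0.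
apply: (@cvg_comp _ _ _ (fun x => x `^ alpha) (psum a) _ (nbhs (0 : R))); first exact: cvg_powR0.
by have := isd_continuous (psum_derive 0 ea).
Qed.

(* [1 / Gamma p], continued to [-1 < p]: [rG 0 = 0], as required at a pole. *)
Definition rG p : R := p / Gamma (p + 1).

Lemma rG_Gamma p : 0 < p -> rG p = (Gamma p)^-1.
Proof. by move=> p0; rewrite /rG Gamma_rec// invfM mulVKf// gt_eqF. Qed.

Lemma rG_rec p : - 1 < p -> p * rG (p + 1) = rG p.
Proof. by move=> p1; rewrite rG_Gamma//; lra. Qed.

(** Two steps of the recursion bring the argument to p + 2 >= 1, where [Gamma_ge] applies. *)
Lemma rG_le p M : - 1 < p -> 0 < M ->
  `|rG p| <= (p + 2) ^+ 2 / (M `^ (p + 1) * expR (- (M + 1))).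
Proof.
move=> p1 M0; have p2 : 1 <= p + 2 by lra.
have p3 : 0 < p + 2 by lra.
have w0 : 0 < M `^ (p + 1) * expR (- (M + 1)) by apply: mulr_gt0; [exact: powR_gt0|exact: expR_gt0].
have pB : `|p * (p + 1)| <= (p + 2) ^+ 2.
  by rewrite ler_norml; apply/andP; split; nra.
have E : rG p = p * (p + 1) / Gamma (p + 2).
  have e : p + 1 + 1 = p + 2 by ring.
  have p1' : - 1 < p + 1 by lra.
  by rewrite -(rG_rec p1) -(rG_rec p1') e (rG_Gamma p3) mulrA.
rewrite E normrM normfV (gtr0_norm (Gamma_gt0 p3)).
apply: ler_pM; [exact: normr_ge0|by rewrite invr_ge0 (ltW (Gamma_gt0 p3))|exact: pB|].
rewrite lef_pV2 ?posrE; [|exact: Gamma_gt0|exact: w0].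
by have := Gamma_ge p2 M0; rewrite (_ : p + 2 - 1 = p + 1); [exact|ring].
Qed.

(** M is chosen with M^alpha = 4 K: its powers beat K^n by 4^n, which absorbs the quadratic factor
    of [rG_le]. *)
Lemma rG_entire g alpha : 0 < alpha -> - 1 < g -> entire_seq (fun n => rG (g + alpha * n%:R)).
Proof.
move=> a0 g1 K K0; pose M := (4 * K) `^ alpha^-1.
have M0 : 0 < M by rewrite powR_gt0// mulr_gt0.
have MK n : M `^ (g + alpha * n%:R + 1) = M `^ (g + 1) * (4 * K) ^+ n.
  rewrite addrAC (@powRD _ M (g + 1) (alpha * n%:R)) ?(gt_eqF M0) ?implybT//; congr (_ * _).
  by rewrite /M -powRrM mulrA mulVf ?mul1r ?powR_mulrn ?gt_eqF// mulr_ge0// ltW.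
exists ((g + 2 + alpha) ^+ 2 / (M `^ (g + 1) * expR (- (M + 1)))) => n.
have n0 : 0 <= alpha * n%:R by rewrite mulr_ge0// ltW.
have p1 : - 1 < g + alpha * n%:R by lra.
have w0 : 0 < M `^ (g + 1) * expR (- (M + 1)) by apply: mulr_gt0; [exact: powR_gt0|exact: expR_gt0].
have K4 : 0 < (4 * K) ^+ n by rewrite exprn_gt0// mulr_gt0.
have pB : (g + alpha * n%:R + 2) ^+ 2 <= (g + 2 + alpha) ^+ 2 * 4 ^+ n.
  have -> : (g + 2 + alpha) ^+ 2 * 4 ^+ n = ((g + 2 + alpha) * 2 ^+ n) ^+ 2.
    by rewrite (_ : 4 = 2 * 2 :> R) ?exprMn; ring.
  have h1 : g + alpha * n%:R + 2 <= (g + 2 + alpha) * 2 ^+ n.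
    have h2 : alpha * n%:R <= alpha * 2 ^+ n by rewrite ler_wpM2l ?natr_le2X// ltW.
    have h3 : g + 2 <= (g + 2) * 2 ^+ n by rewrite ler_peMr ?ge1_2X//; lra.
    by rewrite mulrDl; lra.
  by apply: lerXn2r (h1); rewrite nnegrE; [lra|apply: le_trans (h1); lra].
apply: le_trans (ler_wpM2r (exprn_ge0 _ (ltW K0)) (rG_le p1 M0)) _.
rewrite MK mulrAC ler_pdivrMr; last by apply: mulr_gt0 (expR_gt0 _); apply: mulr_gt0 K4; exact: powR_gt0.
rewrite [leRHS]mulrAC ler_pdivlMr//.
have -> : (g + 2 + alpha) ^+ 2 * (M `^ (g + 1) * (4 * K) ^+ n * expR (- (M + 1))) =
    (g + 2 + alpha) ^+ 2 * 4 ^+ n * K ^+ n * (M `^ (g + 1) * expR (- (M + 1))).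
  by rewrite exprMn; ring.
by rewrite ler_wpM2r ?(ltW w0)// ler_wpM2r// exprn_ge0// ltW.
Qed.

End FracPowerSeries.

(** * The defect as a fractional power series *)

Section Defect.
Context {R : realType}.
Notation mu := (@lebesgue_measure R).
Local Notation pos := (`]0, +oo[%classic : set R).
Implicit Types (a : nat -> R) (b x y c p alpha beta : R).

(** The series of D_b, with the first sum reindexed from 0. For alpha, b > 0 one has alpha + b - 1 >
    -1, the range in which [rG] continues 1 / Gamma. *)
Definition mlD alpha b x : R :=
  fps alpha (alpha - 1) (fun n => rG (alpha + b - 1 + alpha * n%:R)) x -
  fps alpha 0 (fun n => rG (b + alpha * n%:R)) x.

Lemma mul_fps alpha c a x : 0 < x -> x * fps alpha (c - 1) a x = fps alpha c a x.
Proof.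
move=> x0; rewrite /fps mulrA; congr (_ * _).
by rewrite (powR_sub1 _ x0) mulrC divfK// gt_eqF.
Qed.

Lemma fps_shift alpha c a x : entire_seq a -> 0 < x -> a 0 = 0 ->
  fps alpha c a x = fps alpha (c + alpha) (fun n => a n.+1) x.
Proof.
move=> ea x0 a00; rewrite /fps psum_recl// a00 add0r mulrA; congr (_ * _).
by rewrite powRD// (gt_eqF x0) implybT.
Qed.

Lemma ml_powE alpha beta x : 0 < alpha -> 0 < beta ->
  ml_pow alpha beta x = fps alpha 0 (fun n => rG (beta + alpha * n%:R)) x.
Proof.
move=> a0 b0; rewrite /ml_pow /mittag_leffler /fps powRr0 mul1r /psum /pseries.
congr (limn (series _)); apply/funext => n.
by rewrite /= mulrC rG_Gamma// ltr_wpDr// mulr_ge0// ltW.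
Qed.

(** The constant term drops out of the derivative and of F - F(0). On x^(alpha n) with n >= 1 the
    operator is multiplication by (alpha n + beta - 1) / x, which lowers the argument of 1 / Gamma
    by 1. *)
Lemma ml_defectE alpha beta x : 0 < alpha -> alpha != 1 -> 0 < beta -> 0 < x ->
  ml_defect alpha beta x = mlD alpha beta x.
Proof.
move=> a0 a1 b0 x0; set a := fun n : nat => rG (beta + alpha * n%:R).
have ea : entire_seq a by apply: rG_entire => //; lra.
have FE : ml_pow alpha beta = fps alpha 0 a by apply/funext => y; exact: ml_powE.
rewrite /ml_defect /diff_op {1 2 4}FE /mlD; congr (_ - _).
rewrite derive1E (@derive_val _ _ _ _ _ _ _ (fps_derive alpha 0 ea x0)).
rewrite sub0r ml_pow0 ?gt_eqF// -rG_Gamma//.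
have e1 := entire_lin 0 alpha ea.
rewrite (fps_shift alpha (-1) e1 x0); last by rewrite mulr0 addr0 mul0r.
have -> : (beta - 1) / x * (fps alpha 0 a x - rG beta) = (beta - 1) * fps alpha (alpha - 1) (fun n => a n.+1) x.
  rewrite -mulrA; congr (_ * _); apply: (mulfI (lt0r_neq0 x0)).
  rewrite mulVKf ?gt_eqF// mul_fps// /fps psum_recl// powRr0 mul1r /a mulr0 addr0.
  by rewrite addrAC subrr add0r.
rewrite /fps [-1 + alpha]addrC [(beta - 1) * _]mulrCA -mulrDr; congr (_ * _).
have es := entire_shift ea.
rewrite -psumZ// -psumD; [|exact: (entire_shift e1)|exact: entire_scale].
apply: eq_psum => n; rewrite -mulrDl.
have -> : alpha + beta - 1 + alpha * n%:R = beta - 1 + alpha * n.+1%:R by rewrite -[n.+1%:R]natr1; ring.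
have p1 : - 1 < beta - 1 + alpha * n.+1%:R.
  by have : 0 < alpha * n.+1%:R; [rewrite mulr_gt0|lra].
rewrite -(rG_rec p1) /a add0r (_ : beta - 1 + alpha * n.+1%:R + 1 = beta + alpha * n.+1%:R); last by ring.
by ring.
Qed.

Lemma mlD_entire1 alpha b : 0 < alpha -> 0 < b -> entire_seq (fun n => rG (alpha + b - 1 + alpha * n%:R)).
Proof. by move=> a0 b0; apply: rG_entire => //; lra. Qed.

Lemma mlD_entire2 alpha b : 0 < alpha -> 0 < b -> entire_seq (fun n => rG (b + alpha * n%:R)).
Proof. by move=> a0 b0; apply: rG_entire => //; lra. Qed.

(** The operator x d/dx + b multiplies x^c by b + c, which in both series is the factor of the
    recursion of 1 / Gamma. *)
Lemma mlD_derive alpha b x : 0 < alpha -> 0 < b -> 0 < x ->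
  is_derive x 1 (mlD alpha (b + 1)) ((mlD alpha b x - b * mlD alpha (b + 1) x) / x).
Proof.
move=> a0 b0 x0; have b1 : 0 < b + 1 by lra.
have e1 := mlD_entire1 a0 b1; have e2 := mlD_entire2 a0 b1.
refine (isd_eq (isd_add (fps_derive alpha (alpha - 1) e1 x0) (isd_opp (fps_derive alpha 0 e2 x0))) _).
have H c a (a' : nat -> R) : entire_seq a -> (forall n, b * a n + (c + alpha * n%:R) * a n = a' n) ->
    fps alpha (c - 1) (fun n => (c + alpha * n%:R) * a n) x = (fps alpha c a' x - b * fps alpha c a x) / x.
  move=> ea E; apply: (canRL (mulfK (lt0r_neq0 x0))); rewrite mulrC mul_fps//.
  apply: (canRL (addrK _)); rewrite /fps [b * _]mulrCA -mulrDr; congr (_ * _).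
  rewrite -psumZ// -psumD; [|exact: entire_lin|exact: entire_scale].
  by apply: eq_psum => n; rewrite -E addrC.
have n0 n : 0 <= alpha * n%:R by rewrite mulr_ge0// ltW.
rewrite (H _ _ (fun n => rG (alpha + b - 1 + alpha * n%:R)) e1); last first.
  move=> n; have p1 : - 1 < alpha + b - 1 + alpha * n%:R by have := n0 n; lra.
  rewrite -mulrDl -(rG_rec p1) (_ : alpha + b - 1 + alpha * n%:R + 1 = alpha + (b + 1) - 1 + alpha * n%:R); last by ring.
  by congr (_ * _); ring.
rewrite (H _ _ (fun n => rG (b + alpha * n%:R)) e2); last first.
  move=> n; have p1 : - 1 < b + alpha * n%:R by have := n0 n; lra.
  rewrite -mulrDl -(rG_rec p1) (_ : b + alpha * n%:R + 1 = b + 1 + alpha * n%:R); last by ring.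
  by congr (_ * _); ring.
have alg (P P' Q Q' : R) : (P' - b * P) / x - (Q' - b * Q) / x = (P' - Q' - b * (P - Q)) / x by ring.
exact: alg.
Qed.

Lemma mlD_pow_derive alpha b x : 0 < alpha -> 0 < b -> 0 < x ->
  is_derive x 1 (fun y => y `^ b * mlD alpha (b + 1) y) (x `^ (b - 1) * mlD alpha b x).
Proof.
move=> a0 b0 x0; refine (isd_eq (isd_mul (isd_powR b x0) (mlD_derive a0 b0 x0)) _).
have -> : x `^ b = x `^ (b - 1) * x.
  by rewrite (powR_sub1 _ x0) divfK// gt_eqF.
have alg (P A B : R) : b * P * B + P * x * ((A - b * B) / x) = P * A by field; rewrite gt_eqF.
exact: alg.
Qed.

(** The 1 makes up for the constant term left out of [dterm]. *)
Lemma dterm_cvg alpha x : 0 < alpha -> 0 < x ->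
  \sum_(0 <= k < n) dterm alpha x k @[n --> \oo] --> mlD alpha 1 x + 1.
Proof.
move=> a0 x0; have l01 := @ltr01 R.
have e1 := mlD_entire1 a0 l01; have e2 := mlD_entire2 a0 l01.
have E n : \sum_(0 <= k < n) dterm alpha x k =
    x `^ (alpha - 1) * pseries (fun n => rG (alpha + 1 - 1 + alpha * n%:R)) (x `^ alpha) n -
    (pseries (fun n => rG (1 + alpha * n%:R)) (x `^ alpha) n.+1 - 1).
  rewrite /pseries /series /= [X in _ - (X - 1)]big_nat_recl//= mulr0 addr0 expr0 mulr1 (rG_Gamma l01) Gamma1 invr1.
  rewrite [1 + _]addrC !addrK mulr_sumr -sumrB; apply: eq_bigr => k _; rewrite /dterm.
  have k0 : 0 <= alpha * k%:R by rewrite mulr_ge0// ltW.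
  have k1 : 0 < alpha * k.+1%:R by rewrite mulr_gt0.
  have -> : alpha + alpha * k%:R = alpha * k.+1%:R by rewrite -[k.+1%:R]natr1; ring.
  rewrite !rG_Gamma//; last by lra.
  have -> : alpha * k.+1%:R - 1 = (alpha - 1) + alpha * k%:R by rewrite -[k.+1%:R]natr1; ring.
  rewrite (@powRD _ x (alpha - 1)) ?(gt_eqF x0) ?implybT// !(powRrM x alpha) !powR_mulrn ?powR_ge0//.
  have alg (P T A S B : R) : P * T * A - S * B = P * (A * T) - B * S by ring.
  exact: alg.
have -> : mlD alpha 1 x + 1 = x `^ (alpha - 1) * psum (fun n => rG (alpha + 1 - 1 + alpha * n%:R)) (x `^ alpha) - (psum (fun n => rG (1 + alpha * n%:R)) (x `^ alpha) - 1).
  rewrite /mlD /fps powRr0 mul1r; have alg (A B : R) : A - B + 1 = A - (B - 1) by ring.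
  exact: alg.
rewrite (eq_cvg _ _ E); apply: cvgB.
  apply: cvgM; first exact: cvg_cst.
  exact: psum_cvg e1.
apply: cvgB; last exact: cvg_cst.
by rewrite (cvg_shiftS (pseries _ _)); exact: psum_cvg e2.
Qed.

Lemma mlD1_laplace alpha x : 0 < alpha < 2 -> sin (pi * alpha) != 0 -> 0 < x ->
  integ pos (fun t => mlker alpha t * expR (- (x * t))) /\
  pi * mlD alpha 1 x = \int[mu]_(t in pos) (mlker alpha t * expR (- (x * t))).
Proof.
move=> a02 s0 x0; have /andP[a0 _] := a02.
by have := mlker_laplace a02 s0 x0 (dterm_cvg a0 x0); rewrite addrK.
Qed.

End Defect.

(** * Raising the parameter by a Beta mixture *)

Section Mixture.
Context {R : realType}.
Notation mu := (@lebesgue_measure R).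
Local Notation pos := (`]0, +oo[%classic : set R).
Implicit Types (a : nat -> R) (b x y c p q v alpha : R) (f h : R -> R).

Lemma nneser_EFin (u : nat -> R) (l : R) : series u @ \oo --> l ->
  (\sum_(0 <= n <oo) (u n)%:E = l%:E)%E.
Proof.
move=> ul; apply: cvg_lim => //.
have -> : (fun n => \sum_(0 <= i < n) (u i)%:E)%E = (fun n => (series u n)%:E).
  by apply/funext => n; rewrite sumEFin.
by apply: cvg_EFin; [apply: nearW|].
Qed.

(** The mixing weight m_b. *)
Definition mixw b v : R := bint 1 b v / Gamma b.

Lemma mixw_ge0 b v : 0 < b -> 0 <= mixw b v.
Proof. by move=> b0; rewrite /mixw divr_ge0 ?bint_ge0// ltW// Gamma_gt0. Qed.

(** On a monomial the dilation by 1 / (1 + v) only changes the exponent of 1 + v, so a Beta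
    integrand appears; integrating it replaces Gamma p by Gamma (p + b). *)
Lemma mix_term b p x v : 0 < b -> 0 < p -> 0 < x -> 0 < v ->
  mixw b v * ((x / (1 + v)) `^ (p - 1) / Gamma p) = x `^ (p - 1) / (Gamma p * Gamma b) * bint p b v.
Proof.
move=> b0 p0 x0 v0; have w0 : 0 < 1 + v by lra.
rewrite /mixw /bint powRM ?(ltW x0) ?invr_ge0 ?(ltW w0)//.
have -> : (1 + v)^-1 `^ (p - 1) = (1 + v) `^ (- (p - 1)) by rewrite (invr_powR _ w0).
have -> : (1 + v) `^ (- (p + b)) = (1 + v) `^ (- (1 + b)) * (1 + v) `^ (- (p - 1)).
  rewrite -powRD; last by rewrite (gt_eqF w0) implybT.
  by congr (_ `^ _); ring.
have alg (V B G X W P : R) : V * B / G * (X * W / P) = X / (P * G) * (V * (B * W)).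
  by rewrite invfM; ring.
exact: alg.
Qed.

Lemma mea_fps alpha c a x : entire_seq a -> 0 < x -> measurable_fun pos (fun v => fps alpha c a (x / (1 + v))).
Proof.
move=> ea x0; apply: (@mea_within R pos _ (fun v => fps alpha (c - 1) (fun n => (c + alpha * n%:R) * a n) (x / (1 + v)) * (- x / (1 + v) ^+ 2))); first exact: measurable_pos.
move=> v /in_pos v0; have w0 : 0 < 1 + v by lra.
have d1 : is_derive v 1 (fun v => x / (1 + v)) (- x / (1 + v) ^+ 2).
  by isd; rewrite ?gt_eqF//; ring.
exact: (isd_comp d1 (fps_derive alpha c ea (divr_gt0 x0 w0))).
Qed.

(** As q > 0 all terms are nonnegative: sum and integral are exchanged by monotone convergence, and
    integrability comes with the value. *)
Lemma mix_fps alpha b q x : 0 < alpha -> 0 < b -> 0 < q -> 0 < x ->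
  integ pos (fun v => mixw b v * fps alpha (q - 1) (fun n => rG (q + alpha * n%:R)) (x / (1 + v))) /\
  \int[mu]_(v in pos) (mixw b v * fps alpha (q - 1) (fun n => rG (q + alpha * n%:R)) (x / (1 + v))) =
  fps alpha (q - 1) (fun n => rG (q + b + alpha * n%:R)) x.
Proof.
move=> a0 b0 q0 x0; have mp := @measurable_pos R.
have n0 n : 0 <= alpha * n%:R by rewrite mulr_ge0// ltW.
pose p n := q + alpha * n%:R.
have p0 n : 0 < p n by rewrite ltr_wpDr.
have e1 : entire_seq (fun n => rG (q + alpha * n%:R)) by apply: rG_entire => //; lra.
have e2 : entire_seq (fun n => rG (q + b + alpha * n%:R)) by apply: rG_entire => //; lra.
have termE n y d : 0 < y -> rG d * (y `^ alpha) ^+ n * y `^ (q - 1) = y `^ (p n - 1) * rG d.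
  move=> y0; rewrite -powR_mulrn ?powR_ge0// -powRrM -mulrA -powRD; last by rewrite (gt_eqF y0) implybT.
  by rewrite mulrC; congr (_ `^ _ * _); rewrite /p; ring.
have fpsE y (d : nat -> R) : 0 < y -> entire_seq (fun n => rG (d n)) ->
    series (fun n => y `^ (p n - 1) * rG (d n)) @ \oo --> fps alpha (q - 1) (fun n => rG (d n)) y.
  move=> y0 ed; have H n : series (fun n => y `^ (p n - 1) * rG (d n)) n = y `^ (q - 1) * pseries (fun n => rG (d n)) (y `^ alpha) n.
    rewrite /pseries /series /= mulr_sumr; apply: eq_bigr => k _.
    by rewrite -termE// mulrC.
  by rewrite (eq_cvg _ _ H); apply: cvgM; [exact: cvg_cst|exact: psum_cvg].
have mix_int n : (\int[mu]_(v in pos) (mixw b v * ((x / (1 + v)) `^ (p n - 1) * rG (p n)))%:E = (x `^ (p n - 1) * rG (q + b + alpha * n%:R))%:E)%E.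
  have [bi bI] := beta_Gamma (p0 n) b0.
  have Gp := Gamma_gt0 (p0 n); have Gb := Gamma_gt0 b0.
  have pb : 0 < p n + b by rewrite addr_gt0.
  have E v : pos v -> mixw b v * ((x / (1 + v)) `^ (p n - 1) * rG (p n)) = x `^ (p n - 1) / (Gamma (p n) * Gamma b) * bint (p n) b v.
    by move=> /in_pos v0; rewrite rG_Gamma// mix_term.
  have ii : integ pos (fun v => mixw b v * ((x / (1 + v)) `^ (p n - 1) * rG (p n))).
    by apply: (integ_eq mp _ (integ_scale (x `^ (p n - 1) / (Gamma (p n) * Gamma b)) mp bi)) => v /E ->.
  rewrite (integ_EFin mp ii) (Rint_eq E) (Rint_scale _ mp bi); congr (_%:E).
  rewrite (_ : q + b + alpha * n%:R = p n + b); last by rewrite /p; ring.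
  rewrite (rG_Gamma pb) -mulrA; congr (_ * _); have Gpb := Gamma_gt0 pb.
  have -> : \int[mu]_(v in pos) bint (p n) b v = Gamma (p n) * Gamma b / Gamma (p n + b).
    by rewrite -bI mulrAC mulfV ?mul1r ?gt_eqF.
  have alg (G G' H : R) : 0 < G -> 0 < G' -> (G * G')^-1 * (G * G' / H) = H^-1.
    by move=> h h'; rewrite mulrA mulVf ?mul1r// mulf_neq0// gt_eqF.
  exact: alg.
have f0 v : pos v -> 0 <= mixw b v * fps alpha (q - 1) (fun n => rG (q + alpha * n%:R)) (x / (1 + v)).
  move=> /in_pos v0; have w0 : 0 < x / (1 + v) by rewrite divr_gt0//; lra.
  rewrite mulr_ge0 ?mixw_ge0//.
  have H := fpsE _ _ w0 e1; rewrite -(cvg_lim (@Rhausdorff R) H).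
  apply: limr_ge; first exact: cvgP H.
  apply: nearW => n; rewrite /series /=; apply: sumr_ge0 => k _.
  have rk : 0 <= rG (q + alpha * k%:R) by rewrite rG_Gamma ?invr_ge0 ?(ltW (Gamma_gt0 _))//; exact: p0.
  by apply: mulr_ge0; [exact: powR_ge0|exact: rk].
apply: (integ_ge0_EFin mp) => //.
  apply: mea_mul; first by rewrite /mixw /bint; mea.
  exact: mea_fps.
transitivity (\int[mu]_(v in pos) (\sum_(0 <= n <oo) (mixw b v * ((x / (1 + v)) `^ (p n - 1) * rG (p n)))%:E))%E.
  apply: eq_integral => v; rewrite inE => /in_pos v0; apply/esym/nneser_EFin.
  have w0 : 0 < x / (1 + v) by rewrite divr_gt0//; lra.
  have H n : series (fun n => mixw b v * ((x / (1 + v)) `^ (p n - 1) * rG (p n))) n = mixw b v * series (fun n => (x / (1 + v)) `^ (p n - 1) * rG (p n)) n.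
    by rewrite /series /= mulr_sumr.
  rewrite (eq_cvg _ _ H); apply: cvgM; first exact: cvg_cst.
  exact: (fpsE _ p w0 e1).
rewrite (@integral_nneseries _ (measurableTypeR R) R mu pos mp); last 2 first.
- move=> n; apply/measurable_EFinP; rewrite /mixw /bint; mea.
- move=> n v /in_pos v0; rewrite lee_fin mulr_ge0 ?mixw_ge0// mulr_ge0 ?powR_ge0//.
  by rewrite rG_Gamma// invr_ge0 ltW// Gamma_gt0.
under eq_eseriesr do rewrite mix_int.
by apply: nneser_EFin; exact: (fpsE _ (fun n => q + b + alpha * n%:R) x0 e2).
Qed.

Lemma Rint_sub_eq (D : set R) (u w f : R -> R) (A B : R) : measurable D -> (forall x, D x -> u x - w x = f x) ->
  integ D u /\ \int[mu]_(x in D) u x = A -> integ D w /\ \int[mu]_(x in D) w x = B ->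
  integ D f /\ \int[mu]_(x in D) f x = A - B.
Proof.
move=> mD E [ui <-] [wi <-]; split.
  by apply: (integ_eq mD E); apply: (integ_add mD) => //; exact: integ_opp.
by rewrite -(Rint_eq E) (Rint_sub mD ui wi).
Qed.

(** The two series are mixed separately, with q = alpha and q = 1, since only each of them has terms
    of one sign. *)
Lemma mlD_mix alpha b x : 0 < alpha -> 0 < b -> 0 < x ->
  integ pos (fun v => mixw b v * mlD alpha 1 (x / (1 + v))) /\
  \int[mu]_(v in pos) (mixw b v * mlD alpha 1 (x / (1 + v))) = mlD alpha (b + 1) x.
Proof.
move=> a0 b0 x0; have mp := @measurable_pos R.
have mix c q d : 0 < q -> c = q - 1 -> d = q + b ->
    integ pos (fun v => mixw b v * fps alpha c (fun n => rG (q + alpha * n%:R)) (x / (1 + v))) /\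
    \int[mu]_(v in pos) (mixw b v * fps alpha c (fun n => rG (q + alpha * n%:R)) (x / (1 + v))) =
    fps alpha c (fun n => rG (d + alpha * n%:R)) x.
  by move=> q0 -> ->; exact: mix_fps.
have I1 : _ /\ _ := mix (alpha - 1) (alpha + 1 - 1) (alpha + (b + 1) - 1) ltac:(lra) ltac:(lra) ltac:(lra).
have I2 : _ /\ _ := mix 0 1 (b + 1) ltr01 ltac:(lra) ltac:(lra).
by apply: (Rint_sub_eq mp _ I1 I2) => v _; rewrite mulrBr.
Qed.

End Mixture.

(** * Complete monotonicity by finite differences *)

Section DiscreteCM.
Context {R : realType}.
Notation mu := (@lebesgue_measure R).
Implicit Types (x y c d v : R) (f : R -> R) (hs : seq R).

Lemma isd_seq f x d : is_derive x 1 f d ->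
  (n.+1%:R : R) * (f (x + n.+1%:R^-1) - f x) @[n --> \oo] --> d.
Proof.
move=> [df <-]; have H := df.
have {}H := cvg_dnbhs_at_right H.
have {}H := cvg_at_right_seq (fun n => harmonic_gt0 n) (@cvg_harmonic R) H.
have -> : (fun n => n.+1%:R * (f (x + n.+1%:R^-1) - f x)) = (fun n => (harmonic n)^-1 *: ((f \o shift x) (harmonic n)%:A - f x)).
  by apply/funext => n; rewrite /harmonic /= invrK /GRing.scale /= mulr1 [_ + x]addrC.
exact: H.
Qed.

Fixpoint fdiff hs f x : R :=
  if hs is h :: hs' then fdiff hs' f x - fdiff hs' f (x + h) else f x.

(* For smooth functions this is complete monotonicity, but it passes to pointwise
   limits and integrals without differentiating them. *)
Definition dcm f := forall hs x, (forall h : R, h \in hs -> 0 < h) -> 0 < x -> 0 <= fdiff hs f x.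

Lemma eq_fdiff hs f f' x : (forall h : R, h \in hs -> 0 < h) -> 0 < x ->
  (forall y, 0 < y -> f y = f' y) -> fdiff hs f x = fdiff hs f' x.
Proof.
elim: hs x => [|h hs IH] x hp x0 E /=; first exact: E.
have h0 : 0 < h by apply: hp; rewrite inE eqxx.
have hp' k : k \in hs -> 0 < k by move=> kh; apply: hp; rewrite inE kh orbT.
by rewrite !IH// addr_gt0.
Qed.

Lemma eq_dcm f f' : (forall y, 0 < y -> f y = f' y) -> dcm f -> dcm f'.
Proof. by move=> E H hs x hp x0; rewrite -(eq_fdiff hp x0 E); exact: H. Qed.

Lemma fdiffZ c hs f x : fdiff hs (fun y => c * f y) x = c * fdiff hs f x.
Proof. by elim: hs x => [|h hs IH] x //=; rewrite !IH mulrBr. Qed.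

Lemma dcm_scale c f : 0 <= c -> dcm f -> dcm (fun y => c * f y).
Proof. by move=> c0 H hs x hp x0; rewrite fdiffZ mulr_ge0// H. Qed.

Lemma fdiff_arg c hs f x : fdiff hs (fun y => f (c * y)) x = fdiff (map ( *%R c) hs) f (c * x).
Proof. by elim: hs x => [|h hs IH] x //=; rewrite !IH mulrDr. Qed.

Lemma dcm_arg c f : 0 < c -> dcm f -> dcm (fun y => f (c * y)).
Proof.
move=> c0 H hs x hp x0; rewrite fdiff_arg; apply: H; last exact: mulr_gt0.
by move=> h /mapP[k /hp k0 ->]; exact: mulr_gt0.
Qed.

(** Differences of an exponential are multiples of it, each step h contributing the factor 1 - e^(-
    h t) >= 0. *)
Lemma dcm_expR (t : R) : 0 < t -> dcm (fun x => expR (- (x * t))).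
Proof.
move=> t0 hs x hp x0.
have [c [c0 ->]] : exists c, 0 <= c /\ fdiff hs (fun x => expR (- (x * t))) = (fun x => c * expR (- (x * t))).
  elim: hs hp => [|h hs IH] hp; first by exists 1; split => //; apply/funext => y /=; rewrite mul1r.
  have h0 : 0 < h by apply: hp; rewrite inE eqxx.
  have [c [c0 E]] := IH (fun k kh => hp k (@mem_behead _ (h :: hs) k kh)).
  exists (c * (1 - expR (- (h * t)))); split.
    by rewrite mulr_ge0// subr_ge0 -expR0 ler_expR oppr_le0 mulr_ge0 ?(ltW h0) ?(ltW t0).
  by apply/funext => y /=; rewrite E mulrDl opprD expRD; ring.
by rewrite mulr_ge0// expR_ge0.
Qed.

Lemma fdiff_cvg hs (F : nat -> R -> R) f x : (forall h : R, h \in hs -> 0 < h) -> 0 < x ->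
  (forall y, 0 < y -> F n y @[n --> \oo] --> f y) -> fdiff hs (F n) x @[n --> \oo] --> fdiff hs f x.
Proof.
elim: hs x => [|h hs IH] x hp x0 E /=; first exact: E.
have h0 : 0 < h by apply: hp; rewrite inE eqxx.
have hp' k : k \in hs -> 0 < k by move=> kh; apply: hp; rewrite inE kh orbT.
by apply: cvgB; apply: IH => //; exact: addr_gt0.
Qed.

Lemma dcm_cvg (F : nat -> R -> R) f : (forall n, dcm (F n)) ->
  (forall y, 0 < y -> F n y @[n --> \oo] --> f y) -> dcm f.
Proof.
move=> HF E hs x hp x0; have H := fdiff_cvg hp x0 E.
rewrite -(cvg_lim (@Rhausdorff R) H); apply: limr_ge; first exact: cvgP H.
by apply: nearW => n; exact: HF.
Qed.

Lemma dcm_int (D : set R) (F : R -> R -> R) : measurable D ->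
  (forall y, 0 < y -> integ D (fun v => F v y)) -> (forall v, D v -> dcm (F v)) ->
  dcm (fun y => \int[mu]_(v in D) F v y).
Proof.
move=> mD iF HF hs x hp x0.
have [_ <-] : integ D (fun v => fdiff hs (F v) x) /\
    \int[mu]_(v in D) fdiff hs (F v) x = fdiff hs (fun y => \int[mu]_(v in D) F v y) x.
  elim: hs x hp x0 => [|h hs IH] x hp x0 /=; first by split => //; exact: iF.
  have h0 : 0 < h by apply: hp; rewrite inE eqxx.
  have hp' k : k \in hs -> 0 < k by move=> kh; apply: hp; rewrite inE kh orbT.
  have [i1 <-] := IH x hp' x0; have [i2 <-] := IH _ hp' (addr_gt0 x0 h0).
  by rewrite (Rint_sub mD i1 i2); split => //; apply: (integ_add mD) => //; exact: integ_opp.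
by apply: Rint_ge0 => v Dv; exact: HF.
Qed.

Lemma fdiff_fdiff hs h f x : fdiff hs (fun y => f y - f (y + h)) x = fdiff (h :: hs) f x.
Proof.
elim: hs x => [|k hs IH] x //=; rewrite !IH /= (addrAC x k h); ring.
Qed.

(** The quotients (n + 1) (f(x) - f(x + 1 / (n + 1))) are scaled differences of f, and [dcm] passes
    to their limit. *)
Lemma dcm_derive f df : dcm f -> (forall x, 0 < x -> is_derive x 1 f (df x)) -> dcm (fun x => - df x).
Proof.
move=> Hf dF; apply: (@dcm_cvg (fun n y => n.+1%:R * (f y - f (y + n.+1%:R^-1)))).
  move=> n; apply: dcm_scale => // hs x hp x0; rewrite fdiff_fdiff; apply: Hf => // h.
  by rewrite inE => /orP[/eqP ->|/hp//]; rewrite invr_gt0.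
move=> y y0.
have -> : (fun n => n.+1%:R * (f y - f (y + n.+1%:R^-1))) = (fun n => - (n.+1%:R * (f (y + n.+1%:R^-1) - f y))).
  by apply/funext => n; rewrite -mulrN opprB.
by apply: cvgN; exact: isd_seq (dF y y0).
Qed.

Lemma isd_eq_pos f f' x d : (forall y, 0 < y -> f y = f' y) -> 0 < x ->
  is_derive x 1 f d -> is_derive x 1 f' d.
Proof.
move=> E x0; apply: near_eq_is_derive; near=> y; apply: E.
by near: y; exact: lt_nbhsr.
Unshelve. all: by end_near. Qed.

(** A candidate h for all derivatives of f, constrained on the open half-line only, where f agrees
    with its series. *)
Definition derive_chain f (h : nat -> R -> R) :=
  (forall x, 0 < x -> f x = h 0 x) /\
  (forall n x, 0 < x -> is_derive x 1 (h n) (h n.+1 x)).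

Lemma derive_chainE f h n x : derive_chain f h -> 0 < x -> derive1n n f x = h n x.
Proof.
move=> [h0 hn]; elim: n x => [|n IH] x x0; first exact: h0.
rewrite derive1nS derive1E.
have /(isd_eq_pos (fun y (ypos : 0 < y) => esym (IH y ypos)) x0) H := hn n x x0.
exact: (@derive_val _ _ _ _ _ _ _ H).
Qed.

Lemma derive_chain_derivable f h n x : derive_chain f h -> 0 < x -> derivable (derive1n n f) x 1.
Proof.
move=> ch x0; have [_ hn] := ch.
have /(isd_eq_pos (fun y (ypos : 0 < y) => esym (derive_chainE n ch ypos)) x0) H := hn n x x0.
exact: ex_derive.
Qed.

(** By induction with [dcm_derive], (-1)^n times the n-th derivative is again [dcm]; the empty list
    of steps then gives its sign. *)
Lemma cm_chain f h : derive_chain f h -> dcm f -> completely_monotonic f.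
Proof.
move=> ch Hf; split; first by move=> n x; exact: derive_chain_derivable ch.
move=> n x x0; rewrite (derive_chainE n ch x0).
suff H : dcm (fun x => (-1) ^+ n * h n x).
  by have := H [::] x; apply.
elim: n {x x0} => [|n IH].
  by apply: (eq_dcm _ Hf) => x x0; rewrite mul1r; have [->] := ch.
apply: eq_dcm (dcm_derive IH (df := fun x => (-1) ^+ n * h n.+1 x) _).
  by move=> y _; rewrite exprS mulN1r mulNr.
move=> x x0; have [_ hn] := ch.
by refine (isd_eq (isd_mul (isd_cst x ((-1) ^+ n)) (hn n x x0)) _); ring.
Qed.

Lemma derive_chain_sub f f' h h' : derive_chain f h -> derive_chain f' h' ->
  derive_chain (fun x => f x - f' x) (fun n x => h n x - h' n x).
Proof.
move=> [c0 cn] [c0' cn']; split; first by move=> x x0; rewrite c0// c0'.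
by move=> n x x0; exact: isd_add (cn n x x0) (isd_opp (cn' n x x0)).
Qed.

Lemma derive_chain_opp f h : derive_chain f h -> derive_chain (fun x => - f x) (fun n x => - h n x).
Proof.
move=> [c0 cn]; split; first by move=> x x0; rewrite c0.
by move=> n x x0; exact: isd_opp (cn n x x0).
Qed.

Fixpoint fps_coef (alpha c : R) (a : nat -> R) k : nat -> R :=
  if k is k'.+1 then (fun n => (c - k'%:R + alpha * n%:R) * fps_coef alpha c a k' n) else a.

Lemma fps_chain alpha c a : entire_seq a ->
  derive_chain (fps alpha c a) (fun k => fps alpha (c - k%:R) (fps_coef alpha c a k)).
Proof.
move=> ea; split; first by move=> x _; rewrite subr0.
move=> k x x0; have ek : entire_seq (fps_coef alpha c a k).
  by elim: k => //= k IH; exact: entire_lin.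
have := fps_derive alpha (c - k%:R) ek x0.
by rewrite -[k.+1%:R]natr1 opprD addrA.
Qed.

End DiscreteCM.

(** * Sufficiency for alpha < 1 *)

Section Sufficiency.
Context {R : realType}.
Notation mu := (@lebesgue_measure R).
Local Notation pos := (`]0, +oo[%classic : set R).
Implicit Types (b x y d v t l alpha beta sg : R) (f : R -> R).

Lemma mlD_chain alpha b : 0 < alpha -> 0 < b -> exists h, derive_chain (mlD alpha b) h.
Proof.
move=> a0 b0; eexists.
exact: (derive_chain_sub (fps_chain alpha (alpha - 1) (mlD_entire1 a0 b0)) (fps_chain alpha 0 (mlD_entire2 a0 b0))).
Qed.

Lemma mlker_isd alpha t : sin (pi * alpha) != 0 -> 0 < t ->
  exists d, is_derive t 1 (mlker alpha) d.
Proof.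
move=> s0 t0.
have -> : mlker alpha = fun t => sin (pi * alpha) * (1 + t^-1) * t `^ alpha /
    (1 - 2 * cos (pi * alpha) * t `^ alpha + t `^ alpha * t `^ alpha).
  by apply/funext => u; rewrite /mlker /mden expr2.
eexists; repeat isd1; rewrite ?gt_eqF//.
by have := mden_gt0 t s0; rewrite /mden expr2.
Qed.

Lemma mlker_ge0 alpha t : 0 < alpha < 1 -> 0 < t -> 0 <= mlker alpha t.
Proof.
move=> a01 t0; have s0 := sin_pi_gt0 a01; rewrite /mlker.
apply: divr_ge0; last by rewrite ltW// mden_gt0// gt_eqF.
by apply: mulr_ge0; [apply: mulr_ge0; [exact: ltW|rewrite addr_ge0// invr_ge0 ltW]|exact: powR_ge0].
Qed.

(** The substitution t -> t / l in the Laplace integral; its Jacobian lowers the power of l from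
    beta to beta - 1. *)
Lemma mlD1_scaled alpha beta l y : 0 < alpha < 1 -> 0 < l -> 0 < y ->
  integ pos (fun t => l `^ (beta - 1) * mlker alpha (t / l) * expR (- (y * t))) /\
  pi * (l `^ beta * mlD alpha 1 (l * y)) = \int[mu]_(t in pos) (l `^ (beta - 1) * mlker alpha (t / l) * expR (- (y * t))).
Proof.
move=> a01 l0 y0; have mp := @measurable_pos R.
have s0 := sin_pi_gt0 a01; have sN0 : sin (pi * alpha) != 0 by rewrite gt_eqF.
have a02 : 0 < alpha < 2 by case/andP: a01 => -> /= h; lra.
have [ki kI] := mlD1_laplace a02 sN0 (mulr_gt0 l0 y0).
pose f t := l `^ (beta - 1) * mlker alpha (t / l) * expR (- (y * t)).
have f0 t : 0 < t -> 0 <= f t.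
  move=> t0; apply: mulr_ge0; last exact: expR_ge0.
  by apply: mulr_ge0; [exact: powR_ge0|apply: mlker_ge0 => //; exact: divr_gt0].
have fc t : 0 < t -> {for t, continuous f}.
  move=> t0; have [d dE] := mlker_isd sN0 (divr_gt0 t0 l0).
  have h : {for t, continuous (fun t => mlker alpha (t / l))}.
    apply: isd_continuous; apply: (@isd_comp R (mlker alpha) (fun t => t / l) t _ _ _ dE).
  apply: cvgM; first by apply: cvgM; [exact: cvg_cst|exact: h].
  by have : {for t, continuous (fun t => expR (- (y * t)))} by isc.
have E t : l * f (l * t) = l `^ beta * (mlker alpha t * expR (- (l * y * t))).
  rewrite /f (_ : l * t / l = t); last by rewrite mulrAC mulfV ?mul1r// gt_eqF.
  rewrite (_ : l `^ beta = l * l `^ (beta - 1)).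
    by rewrite (_ : y * (l * t) = l * y * t); [rewrite !mulrA|ring].
  by rewrite (powR_sub1 _ l0) mulrC divfK// gt_eqF.
have := scale_pos l0 f0 fc; rewrite (Eint_eq (fun t _ => E t)).
have ki' := integ_scale (l `^ beta) mp ki.
rewrite (integ_EFin mp ki') => H.
have [fi fI] : integ pos f /\ \int[mu]_(t in pos) f t = \int[mu]_(t in pos) (l `^ beta * (mlker alpha t * expR (- (l * y * t)))).
  apply: (integ_ge0_EFin mp _ _ H) => [|t /in_pos]; last exact: f0.
  by rewrite /f /mlker /mden; mea.
split; first exact: fi.
by rewrite fI (Rint_scale _ mp ki) -kI mulrCA.
Qed.

(** The factor [sg] will be 1 or -1, so that one argument serves both equivalences. *)
Lemma mlD1_quot alpha beta l sg : 0 < alpha < 1 -> 1 < l ->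
  (forall t, 0 < t -> 0 <= sg * (l `^ (beta - 1) * mlker alpha (t / l) - mlker alpha t)) ->
  dcm (fun y => sg * (l `^ beta * mlD alpha 1 (l * y) - mlD alpha 1 y)).
Proof.
move=> a01 l1 hk; have mp := @measurable_pos R; have l0 : 0 < l by apply: lt_trans l1.
have s0 := sin_pi_gt0 a01; have sN0 : sin (pi * alpha) != 0 by rewrite gt_eqF.
have a02 : 0 < alpha < 2 by case/andP: a01 => -> /= h; lra.
pose F t y := sg * (l `^ (beta - 1) * mlker alpha (t / l) - mlker alpha t) * expR (- (y * t)).
have FI y : 0 < y -> integ pos (fun t => F t y) /\
    pi * (sg * (l `^ beta * mlD alpha 1 (l * y) - mlD alpha 1 y)) = \int[mu]_(t in pos) F t y.
  move=> y0; have [i1 I1] := mlD1_scaled beta a01 l0 y0.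
  have [i2 I2] := mlD1_laplace a02 sN0 y0.
  have E t : pos t -> sg * (l `^ (beta - 1) * mlker alpha (t / l) * expR (- (y * t)) - mlker alpha t * expR (- (y * t))) = F t y.
    by move=> _; rewrite /F -mulrBl mulrA.
  have i3 := integ_add mp i1 (integ_opp mp i2).
  split; first by apply: (integ_eq mp E); exact: integ_scale.
  rewrite -(Rint_eq E) (Rint_scale _ mp i3) (Rint_sub mp i1 i2) -I1 -I2.
  by rewrite -mulrBr mulrCA.
apply: (@eq_dcm _ (fun y => pi^-1 * \int[mu]_(t in pos) F t y)).
  by move=> y y0; have [_ <-] := FI y y0; rewrite mulKf// gt_eqF// pi_gt0.
apply: dcm_scale; first by rewrite invr_ge0 pi_ge0.
apply: dcm_int => //; first by move=> y /FI[].
by move=> t /in_pos t0; apply: dcm_scale; [exact: hk|exact: dcm_expR].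
Qed.

(** The dilations of the mixture commute with y -> l y, so the hypothesis on D_1 passes to D_(beta +
    1). The derivative of l^beta D_(beta + 1)(l x) at l = 1 is beta D_(beta + 1) + x D_(beta + 1)',
    which [mlD_derive] identifies with D_beta. *)
Lemma dcm_mlD_quot alpha beta sg : 0 < alpha -> 0 < beta ->
  (forall l, 1 < l -> dcm (fun y => sg * (l `^ beta * mlD alpha 1 (l * y) - mlD alpha 1 y))) ->
  dcm (fun x => sg * mlD alpha beta x).
Proof.
move=> a0 b0 hl; have mp := @measurable_pos R.
have hG l : 1 < l -> dcm (fun x => sg * (l `^ beta * mlD alpha (beta + 1) (l * x) - mlD alpha (beta + 1) x)).
  move=> l1; have l0 : 0 < l by apply: lt_trans l1.
  pose Q y := sg * (l `^ beta * mlD alpha 1 (l * y) - mlD alpha 1 y).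
  pose F v y := mixw beta v * Q ((1 + v)^-1 * y).
  have FI y : 0 < y -> integ pos (fun v => F v y) /\
     sg * (l `^ beta * mlD alpha (beta + 1) (l * y) - mlD alpha (beta + 1) y) = \int[mu]_(v in pos) F v y.
    move=> y0; have [i1 I1] := mlD_mix a0 b0 (mulr_gt0 l0 y0).
    have [i2 I2] := mlD_mix a0 b0 y0.
    have E v : pos v -> sg * (l `^ beta * (mixw beta v * mlD alpha 1 (l * y / (1 + v))) - mixw beta v * mlD alpha 1 (y / (1 + v))) = F v y.
      move=> _; rewrite /F /Q [_^-1 * y]mulrC (mulrA l y).
      have alg (s m L A B : R) : s * (L * (m * A) - m * B) = m * (s * (L * A - B)) by ring.
      exact: alg.
    have i1' := integ_scale (l `^ beta) mp i1.
    have i3 := integ_add mp i1' (integ_opp mp i2).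
    split; first by apply: (integ_eq mp E); exact: integ_scale.
    rewrite -(Rint_eq E) (Rint_scale _ mp i3) (Rint_sub mp i1' i2) (Rint_scale _ mp i1).
    by rewrite -I1 -I2.
  apply: (@eq_dcm _ (fun y => \int[mu]_(v in pos) F v y)).
    by move=> y y0; have [_ <-] := FI y y0.
  apply: dcm_int => //; first by move=> y /FI[].
  move=> v /in_pos v0; apply: dcm_scale; first exact: mixw_ge0.
  by apply: (dcm_arg _ (hl l l1)); rewrite invr_gt0; lra.
apply: (@dcm_cvg _ (fun n x => n.+1%:R * (sg * ((1 + n.+1%:R^-1) `^ beta * mlD alpha (beta + 1) ((1 + n.+1%:R^-1) * x) - mlD alpha (beta + 1) x)))).
  by move=> n; apply: dcm_scale => //; apply: hG; rewrite ltrDl invr_gt0.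
move=> x x0; have x01 : 0 < 1 * x by rewrite mul1r.
have d1 : is_derive (1 : R) (1 : R) (fun l : R => l * x) x by isd; ring.
have H : is_derive (1 : R) (1 : R) (fun l => l `^ beta * mlD alpha (beta + 1) (l * x)) (mlD alpha beta x).
  refine (isd_eq (isd_mul (isd_powR beta (@ltr01 R)) (isd_comp d1 (mlD_derive a0 b0 x01))) _).
  rewrite !mul1r !powR1 mulr1 mul1r divfK ?gt_eqF//.
  have alg (A B : R) : beta * B + (A - beta * B) = A by ring.
  exact: alg.
have := isd_seq H; rewrite /= => {}H.
have -> : (fun n => n.+1%:R * (sg * ((1 + n.+1%:R^-1) `^ beta * mlD alpha (beta + 1) ((1 + n.+1%:R^-1) * x) - mlD alpha (beta + 1) x))) =
  (fun n => sg * (n.+1%:R * ((1 + n.+1%:R^-1) `^ beta * mlD alpha (beta + 1) ((1 + n.+1%:R^-1) * x) - mlD alpha (beta + 1) x))).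
  by apply/funext => n; rewrite mulrCA.
apply: cvgM; first exact: cvg_cst.
by move: H; rewrite powR1 !mul1r.
Qed.

Lemma dcm_mlD_pos alpha beta : 0 < alpha < 1 -> Num.max alpha (1 - alpha) <= beta ->
  dcm (mlD alpha beta).
Proof.
move=> a01 hb; have /andP[a0 a1] := a01.
have b0 : 0 < beta by apply: lt_le_trans hb; rewrite lt_max a0.
apply: (@eq_dcm _ (fun x => 1 * mlD alpha beta x)); first by move=> x _; rewrite mul1r.
apply: dcm_mlD_quot => // l l1; apply: mlD1_quot => // t t0.
by rewrite mul1r subr_ge0 mlker_scale_le// ltW.
Qed.

Lemma dcm_mlD_neg alpha beta : 0 < alpha < 1 -> 0 < beta -> beta <= Num.min alpha (1 - alpha) ->
  dcm (fun x => - mlD alpha beta x).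
Proof.
move=> a01 b0 hb; have /andP[a0 a1] := a01.
apply: (@eq_dcm _ (fun x => -1 * mlD alpha beta x)); first by move=> x _; rewrite mulN1r.
apply: dcm_mlD_quot => // l l1; apply: mlD1_quot => // t t0.
by rewrite mulN1r opprB subr_ge0 mlker_scale_ge// ltW.
Qed.

End Sufficiency.

(** * Sufficiency for 1 < alpha <= 2 *)

Section SuffLarge.
Context {R : realType}.
Notation mu := (@lebesgue_measure R).
Local Notation pos := (`]0, +oo[%classic : set R).
Implicit Types (b x y z p v t alpha beta : R) (f : R -> R).

Lemma pos_derive0_cst f : (forall x, 0 < x -> is_derive x 1 f 0) -> forall x y, 0 < x -> 0 < y -> f x = f y.
Proof.
move=> fd; have H x y : 0 < x -> x <= y -> f x = f y.
  move=> x0 xy; apply: (@isd0_eq R f (fun=> 0)) => // z /andP[xz _].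
  by apply: fd; exact: lt_le_trans xz.
move=> x y x0 y0; have [xy|/ltW yx] := leP x y; first exact: H.
by rewrite (H y x).
Qed.

(** Here sin(pi alpha) = 0 and the kernel representation degenerates. The two series are sinh and
    cosh, recognised by S' = C and C' = S: the product e^x (S - C) is constant, and its value -1 is
    read off at 0. *)
Lemma mlD_two (u : R) : 0 < u -> mlD 2 1 u = - expR (- u).
Proof.
move=> u0.
pose S : R -> R := fps 2 1 (fun n => rG (2 + 2 * n%:R)).
pose C : R -> R := fps 2 0 (fun n => rG (1 + 2 * n%:R)).
have eS : entire_seq (fun n => rG (2 + 2 * n%:R) : R) by apply: rG_entire => //; lra.
have eC : entire_seq (fun n => rG (1 + 2 * n%:R) : R) by apply: rG_entire => //; lra.
have n0 (n : nat) : 0 <= 2 * n%:R :> R by rewrite mulr_ge0.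
have mE x : @mlD R 2 1 x = S x - C x.
  have e1 : (fun n : nat => rG (2 + 1 - 1 + 2 * n%:R)) = (fun n => rG (2 + 2 * n%:R)) :> (nat -> R).
    by apply/funext => n; rewrite addrK.
  have e2 : 2 - 1 = 1 :> R by ring.
  by rewrite /mlD e1 e2.
have dS x : 0 < x -> is_derive x 1 S (C x).
  move=> x0; refine (isd_eq (fps_derive 2 1 eS x0) _).
  have e1 : (fun n : nat => (1 + 2 * n%:R) * rG (2 + 2 * n%:R)) = (fun n => rG (1 + 2 * n%:R)) :> (nat -> R).
    apply/funext => n; have p1 : - 1 < 1 + 2 * n%:R :> R by have := n0 n; lra.
    have e : 2 + 2 * n%:R = 1 + 2 * n%:R + 1 :> R by ring.
    by rewrite e rG_rec.
  by rewrite e1 (@subrr R 1).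
have dC x : 0 < x -> is_derive x 1 C (S x).
  move=> x0; refine (isd_eq (fps_derive 2 0 eC x0) _).
  have z0 : (0 + 2 * 0%:R) * rG (1 + 2 * 0%:R) = 0 :> R by rewrite mulr0 addr0 mul0r.
  rewrite (fps_shift _ _ (entire_lin 0 2 eC) x0 z0).
  have e1 : (fun n : nat => (0 + 2 * n.+1%:R) * rG (1 + 2 * n.+1%:R)) = (fun n => rG (2 + 2 * n%:R)) :> (nat -> R).
    apply/funext => n; have p1 : - 1 < 2 * n.+1%:R :> R by have := n0 n.+1; lra.
    have e : 2 + 2 * n%:R = 2 * n.+1%:R :> R by rewrite -[n.+1%:R]natr1; ring.
    by rewrite e add0r [1 + _]addrC rG_rec.
  have e2 : 0 - 1 + 2 = 1 :> R by ring.
  by rewrite e1 e2.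
have H x : 0 < x -> is_derive x 1 (fun x => expR x * (S x - C x)) 0.
  move=> x0; have e := isd_exp (isd_id x).
  refine (isd_eq (isd_mul e (isd_add (dS x x0) (isd_opp (dC x x0)))) _); ring.
have cst := pos_derive0_cst H.
rewrite mE.
have lim : expR y * (S y - C y) @[y --> 0^'+] --> (1 * (0 * rG (2 + 2 * 0) - 1 * rG (1 + 2 * 0)) : R).
  apply: cvgM.
    have := isd_continuous (isd_exp (isd_id (0 : R))); rewrite /prop_for /continuous_at /= expR0 => h.
    exact: cvg_at_right_filter h.
  apply: cvgB; apply: cvgM.
  - exact: cvg_powR0.
  - exact: fps_lim0 eS.
  - by apply: cvg_near_cst; apply: nearW => y; rewrite powRr0.
  - exact: fps_lim0 eC.
have E : expR u * (S u - C u) = -1.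
  have lim2 : expR y * (S y - C y) @[y --> 0^'+] --> expR u * (S u - C u).
    apply: cvg_near_cst; near=> w.
    have w0 : 0 < w by near: w; exact: nbhs_right_gt.
    exact: (cst w u w0 u0).
  have := cvg_unique (@Rhausdorff R) lim lim2 => <-.
  by rewrite !mulr0 !addr0 mul0r !mul1r sub0r rG_Gamma// Gamma1 invr1.
rewrite expRN; apply: (mulfI (lt0r_neq0 (expR_gt0 u))).
by rewrite E mulrN mulfV// gt_eqF// expR_gt0.
Unshelve. all: by end_near. Qed.

Lemma sin_pi_lt0 alpha : 1 < alpha < 2 -> sin (pi * alpha) < 0.
Proof.
move=> /andP[a1 a2]; have -> : pi * alpha = pi * (alpha - 1) + pi by rewrite mulrBr mulr1 subrK.
by rewrite sinDpi oppr_lt0 sin_pi_gt0//; lra.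
Qed.

Lemma dcm_mlD1_neg alpha : 1 < alpha <= 2 -> dcm (fun x => - mlD alpha 1 x).
Proof.
move=> /andP[a1]; rewrite le_eqVlt => /orP[/eqP ->|a2].
  apply: (eq_dcm _ (dcm_expR (@ltr01 R))) => x x0.
  by rewrite mlD_two// opprK mulr1.
have mp := @measurable_pos R.
have a12 : 1 < alpha < 2 by rewrite a1.
have a02 : 0 < alpha < 2 by rewrite a2 (lt_trans ltr01 a1).
have s0 := sin_pi_lt0 a12; have sN0 : sin (pi * alpha) != 0 by rewrite lt_eqF.
apply: (@eq_dcm _ (fun x => pi^-1 * \int[mu]_(t in pos) (- mlker alpha t * expR (- (x * t))))).
  move=> x x0; have [ki kI] := mlD1_laplace a02 sN0 x0.
  have E t : pos t -> -1 * (mlker alpha t * expR (- (x * t))) = - mlker alpha t * expR (- (x * t)).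
    by move=> _; rewrite mulN1r mulNr.
  by rewrite -(Rint_eq E) (Rint_scale _ mp ki) -kI mulN1r mulrN mulKf// gt_eqF// pi_gt0.
apply: dcm_scale; first by rewrite invr_ge0 pi_ge0.
apply: (dcm_int mp (F := fun t x => - mlker alpha t * expR (- (x * t)))).
  move=> x x0; have [ki kI] := mlD1_laplace a02 sN0 x0.
  by apply: (integ_eq mp _ (integ_opp mp ki)) => t _; rewrite mulNr.
move=> t /in_pos t0; apply: dcm_scale; last exact: dcm_expR.
rewrite /mlker oppr_ge0 -mulrA mulr_le0_ge0 ?(ltW s0)//.
- rewrite mulr_le0_ge0 ?(ltW s0)// addr_ge0// invr_ge0 ltW//.
- by rewrite divr_ge0 ?powR_ge0// ltW// mden_gt0.
Qed.

Lemma dcm_mlD_neg_large alpha beta : 1 < alpha <= 2 -> 1 <= beta -> dcm (fun x => - mlD alpha beta x).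
Proof.
move=> a12; rewrite le_eqVlt => /orP[/eqP <-|b1]; first exact: dcm_mlD1_neg.
have mp := @measurable_pos R; have b0 : 0 < beta - 1 by rewrite subr_gt0.
have a0 : 0 < alpha by case/andP: a12 => h _; lra.
pose F v y := mixw (beta - 1) v * - mlD alpha 1 ((1 + v)^-1 * y).
have E y v : pos v -> -1 * (mixw (beta - 1) v * mlD alpha 1 (y / (1 + v))) = F v y.
  by move=> _; rewrite /F mulN1r mulrN [_^-1 * y]mulrC.
apply: (@eq_dcm _ (fun y => \int[mu]_(v in pos) F v y)).
  move=> y y0; have [ii iI] := mlD_mix a0 b0 y0.
  by rewrite -(Rint_eq (E y)) (Rint_scale _ mp ii) iI mulN1r subrK.
apply: dcm_int => //.
  by move=> y y0; have [ii iI] := mlD_mix a0 b0 y0; apply: (integ_eq mp (E y)); exact: integ_scale.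
move=> v /in_pos v0; apply: dcm_scale; first exact: mixw_ge0.
by apply: (dcm_arg _ (dcm_mlD1_neg a12)); rewrite invr_gt0; lra.
Qed.

Lemma cm_ml_defect alpha beta : 0 < alpha -> alpha != 1 -> 0 < beta ->
  dcm (mlD alpha beta) -> completely_monotonic (ml_defect alpha beta).
Proof.
move=> a0 a1 b0 H; have [h [ch0 chn]] := mlD_chain a0 b0.
have E x : 0 < x -> mlD alpha beta x = ml_defect alpha beta x by move=> x0; rewrite ml_defectE.
apply: (@cm_chain _ _ h); last exact: eq_dcm E H.
by split=> // x x0; rewrite -E// ch0.
Qed.

Lemma cm_ml_defect_opp alpha beta : 0 < alpha -> alpha != 1 -> 0 < beta ->
  dcm (fun x => - mlD alpha beta x) -> completely_monotonic (ml_defect_opp alpha beta).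
Proof.
move=> a0 a1 b0 H; have [h ch] := mlD_chain a0 b0; have [ch0 chn] := derive_chain_opp ch.
have E x : 0 < x -> - mlD alpha beta x = ml_defect_opp alpha beta x.
  by move=> x0; rewrite /ml_defect_opp ml_defectE.
apply: (@cm_chain _ _ (fun n x => - h n x)); last exact: eq_dcm E H.
by split=> // x x0; rewrite -E// ch0.
Qed.

End SuffLarge.

(** * Behaviour at 0 and at infinity *)

Section Necessity.
Context {R : realType}.
Implicit Types (b x c d l alpha beta : R) (f : R -> R).

Lemma cm_mlD_ge0 alpha beta x : 0 < alpha -> alpha != 1 -> 0 < beta ->
  completely_monotonic (ml_defect alpha beta) -> 0 < x -> 0 <= mlD alpha beta x.
Proof.
move=> a0 a1 b0 [_ H] x0; have := H 0 x x0.
by rewrite expr0 mul1r derive1n0 ml_defectE.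
Qed.

Lemma cm_mlD_le0 alpha beta x : 0 < alpha -> alpha != 1 -> 0 < beta ->
  completely_monotonic (ml_defect_opp alpha beta) -> 0 < x -> mlD alpha beta x <= 0.
Proof.
move=> a0 a1 b0 [_ H] x0; have := H 0 x x0.
by rewrite expr0 mul1r derive1n0 /ml_defect_opp ml_defectE// oppr_ge0.
Qed.

Lemma cvg_right_eq f f' (l : R) : (forall x, 0 < x -> f x = f' x) ->
  f x @[x --> 0^'+] --> l -> f' x @[x --> 0^'+] --> l.
Proof.
move=> E; apply: cvg_trans; apply: near_eq_cvg; near=> x; apply: E.
by near: x; exact: nbhs_right_gt.
Unshelve. all: by end_near. Qed.

Lemma fps_lim_eq alpha c a : 0 < alpha -> entire_seq a ->
  x `^ (- c) * fps alpha c a x @[x --> 0^'+] --> a 0.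
Proof.
move=> a0 ea; apply: cvg_right_eq (fps_lim0 a0 ea) => x x0.
by rewrite /fps mulrA powRN mulVf ?mul1r// gt_eqF// powR_gt0.
Qed.

Lemma fps_lim_gt alpha c d a : 0 < alpha -> entire_seq a -> 0 < d + c ->
  x `^ d * fps alpha c a x @[x --> 0^'+] --> (0 : R).
Proof.
move=> a0 ea dc; have H : x `^ (d + c) * psum a (x `^ alpha) @[x --> 0^'+] --> (0 * a 0 : R).
  by apply: cvgM; [exact: cvg_powR0|exact: fps_lim0].
rewrite mul0r in H; apply: cvg_right_eq H => x x0.
by rewrite /fps mulrA powRD// (gt_eqF x0) implybT.
Qed.

(** For alpha < 1 the first series of [mlD] dominates at 0, as x^(alpha - 1) is unbounded; for alpha
    > 1 the constant term of the second does. *)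
Lemma mlD_lim_lt1 alpha beta : 0 < alpha < 1 -> 0 < beta ->
  x `^ (1 - alpha) * mlD alpha beta x @[x --> 0^'+] --> rG (alpha + beta - 1).
Proof.
move=> /andP[a0 a1] b0.
have H1 := fps_lim_eq (alpha - 1) a0 (mlD_entire1 a0 b0).
have d0 : 0 < 1 - alpha + 0 by lra.
have H2 := fps_lim_gt a0 (mlD_entire2 a0 b0) d0.
rewrite opprB mulr0 addr0 in H1; rewrite -[X in _ --> X]subr0.
by apply: cvg_right_eq (cvgB H1 H2) => x x0 /=; rewrite /mlD mulrBr.
Qed.

Lemma mlD_lim_gt1 alpha beta : 1 < alpha -> 0 < beta ->
  mlD alpha beta x @[x --> 0^'+] --> - rG beta.
Proof.
move=> a1 b0; have a0 : 0 < alpha by lra.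
have d0 : 0 < 0 + (alpha - 1) by lra.
have H1 := fps_lim_gt a0 (mlD_entire1 a0 b0) d0.
have H2 := fps_lim_eq 0 a0 (mlD_entire2 a0 b0).
rewrite mulr0 addr0 oppr0 in H2; rewrite -[X in _ --> X]sub0r.
apply: cvg_right_eq (cvgB H1 H2) => x x0; apply/esym.
have E : x `^ 0 * mlD alpha beta x = mlD alpha beta x by rewrite powRr0 mul1r.
by rewrite -[LHS]E /mlD mulrBr.
Qed.

Lemma cvg_right_ge0 f (l : R) : (forall x, 0 < x -> 0 <= f x) -> f x @[x --> 0^'+] --> l -> 0 <= l.
Proof.
move=> f0 fl; rewrite -(cvg_lim (@Rhausdorff R) fl); apply: limr_ge; first exact: cvgP fl.
by near=> x; apply: f0; near: x; exact: nbhs_right_gt.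
Unshelve. all: by end_near. Qed.

Lemma cvg_right_le0 f (l : R) : (forall x, 0 < x -> f x <= 0) -> f x @[x --> 0^'+] --> l -> l <= 0.
Proof.
move=> f0 fl; rewrite -oppr_ge0; apply: (@cvg_right_ge0 (fun x => - f x)).
  by move=> x /f0; rewrite oppr_ge0.
exact: cvgN.
Qed.

(** D itself has the right sign near 0 because of its constant term - 1 / Gamma beta, which two
    derivatives remove. The first series then leads with (alpha - 1) (alpha - 2) x^(alpha - 3) /
    Gamma (alpha + beta - 1), positive for alpha > 2, while the second starts at x^(alpha - 2). *)
Lemma cm_opp_alpha_le2 alpha beta : 0 < alpha -> alpha != 1 -> 0 < beta ->
  completely_monotonic (ml_defect_opp alpha beta) -> alpha <= 2.
Proof.
move=> a0 a1 b0 [_ H]; rewrite leNgt; apply/negP => a2.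
have e1 := mlD_entire1 a0 b0; have e2 := mlD_entire2 a0 b0.
set u := (fun n : nat => rG (alpha + beta - 1 + alpha * n%:R)) in e1.
set w := (fun n : nat => rG (beta + alpha * n%:R)) in e2.
have ch := derive_chain_opp (derive_chain_sub (fps_chain alpha (alpha - 1) e1) (fps_chain alpha 0 e2)).
have ch' : derive_chain (ml_defect_opp alpha beta) (fun n x => - (fps alpha (alpha - 1 - n%:R) (fps_coef alpha (alpha - 1) u n) x - fps alpha (0 - n%:R) (fps_coef alpha 0 w n) x)).
  by split; [move=> x x0; rewrite /ml_defect_opp ml_defectE// /mlD; case: ch => c0 _; rewrite -(c0 x x0)|case: ch].
have eu : entire_seq (fps_coef alpha (alpha - 1) u 2) by do 2!apply: entire_lin.
have ew : entire_seq (fps_coef alpha 0 w 2) by do 2!apply: entire_lin.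
have w0 : fps_coef alpha 0 w 2 0 = 0 by rewrite /= (@subrr R 0) !mulr0 !addr0 mul0r mulr0.
have H2 x : 0 < x -> fps alpha (alpha - 1 - 2) (fps_coef alpha (alpha - 1) u 2) x - fps alpha (0 - 2 + alpha) (fun n => fps_coef alpha 0 w 2 n.+1) x <= 0.
  move=> x0; have := H 2 x x0; rewrite (derive_chainE 2 ch' x0) sqrrN expr1n mul1r oppr_ge0.
  by rewrite (fps_shift alpha (0 - 2) ew x0 w0).
have L1 := fps_lim_eq (alpha - 1 - 2) a0 eu.
have d0 : 0 < - (alpha - 1 - 2) + (0 - 2 + alpha) by lra.
have L2 := fps_lim_gt a0 (entire_shift ew) d0.
have L : x `^ (- (alpha - 1 - 2)) * (fps alpha (alpha - 1 - 2) (fps_coef alpha (alpha - 1) u 2) x - fps alpha (0 - 2 + alpha) (fun n => fps_coef alpha 0 w 2 n.+1) x) @[x --> 0^'+] --> fps_coef alpha (alpha - 1) u 2 0.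
  rewrite -[X in _ --> X]subr0; apply: cvg_right_eq (cvgB L1 L2) => x x0.
  by rewrite mulrBr.
have := cvg_right_le0 _ L; rewrite leNgt => /(_ _)/negP; apply.
  by move=> x x0; rewrite mulr_ge0_le0 ?powR_ge0// H2.
rewrite /= mulr0 !addr0 subr0 /u mulr0 addr0; apply: mulr_gt0; first by lra.
apply: mulr_gt0; first by lra.
by rewrite rG_Gamma ?invr_gt0 ?Gamma_gt0//; lra.
Qed.

End Necessity.

(** * Decay at infinity *)

Section Infinity.
Context {R : realType}.
Notation mu := (@lebesgue_measure R).
Local Notation pos := (`]0, +oo[%classic : set R).
Implicit Types (b x y z c g q v t alpha sg gam : R) (f : R -> R).

Definition decays alpha gam := exists C : R, forall x : R, 0 < x -> `|mlD alpha 1 x| <= C * x `^ (- gam).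

(** The kernel has order t^(alpha - 1) at 0 and t^(- alpha) at infinity; the two conditions on [gam]
    let t^(gam - 1) dominate both. The denominator is bounded below by s^2 for t <= 1 and by s^2
    t^(2 alpha) for t > 1. *)
Lemma mlker_le alpha gam t : 0 < alpha -> sin (pi * alpha) != 0 -> 1 - alpha <= gam <= alpha -> 0 < t ->
  `|mlker alpha t| <= 2 / `|sin (pi * alpha)| * t `^ (gam - 1).
Proof.
move=> a0 s0 /andP[g1 g2] t0; set s := sin (pi * alpha) in s0 *.
have sp : 0 < `|s| by rewrite normr_gt0.
have dp := mden_gt0 t s0.
have q0 : 0 < t `^ alpha by exact: powR_gt0.
have E : `|mlker alpha t| = `|s| * ((1 + t^-1) * t `^ alpha) / mden alpha t.
  rewrite /mlker -/s !normrM normfV (gtr0_norm dp) (gtr0_norm q0) -!mulrA.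
  by congr (_ * (_ * _)); rewrite ger0_norm// addr_ge0// invr_ge0 ltW.
rewrite E ler_pdivrMr//.
have s2 : `|s| * `|s| = s ^+ 2 by rewrite -expr2 real_normK// num_real.
have key : (1 + t^-1) * t `^ alpha * s ^+ 2 <= 2 * t `^ (gam - 1) * mden alpha t.
  have [t1|t1] := leP t 1.
    have h1 : (1 + t^-1) * t `^ alpha <= 2 * t `^ (gam - 1).
      apply: (@le_trans _ _ (2 * t `^ (alpha - 1))).
        rewrite (powR_sub1 _ t0) mulrCA mulrC ler_wpM2l ?(ltW q0)//.
        have : 1 <= t^-1 by rewrite -[leLHS]invr1 lef_pV2 ?posrE.
        lra.
      have -> : t `^ (alpha - 1) = t `^ (alpha - 1 - (gam - 1)) * t `^ (gam - 1).
        by rewrite -powRD ?(gt_eqF t0) ?implybT// subrK.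
      rewrite ler_wpM2l// ler_piMl ?powR_ge0// [leRHS](_ : 1 = 1 `^ (alpha - 1 - (gam - 1))); last by rewrite powR1.
      by apply: ge0_ler_powR; rewrite ?nnegrE ?(ltW t0)//; lra.
    by apply: ler_pM; rewrite ?sqr_ge0 ?mden_ge// mulr_ge0 ?(ltW q0)// addr_ge0// invr_ge0 ltW.
  have h1 : (1 + t^-1) <= 2 * (t `^ (gam - 1) * t `^ alpha).
    apply: (@le_trans _ _ 2).
      have : t^-1 <= 1 by rewrite -[leRHS]invr1 lef_pV2 ?posrE// ltW.
      lra.
    rewrite -powRD ?(gt_eqF t0) ?implybT// ler_peMr//.
    have := @ler_powR R t (ltW t1) 0 (gam - 1 + alpha); rewrite powRr0; apply; lra.
  apply: (@le_trans _ _ (2 * t `^ (gam - 1) * (s ^+ 2 * (t `^ alpha) ^+ 2))); last first.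
    by rewrite ler_wpM2l ?mden_ge'// mulr_ge0 ?powR_ge0.
  have -> : 2 * t `^ (gam - 1) * (s ^+ 2 * (t `^ alpha) ^+ 2) = 2 * (t `^ (gam - 1) * t `^ alpha) * (t `^ alpha * s ^+ 2) by ring.
  by rewrite -[leLHS]mulrA ler_wpM2r// mulr_ge0 ?(ltW q0)// sqr_ge0.
rewrite -(ler_pM2l sp) mulrA s2.
have -> : `|s| * (2 / `|s| * t `^ (gam - 1) * mden alpha t) = 2 * t `^ (gam - 1) * mden alpha t.
  by field; rewrite gt_eqF.
by rewrite mulrC.
Qed.

Lemma decays_lt2 alpha gam : 0 < alpha < 2 -> sin (pi * alpha) != 0 -> 0 < gam ->
  1 - alpha <= gam <= alpha -> decays alpha gam.
Proof.
move=> a02 s0 g0 hg; have mp := @measurable_pos R; have /andP[a0 _] := a02.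
exists (pi^-1 * (2 / `|sin (pi * alpha)| * Gamma gam)) => x x0.
have [ki kI] := mlD1_laplace a02 s0 x0.
set c := 2 / `|sin (pi * alpha)|.
have c0 : 0 <= c by rewrite divr_ge0.
pose h t := c * (t `^ (gam - 1) * expR (- (x * t))).
have f0 t : 0 < t -> 0 <= gint gam t by move=> _; exact: gint_ge0.
have fc t : 0 < t -> {for t, continuous (gint gam)} by exact: gint_cont.
have E t : pos t -> x * gint gam (x * t) = x `^ gam * (t `^ (gam - 1) * expR (- (x * t))).
  move=> /in_pos t0; rewrite /gint powRM ?(ltW x0) ?(ltW t0)//.
  rewrite (_ : x `^ gam = x * x `^ (gam - 1)); first by rewrite !mulrA.
  by rewrite (powR_sub1 _ x0) mulrC divfK// gt_eqF.
have := scale_pos x0 f0 fc; rewrite Gamma_EFin// (Eint_eq E) => /esym H.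
have h0 t : pos t -> 0 <= x `^ gam * (t `^ (gam - 1) * expR (- (x * t))).
  by move=> _; rewrite mulr_ge0 ?powR_ge0// mulr_ge0 ?powR_ge0 ?expR_ge0.
have [|gi gI] := integ_ge0_EFin mp _ h0 H; first by mea.
have xg : 0 < x `^ gam by exact: powR_gt0.
have gi' : integ pos (fun t => t `^ (gam - 1) * expR (- (x * t))).
  by apply: (integ_eq mp _ (integ_scale (x `^ gam)^-1 mp gi)) => t _; rewrite mulKf// gt_eqF.
rewrite (Rint_scale _ mp gi') in gI.
have EI : \int[mu]_(t in pos) (t `^ (gam - 1) * expR (- (x * t))) = Gamma gam * x `^ (- gam).
  by rewrite -gI powRN mulrC mulKf// gt_eqF.
have -> : mlD alpha 1 x = pi^-1 * \int[mu]_(t in pos) (mlker alpha t * expR (- (x * t))).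
  by rewrite -kI mulKf// gt_eqF// pi_gt0.
rewrite normrM ger0_norm ?invr_ge0 ?pi_ge0// -!mulrA ler_wpM2l ?invr_ge0 ?pi_ge0//.
apply: le_trans (Rint_norm mp ki) _; rewrite -EI mulrA -/c -(Rint_scale _ mp gi').
apply: (Rint_le mp (integ_norm mp ki) (integ_scale _ mp gi')) => t /in_pos t0.
rewrite normrM (ger0_norm (expR_ge0 _)) mulrA ler_wpM2r ?expR_ge0//.
exact: mlker_le.
Qed.

Lemma decays_two gam : 0 < gam -> decays 2 gam.
Proof.
move=> g0; exists ((2 * gam) `^ gam) => x x0.
rewrite mlD_two// normrN (ger0_norm (expR_ge0 _)) powRN ler_pdivlMr ?powR_gt0// mulrC.
rewrite expRN ler_pdivrMr ?expR_gt0//; apply: le_trans (powR_le_exp g0 x0) _.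
by rewrite ler_wpM2l ?powR_ge0// ler_expR; lra.
Qed.

(** The mixture of (x / (1 + v))^(- gam) is a Beta integral with p = 1 - gam, finite because gam <
    1. *)
Lemma mlD_decay alpha b gam : 0 < alpha -> 0 < b -> gam < 1 -> decays alpha gam ->
  exists C : R, forall x, 0 < x -> `|mlD alpha (b + 1) x| <= C * x `^ (- gam).
Proof.
move=> a0 b0 g1 [C hC]; have mp := @measurable_pos R.
have g10 : 0 < 1 - gam by lra.
have [bi _] := beta_Gamma g10 b0.
exists (C / Gamma b * \int[mu]_(v in pos) bint (1 - gam) b v) => x x0.
have [ii <-] := mlD_mix a0 b0 x0.
apply: le_trans (Rint_norm mp ii) _.
rewrite [leRHS]mulrAC -(Rint_scale _ mp bi).
apply: (Rint_le mp (integ_norm mp ii) (integ_scale _ mp bi)) => v /in_pos v0.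
have w0 : 0 < 1 + v by lra.
rewrite normrM (ger0_norm (mixw_ge0 _ b0)).
apply: le_trans (ler_wpM2l (mixw_ge0 _ b0) (hC _ (divr_gt0 x0 w0))) _.
rewrite le_eqVlt; apply/orP; left; apply/eqP.
rewrite powRM ?(ltW x0) ?invr_ge0 ?(ltW w0)//.
have -> : (1 + v)^-1 `^ (- gam) = (1 + v) `^ gam by rewrite (invr_powR _ w0) opprK.
rewrite /mixw /bint.
have -> : (1 + v) `^ (- (1 - gam + b)) = (1 + v) `^ (- (1 + b)) * (1 + v) `^ gam.
  rewrite -powRD; last by rewrite (gt_eqF w0) implybT.
  by congr (_ `^ _); ring.
have alg (A B G D X : R) : A * B * G * (C * (X * D)) = C * G * X * (A * (B * D)) by ring.
exact: alg.
Qed.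

Lemma mlD_pow_le alpha b sg x y : 0 < alpha -> 0 < b ->
  (forall z, 0 < z -> 0 <= sg * mlD alpha b z) -> 0 < x -> x <= y ->
  sg * (x `^ b * mlD alpha (b + 1) x) <= sg * (y `^ b * mlD alpha (b + 1) y).
Proof.
move=> a0 b0 h x0 xy.
apply: (@isd_ge0_le R (fun z => sg * (z `^ b * mlD alpha (b + 1) z)) (fun z => sg * (z `^ (b - 1) * mlD alpha b z))) => // z /andP[xz _].
  have z0 : 0 < z by exact: lt_le_trans xz.
  by refine (isd_eq (isd_mul (isd_cst z sg) (mlD_pow_derive a0 b0 z0)) _); rewrite mul0r ?addr0 ?add0r.
have z0 : 0 < z by exact: lt_le_trans xz.
by rewrite mulrCA mulr_ge0 ?powR_ge0// h.
Qed.

(** The function sg x^b D_(b + 1) is nondecreasing and, as gam > b, tends to 0 at infinity; hence it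
    is nonpositive throughout. *)
Lemma mlD_decay_sign alpha b gam sg x : 0 < alpha -> 0 < b -> b < gam < 1 -> decays alpha gam ->
  (forall z, 0 < z -> 0 <= sg * mlD alpha b z) -> 0 < x -> sg * mlD alpha (b + 1) x <= 0.
Proof.
move=> a0 b0 /andP[bg g1] hd h x0; have [C hC] := mlD_decay a0 b0 g1 hd.
rewrite -(pmulr_rle0 _ (powR_gt0 b x0)) mulrCA.
have gb : 0 < gam - b by lra.
have L : `|sg| * C * y `^ (- (gam - b)) @[y --> +oo] --> (`|sg| * C * 0 : R).
  by apply: cvgM; [exact: cvg_cst|exact: cvg_powRN].
rewrite mulr0 in L; rewrite -(cvg_lim (@Rhausdorff R) L); apply: limr_ge; first exact: cvgP L.
near=> y; have xy : x <= y by near: y; apply: nbhs_pinfty_ge; exact: num_real.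
have y0 : 0 < y by exact: lt_le_trans xy.
apply: le_trans (mlD_pow_le a0 b0 h x0 xy) _; apply: le_trans (ler_norm _) _.
rewrite !normrM (ger0_norm (powR_ge0 _ _)) -mulrA ler_wpM2l//.
apply: le_trans (ler_wpM2l (powR_ge0 _ _) (hC _ y0)) _.
rewrite mulrCA -powRD ?(gt_eqF y0) ?implybT// opprB.
by rewrite addrC.
Unshelve. all: by end_near. Qed.

End Infinity.

(** * Lower bounds at infinity for alpha < 1 *)

Section LowerBound.
Context {R : realType}.
Notation mu := (@lebesgue_measure R).
Local Notation pos := (`]0, +oo[%classic : set R).
Implicit Types (b x y z c d p q v t alpha beta : R).

(** For t <= 1 the denominator is at most 4, and 1 + 1 / t is at least 1 / t. *)
Lemma mlker_ge alpha t : 0 < alpha < 1 -> 0 < t <= 1 ->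
  sin (pi * alpha) / 4 * t `^ (alpha - 1) <= mlker alpha t.
Proof.
move=> a01 /andP[t0 t1]; have s0 := sin_pi_gt0 a01; have /andP[a0 a1] := a01.
have dp : 0 < mden alpha t by apply: mden_gt0; rewrite gt_eqF.
have q0 : 0 <= t `^ alpha by exact: powR_ge0.
have q1 : t `^ alpha <= 1.
  rewrite [leRHS](_ : 1 = 1 `^ alpha); last by rewrite powR1.
  by apply: ge0_ler_powR; rewrite ?nnegrE ?(ltW t0) ?(ltW a0).
have d4 : mden alpha t <= 4.
  rewrite /mden; have := cos_max (pi * alpha); rewrite ler_norml => /andP[c1 c2].
  by nra.
have E : t `^ (alpha - 1) = t^-1 * t `^ alpha.
  by rewrite (powR_sub1 _ t0) mulrC.
have i0 : 0 < t^-1 by rewrite invr_gt0.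
rewrite /mlker ler_pdivlMr// E.
have algl (s q i d : R) : s / 4 * (i * q) * d = s * q * (i * (d / 4)) by field.
have algr (s q i : R) : s * (1 + i) * q = s * q * (1 + i) by ring.
rewrite algl algr ler_wpM2l ?mulr_ge0 ?(ltW s0)//.
have : t^-1 * (mden alpha t / 4) <= t^-1 * 1 by rewrite ler_wpM2l ?(ltW i0)// ler_pdivrMr// mul1r.
lra.
Qed.

Lemma mlD1_ge0 alpha x : 0 < alpha < 1 -> 0 < x -> 0 <= mlD alpha 1 x.
Proof.
move=> a01 x0; have s0 := sin_pi_gt0 a01.
have a02 : 0 < alpha < 2 by case/andP: a01 => -> /= h; lra.
have [_ kI] := mlD1_laplace a02 (lt0r_neq0 s0) x0.
rewrite -(pmulr_rge0 _ (pi_gt0 R)) kI; apply: Rint_ge0 => t /in_pos t0.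
by rewrite mulr_ge0 ?expR_ge0// mlker_ge0.
Qed.

(** Only ]0, 1 / x] is kept, where e^(- x t) >= e^(-1) and t^(alpha - 1) integrates to x^(- alpha) /
    alpha. *)
Lemma mlD1_ge alpha : 0 < alpha < 1 -> exists2 c : R, 0 < c & forall x, 1 <= x -> c * x `^ (- alpha) <= mlD alpha 1 x.
Proof.
move=> a01; have s0 := sin_pi_gt0 a01; have /andP[a0 _] := a01.
have a02 : 0 < alpha < 2 by case/andP: a01 => -> /= h; lra.
have mp := @measurable_pos R.
set s := sin (pi * alpha) in s0.
exists (pi^-1 * (s / 4 * expR (-1) / alpha)).
  by rewrite !mulr_gt0 ?invr_gt0 ?pi_gt0 ?expR_gt0.
move=> x x1; have x0 : 0 < x by lra.
have [ki kI] := mlD1_laplace a02 (lt0r_neq0 s0) x0.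
have -> : mlD alpha 1 x = pi^-1 * \int[mu]_(t in pos) (mlker alpha t * expR (- (x * t))).
  by rewrite -kI mulKf// gt_eqF// pi_gt0.
rewrite -[leLHS]mulrA ler_pM2l ?invr_gt0 ?pi_gt0//.
have ix0 : 0 < x^-1 by rewrite invr_gt0.
have mD : measurable (`]0, x^-1]%classic : set R) by exact: measurable_itv.
have sub : `]0, x^-1]%classic `<=` pos by apply: subset_itvl; rewrite bnd_simp.
have k0 t : pos t -> 0 <= mlker alpha t * expR (- (x * t)).
  by move=> /in_pos t0; rewrite mulr_ge0 ?expR_ge0// mlker_ge0.
apply: le_trans (Rint_sub_le mD mp sub ki k0).
have [pi0 pI] := integ_pow01 a0 ix0.
have xa : (x^-1) `^ alpha = x `^ (- alpha) by rewrite (invr_powR _ x0).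
have -> : s / 4 * expR (-1) / alpha * x `^ (- alpha) = s / 4 * expR (-1) * \int[mu]_(t in `]0, x^-1]) t `^ (alpha - 1).
  by rewrite pI xa [in RHS]mulrA mulrAC.
rewrite -(Rint_scale _ mD pi0).
apply: (Rint_le mD (integ_scale _ mD pi0) (integ_sub mD mp sub ki)) => t /=.
rewrite in_itv/= => /andP[t0 tx]; rewrite mulrAC.
have t1 : t <= 1 by apply: le_trans tx _; rewrite invf_le1.
apply: ler_pM.
- by rewrite mulr_ge0 ?powR_ge0// divr_ge0 ?(ltW s0).
- exact: expR_ge0.
- by apply: mlker_ge => //; rewrite t0.
- by rewrite ler_expR lerN2 mulrC -ler_pdivlMr// mul1r.
Qed.

(** Only 0 < v <= 1 is kept in the mixture; x >= 2 then ensures x / (1 + v) >= 1, as [mlD1_ge]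
    requires. *)
Lemma mlD_ge alpha b : 0 < alpha < 1 -> 0 < b ->
  exists2 c : R, 0 < c & forall x, 2 <= x -> c * x `^ (- alpha) <= mlD alpha (b + 1) x.
Proof.
move=> a01 b0; have [c c0 hc] := mlD1_ge a01; have /andP[a0 _] := a01.
have mp := @measurable_pos R; have Gb := Gamma_gt0 b0.
pose e := c * (2 `^ (- (1 + b)) / Gamma b).
have e0 : 0 < e by rewrite /e mulr_gt0// divr_gt0// powR_gt0.
exists (e / b); first by rewrite divr_gt0.
move=> x x2; have x0 : 0 < x by lra.
have [ii <-] := mlD_mix a0 b0 x0.
have mD : measurable (`]0, 1]%classic : set R) by exact: measurable_itv.
have sub : `]0, 1]%classic `<=` pos by apply: subset_itvl; rewrite bnd_simp.
have k0 v : pos v -> 0 <= mixw b v * mlD alpha 1 (x / (1 + v)).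
  move=> /in_pos v0; rewrite mulr_ge0 ?mixw_ge0// mlD1_ge0//.
  by rewrite divr_gt0//; lra.
apply: le_trans (Rint_sub_le mD mp sub ii k0).
have [ip pI] := integ_pow01 b0 (@ltr01 R).
have -> : e / b * x `^ (- alpha) = e * x `^ (- alpha) * \int[mu]_(v in `]0, 1]) v `^ (b - 1).
  by rewrite pI powR1 mul1r mulrAC.
rewrite -(Rint_scale _ mD ip).
apply: (Rint_le mD (integ_scale _ mD ip) (integ_sub mD mp sub ii)) => v /=.
rewrite in_itv/= => /andP[v0 v1]; have w0 : 0 < 1 + v by lra.
have h1 : c * x `^ (- alpha) <= mlD alpha 1 (x / (1 + v)).
  apply: le_trans (hc _ _); last by rewrite ler_pdivlMr//; lra.
  rewrite ler_pM2l// !powRN lef_pV2 ?posrE ?powR_gt0 ?divr_gt0//.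
  apply: ge0_ler_powR; rewrite ?nnegrE ?(ltW a0) ?(ltW x0) ?divr_ge0 ?(ltW x0) ?(ltW w0)//.
  by rewrite ler_pdivrMr// ler_peMr ?(ltW x0)//; lra.
have h2 : v `^ (b - 1) * (2 `^ (- (1 + b)) / Gamma b) <= mixw b v.
  rewrite /mixw /bint mulrA ler_wpM2r ?invr_ge0 ?(ltW Gb)// ler_wpM2l ?powR_ge0//.
  rewrite !powRN lef_pV2 ?posrE ?powR_gt0//.
  by apply: ge0_ler_powR; rewrite ?nnegrE; lra.
have -> : e * x `^ (- alpha) * v `^ (b - 1) = v `^ (b - 1) * (2 `^ (- (1 + b)) / Gamma b) * (c * x `^ (- alpha)).
  rewrite /e; have alg (C P G X V : R) : C * (P / G) * X * V = V * (P / G) * (C * X) by ring.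
  exact: alg.
apply: ler_pM => //; first by rewrite mulr_ge0 ?powR_ge0// divr_ge0 ?powR_ge0 ?(ltW Gb).
by rewrite mulr_ge0 ?powR_ge0 ?(ltW c0).
Qed.

(** The function x^beta D_(beta + 1) would be nonincreasing, hence bounded above on [2, +oo[,
    whereas it is at least c x^(beta - alpha). *)
Lemma mlD_le0_false alpha beta : 0 < alpha < 1 -> alpha < beta ->
  (forall z, 0 < z -> mlD alpha beta z <= 0) -> False.
Proof.
move=> a01 ab h; have /andP[a0 _] := a01; have b0 : 0 < beta by lra.
have [c c0 hc] := mlD_ge a01 b0.
have h' z : 0 < z -> 0 <= (-1) * mlD alpha beta z by move=> /h; rewrite mulN1r oppr_ge0.
have ub y : 2 <= y -> c * y `^ (beta - alpha) <= 2 `^ beta * mlD alpha (beta + 1) 2.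
  move=> y2; have y0 : 0 < y by lra.
  have alg (A B : R) : -1 * A <= -1 * B -> B <= A by lra.
  apply: le_trans (alg _ _ (mlD_pow_le a0 b0 h' (ltr0Sn R 1) y2)).
  rewrite powRD ?(gt_eqF y0) ?implybT// mulrCA ler_wpM2l ?powR_ge0//.
  exact: hc.
have L : y `^ (- (beta - alpha)) * (2 `^ beta * mlD alpha (beta + 1) 2) @[y --> +oo] --> (0 * (2 `^ beta * mlD alpha (beta + 1) 2) : R).
  by apply: cvgM; [apply: cvg_powRN; lra|exact: cvg_cst].
rewrite mul0r in L.
suff : c <= 0 by rewrite leNgt c0.
rewrite -(cvg_lim (@Rhausdorff R) L); apply: limr_ge; first exact: cvgP L.
near=> y; have y2 : 2 <= y by near: y; apply: nbhs_pinfty_ge; exact: num_real.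
have y0 : 0 < y by lra.
by rewrite powRN mulrC ler_pdivlMr ?powR_gt0// ub.
Unshelve. all: by end_near. Qed.

End LowerBound.

Theorem theoremA (R : realType) (alpha beta : R)
    (alpha_gt0 : 0 < alpha) (beta_gt0 : 0 < beta) (alpha_neq1 : alpha != 1) :
  (completely_monotonic (ml_defect alpha beta) <->
     0 < alpha < 1 /\ Num.max alpha (1 - alpha) <= beta) /\
  (completely_monotonic (ml_defect_opp alpha beta) <->
     (1 < alpha <= 2 /\ 1 <= beta) \/
     (0 < alpha < 1 /\ beta <= Num.min alpha (1 - alpha))).
Proof.
have Gb := Gamma_gt0 beta_gt0.
have b1 : 0 < beta + 1 by lra.
(* The continued reciprocal is negative on ]-1, 0[ and vanishes at 0, so the limit at 0 still allows
   beta = 1 - alpha. *)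
have rGle (p : R) : p <= 0 -> - 1 < p -> 0 <= rG p -> p = 0.
  move=> p0 p1; rewrite /rG pmulr_lge0 ?invr_gt0 ?Gamma_gt0//; last by lra.
  by move=> p0'; apply/eqP; rewrite eq_le p0.
split; split.
- move=> cm; have D0 x : 0 < x -> 0 <= mlD alpha beta x by exact: cm_mlD_ge0.
  have a1 : alpha < 1.
    rewrite ltNge; apply/negP => a1; have {}a1 : 1 < alpha by rewrite lt_def alpha_neq1.
    have := cvg_right_ge0 D0 (mlD_lim_gt1 a1 beta_gt0).
    by rewrite rG_Gamma// oppr_ge0 leNgt invr_gt0 Gb.
  have a01 : 0 < alpha < 1 by rewrite alpha_gt0.
  have h1 : 1 - alpha <= beta.
    rewrite leNgt; apply/negP => h.
    have D1 x : 0 < x -> 0 <= x `^ (1 - alpha) * mlD alpha beta x by move=> x0; rewrite mulr_ge0 ?powR_ge0// D0.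
    have := rGle _ _ _ (cvg_right_ge0 D1 (mlD_lim_lt1 a01 beta_gt0)); lra.
  split=> //; rewrite ge_max h1 andbT leNgt; apply/negP => ba.
  (* The midpoint exceeds beta, as the decay of x^beta D_(beta + 1) requires, and lies between 1 -
     alpha and alpha thanks to [h1] and [ba]. *)
  have dec : decays alpha ((beta + alpha) / 2).
    apply: decays_lt2; [lra|by rewrite gt_eqF// sin_pi_gt0|lra|lra].
  have bg : beta < (beta + alpha) / 2 < 1 by lra.
  have D1 x : 0 < x -> 0 <= 1 * mlD alpha beta x by rewrite mul1r; exact: D0.
  have G0 x : 0 < x -> x `^ (1 - alpha) * mlD alpha (beta + 1) x <= 0.
    move=> x0; have := mlD_decay_sign alpha_gt0 beta_gt0 bg dec D1 x0.
    by rewrite mul1r => h; rewrite mulr_ge0_le0 ?powR_ge0.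
  (* Near 0, however, D_(beta + 1) is positive, with leading coefficient 1 / Gamma (alpha +
     beta). *)
  have := cvg_right_le0 G0 (mlD_lim_lt1 a01 b1).
  by rewrite rG_Gamma ?leNgt ?invr_gt0 ?Gamma_gt0//; lra.
- move=> [a01 hb]; apply: cm_ml_defect => //; exact: dcm_mlD_pos.
- move=> cm; have D0 x : 0 < x -> mlD alpha beta x <= 0 by exact: cm_mlD_le0.
  have a2 := cm_opp_alpha_le2 alpha_gt0 alpha_neq1 beta_gt0 cm.
  have [a1|a1] := ltP alpha 1; [right|left].
    have a01 : 0 < alpha < 1 by rewrite alpha_gt0.
    split; first by rewrite alpha_gt0.
    rewrite le_min; apply/andP; split.
      by rewrite leNgt; apply/negP => ab; exact: (mlD_le0_false a01 ab D0).
    rewrite leNgt; apply/negP => h.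
    have D1 x : 0 < x -> x `^ (1 - alpha) * mlD alpha beta x <= 0.
      by move=> x0; rewrite mulr_ge0_le0 ?powR_ge0// D0.
    have := cvg_right_le0 D1 (mlD_lim_lt1 a01 beta_gt0).
    by rewrite rG_Gamma ?leNgt ?invr_gt0 ?Gamma_gt0//; lra.
  have {}a1 : 1 < alpha by rewrite lt_def alpha_neq1.
  split; first by rewrite a1.
  rewrite leNgt; apply/negP => bl1.
  (* An exponent strictly between beta and 1. As alpha > 1, it lies between 1 - alpha and alpha; at
     alpha = 2 every rate is available because D_1 decays exponentially. *)
  have dec : decays alpha ((beta + 1) / 2).
    move: a2; rewrite le_eqVlt => /orP[/eqP ->|a2]; first by apply: decays_two; lra.
    by apply: decays_lt2; [lra|rewrite lt_eqF// sin_pi_lt0// a1|lra|lra].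
  have bg : beta < (beta + 1) / 2 < 1 by lra.
  have D1 x : 0 < x -> 0 <= -1 * mlD alpha beta x by rewrite mulN1r oppr_ge0; exact: D0.
  have G0 x : 0 < x -> 0 <= mlD alpha (beta + 1) x.
    move=> x0; have := mlD_decay_sign alpha_gt0 beta_gt0 bg dec D1 x0.
    by rewrite mulN1r oppr_le0.
  (* The limit of D_(beta + 1) at 0 is - 1 / Gamma (beta + 1) < 0. *)
  have := cvg_right_ge0 G0 (mlD_lim_gt1 a1 b1).
  by rewrite rG_Gamma// oppr_ge0 leNgt invr_gt0 Gamma_gt0.
- case=> [[a12 b]|[a01 hb]]; apply: cm_ml_defect_opp => //; first exact: dcm_mlD_neg_large.
  exact: dcm_mlD_neg.
Qed.
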